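(* Let $C>0$ be a constant independent of $h$, $n$ and $\theta$ with the following one-step property: whenever ${\bf y}_h^n\in[S_h^k]^3$ and $\tau\le\frac1{C\,d_{h,\tau}({\bf y}_h^n)}$, the solution ${\bf y}_h^{n+1}$ of one gradient-flow step starting from ${\bf y}_h^n$ satisfies $E_h({\bf y}_h^{n+1})+\frac1{2\tau}\|{\bf y}_h^{n+1}-{\bf y}_h^n\|_{H_h^2(\Omega)}^2\le E_h({\bf y}_h^n)$ (such a constant exists). Let ${\bf y}_h^0\in[S_h^k]^3$ and assume that $\tau>0$ satisfies $$\tau\le\frac1{C\,d_{h,\tau}({\bf y}_h^0)}.$$ Then the sequence of successive iterates ${\bf y}_h^{n+1}\in[S_h^k]^3$, $n\ge0$, defined by $$\tau^{-1}({\bf y}_h^{n+1}-{\bf y}_h^n,{\bf v}_h)_{H_h^2(\Omega)}+a_h^S({\bf y}_h^n;{\bf y}_h^n,{\bf v}_h)+\theta^2a_h^B({\bf y}_h^{n+1},{\bf v}_h)=0\qquad\forall{\bf v}_h\in[S_h^k]^3,$$ is well-defined. Furthermore, with $\delta{\bf y}_h^{n+1}:={\bf y}_h^{n+1}-{\bf y}_h^n$, $$E_h({\bf y}_h^{N+1})+\frac1{2\tau}\sum_{n=0}^N\|\delta{\bf y}_h^{n+1}\|_{H_h^2(\Omega)}^2\le E_h({\bf y}_h^0)\qquad\forall N\ge0.$$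
   Context: **Domain and data.** $\Omega\subset\mathbb R^2$ is a bounded (connected) Lipschitz domain. $\Sigma\subset\Omega$ is a Lipschitz curve (the crease) meeting $\partial\Omega$ transversely and dividing $\Omega$ into two open subdomains $\Omega_1,\Omega_2$; $\Sigma=\emptyset$ is allowed (no folding). ${\bf g}\in[W^{1,\infty}(\Omega)]^{2\times2}$ is symmetric and uniformly positive definite; $\mu>0$, $\lambda\ge0$, $\gamma>0$, $\theta>0$. **Meshes.** $\{\mathcal T_h\}_{h>0}$ is a shape-regular, quasi-uniform sequence of conforming subdivisions of $\Omega$ with mesh size $h$; each $T\in\mathcal T_h$ is the image of a reference triangle or quadrilateral $\hat T$ under an isoparametric diffeomorphism $\psi_T$ of degree $k$, where $k\ge2$, with $\|D^m\psi_T\|_{L^\infty(\hat T)}\le ch_T^m$ and $\|D^m\psi_T^{-1}\|_{L^\infty(T)}\le ch_T^{-m}$ for $1\le m\le k+1$, $c$ independent of $h$ and $T$. The crease is resolved by the mesh: $\Sigma$ is a union of edges. $\mathcal E_h^0$ is the set of interior edges, $\mathcal E_h^\Sigma\subset\mathcal E_h^0$ the edges along $\Sigma$, $\Gamma_h^0$ the union of the interior edges; $L^2(\Gamma_h^0\setminus\Sigma)$ refers to the edges in $\mathcal E_h^0\setminus\mathcal E_h^\Sigma$. The mesh function ${\rm h}$ equals $h_T=\mathrm{diam}(T)$ on $T$ and $h_e=\mathrm{diam}(e)$ on $e$; $h_{\min}:=\min_{T\in\mathcal T_h}h_T$. **Space.** $S_h^k:=\{v_h\in C^0(\overline\Omega):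 v_h|_T=\hat v\circ\psi_T^{-1},\ \hat v\in\mathbb P_k(\hat T)\ (\text{resp. }\mathbb Q_k(\hat T))\ \forall T\in\mathcal T_h\}$, with $\mathbb P_k$ polynomials of total degree $\le k$ (triangles) and $\mathbb Q_k$ polynomials of degree $\le k$ in each variable (quadrilaterals). **Jumps, averages.** For $e\in\mathcal E_h^0$ with fixed unit normal ${\bf n}_e$ and ${\bf x}\in e$, $w^\pm({\bf x}):=\lim_{s\to0^+}w({\bf x}\pm s{\bf n}_e)$, $[w]:=w^--w^+$, $\{w\}:=\frac12(w^++w^-)$, componentwise for vectors and matrices. **Discrete inner product.** $(v_h,w_h)_{H_h^2(\Omega)}:=(D_h^2v_h,D_h^2w_h)_{L^2(\Omega)}+({\rm h}^{-1}[\nabla v_h],[\nabla w_h])_{L^2(\Gamma_h^0\setminus\Sigma)}+(v_h,w_h)_{L^2(\Omega)}$, with $D_h^2$ the elementwise Hessian; summed over components on $[S_h^k]^3$; $\|{\bf v}_h\|_{H_h^2(\Omega)}^2:=({\bf v}_h,{\bf v}_h)_{H_h^2(\Omega)}$. **Discrete Hessian.** For an integer $\ell\ge0$, $V_h^\ell:=\{v_h\in L^2(\Omega): v_h|_T=\hat v\circ\psi_T^{-1},\ \hat v\in\mathbb P_\ell(\hat T)\ (\text{resp. }\mathbb Q_\ell(\hat T))\ \forall T\}$. For $e\in\mathcal E_h^0\setminus\mathcal E_h^\Sigma$, with $\omega_e$ the union of the two elements sharing $e$, $r_e:[L^2(e)]^2\to[V_h^\ell]^{2\times2}$ is defined by: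 $r_e(\phi)$ vanishes outside $\omega_e$ and $\int_{\omega_e}r_e(\phi):\boldsymbol\tau_h=\int_e\{\boldsymbol\tau_h\}{\bf n}_e\cdot\phi$ for all $\boldsymbol\tau_h\in[V_h^\ell]^{2\times2}$. Set $R_h:=\sum_{e\in\mathcal E_h^0\setminus\mathcal E_h^\Sigma}r_e$ and $H_h(v_h):=D_h^2v_h-R_h([\nabla v_h])$, componentwise on $[S_h^k]^3$. **Tensor notation.** $(\nabla{\bf y})_{ij}=\partial_jy_i$. For ${\bf A}=({\bf A}_m)_{m=1}^3$, ${\bf A}_m\in\mathbb R^{2\times2}$, ${\bf B}\in\mathbb R^{2\times2}$: ${\bf BAB}=({\bf BA}_m{\bf B})_m$, ${\rm tr}({\bf A})=({\rm tr}\,{\bf A}_m)_m\in\mathbb R^3$, $|{\bf A}|^2=\sum_m|{\bf A}_m|^2$ (Frobenius); products $:$ of such tensors and products of traces are summed over $m$, and ${\rm tr}({\bf A})^2=\sum_m({\rm tr}\,{\bf A}_m)^2$. **Discrete energy.** $E_h=E_h^S+\theta^2E_h^B$ with $$E_h^S({\bf y}_h)=\tfrac18\int_\Omega\Big(2\mu|{\bf g}^{-1/2}(\nabla{\bf y}_h^T\nabla{\bf y}_h-{\bf g}){\bf g}^{-1/2}|^2+\lambda\,{\rm tr}({\bf g}^{-1/2}(\nabla{\bf y}_h^T\nabla{\bf y}_h-{\bf g}){\bf g}^{-1/2})^2\Big),$$ $$E_h^B({\bf y}_h)=\tfrac1{24}\int_\Omega\Big(2\mu|{\bf g}^{-1/2}H_h({\bf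 y}_h){\bf g}^{-1/2}|^2+\tfrac{2\mu\lambda}{2\mu+\lambda}{\rm tr}({\bf g}^{-1/2}H_h({\bf y}_h){\bf g}^{-1/2})^2\Big)+\tfrac\gamma2\|{\rm h}^{-1/2}[\nabla{\bf y}_h]\|_{L^2(\Gamma_h^0\setminus\Sigma)}^2.$$ **Forms.** $$a_h^B({\bf y}_h,{\bf v}_h)=\tfrac\mu6\int_\Omega({\bf g}^{-1/2}H_h({\bf y}_h){\bf g}^{-1/2}):({\bf g}^{-1/2}H_h({\bf v}_h){\bf g}^{-1/2})+\tfrac{\mu\lambda}{6(2\mu+\lambda)}\int_\Omega{\rm tr}({\bf g}^{-1/2}H_h({\bf y}_h){\bf g}^{-1/2})\,{\rm tr}({\bf g}^{-1/2}H_h({\bf v}_h){\bf g}^{-1/2})+\gamma({\rm h}^{-1}[\nabla{\bf y}_h],[\nabla{\bf v}_h])_{L^2(\Gamma_h^0\setminus\Sigma)},$$ $$a_h^S({\bf z}_h;{\bf y}_h,{\bf v}_h)=\tfrac\mu2\int_\Omega\big({\bf g}^{-1/2}(\nabla{\bf v}_h^T\nabla{\bf y}_h+\nabla{\bf y}_h^T\nabla{\bf v}_h){\bf g}^{-1/2}\big):\big({\bf g}^{-1/2}(\nabla{\bf z}_h^T\nabla{\bf z}_h-{\bf g}){\bf g}^{-1/2}\big)+\tfrac\lambda4\int_\Omega{\rm tr}\big({\bf g}^{-1/2}(\nabla{\bf v}_h^T\nabla{\bf y}_h+\nabla{\bf y}_h^T\nabla{\bf v}_h){\bf g}^{-1/2}\big)\,{\rm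 tr}\big({\bf g}^{-1/2}(\nabla{\bf z}_h^T\nabla{\bf z}_h-{\bf g}){\bf g}^{-1/2}\big).$$ **Time-step quantity.** $d_{h,\tau}({\bf y}_h):=\big(1+\tau^2E_h({\bf y}_h)\big)h_{\min}^{-1}\big(1+E_h({\bf y}_h)^{1/2}\big)+\tau E_h({\bf y}_h)+E_h({\bf y}_h)^{1/2}$. **One gradient-flow step** starting from ${\bf y}_h^n$ means solving the displayed linear problem in the claim for ${\bf y}_h^{n+1}$. *)

(* Defs.v *)
(* Points of the plane are pairs R * R, with the product topology and the
   product Lebesgue measure. *)
From HB Require Import structures.
From mathcomp Require Import all_boot all_order all_algebra.
From mathcomp Require Import all_classical all_reals all_analysis.
Set Implicit Arguments.
Unset Strict Implicit.
Unset Printing Implicit Defensive.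
Import Order.TTheory GRing.Theory Num.Theory.
Import numFieldNormedType.Exports.
Local Open Scope classical_set_scope.
Local Open Scope ring_scope.

Section Plane.
Context {R : realType}.
Implicit Types (x y : R * R) (A W : set (R * R)) (f : R * R -> R).

(* The library norm of R * R is the maximum norm; this is the Euclidean one. *)
Definition enorm x : R := Num.sqrt (x.1 ^+ 2 + x.2 ^+ 2).

Definition diam A : R :=
  sup [set r | exists x y, [/\ A x, A y & r = enorm (x - y)]].

Definition rotr90 x : R * R := (x.2, - x.1).

Definition evec (j : 'I_2) : R * R := if j == ord0 then (1, 0) else (0, 1).

Definition pd (j : 'I_2) f : R * R -> R := fun x => 'D_(evec j) f x.

(* The entries of the tensor D^m f are the [pds s f] with [size s = m]. *)
Definition pds (s : seq 'I_2) f : R * R -> R := foldr pd f s.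

Definition Cm_on (m : nat) W f : Prop :=
  forall s, (size s <= m)%N -> forall x, W x ->
    {for x, continuous (pds s f)} /\
    ((size s < m)%N -> forall j, derivable (pds s f) x (evec j)).

Definition mu2 := (@lebesgue_measure R \x @lebesgue_measure R)%E.

(* [quad = false]: total degree at most k; [quad = true]: degree at most k in
   each variable. *)
Definition poly_fun (quad : bool) (k : nat) f : Prop :=
  exists c : 'M[R]_k.+1, forall x,
    f x = \sum_(i < k.+1) \sum_(j < k.+1 | quad || (i + j <= k)%N)
            c i j * x.1 ^+ i * x.2 ^+ j.

Definition lipschitz_domain (Om : set (R * R)) : Prop :=
  [/\ open Om, connected Om, Om !=set0, bounded_set Om &
      forall p, (closure Om `\` Om) p ->
      exists (u : R * R) (r s L : R) (phi : R -> R),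
        [/\ enorm u = 1, 0 < r, 0 < s, L.-lipschitz phi &
            forall a b, `|a| < r -> `|b| < s ->
              Om (p + a *: u + b *: rotr90 u) <-> phi a < b]].

(* A nonempty crease is an injective Lipschitz arc c without its end points;
   the end points lie on the boundary.  The bound with [alpha] says that the
   arc is nontangential to the boundary at both of them, which is
   transversality when tangents need not exist. *)
Definition crease (Om Sig : set (R * R)) : Prop :=
  Sig = set0 \/
  exists (c : R -> R * R) (L alpha : R) (Om1 Om2 : set (R * R)),
    [/\ [/\ L.-lipschitz_`[0, 1] c, {in `[0, 1] &, injective c},
            Sig = c @` `]0, 1[ & Sig `<=` Om],
        [/\ (closure Om `\` Om) (c 0), (closure Om `\` Om) (c 1), 0 < alpha &
            forall t q, t \in `]0, 1[ -> (closure Om `\` Om) q ->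
              alpha * Num.min (enorm (c t - c 0)) (enorm (c t - c 1))
                <= enorm (c t - q)],
        [/\ open Om1, connected Om1 & Om1 !=set0],
        [/\ open Om2, connected Om2 & Om2 !=set0] &
        Om1 `&` Om2 = set0 /\ Om `\` Sig = Om1 `|` Om2].

Definition Linfty (Om : set (R * R)) f : Prop := f \_ Om \in Lfun mu2 +oo%E.

Definition test_function (Om : set (R * R)) f : Prop :=
  (forall m, Cm_on m setT f) /\
  exists K, [/\ compact K, K `<=` Om & forall x, ~ K x -> f x = 0].

Definition W1infty (Om : set (R * R)) f : Prop :=
  Linfty Om f /\
  forall j, exists w, Linfty Om w /\
    forall phi, test_function Om phi ->
      \int[mu2]_(x in Om) (f x * pd j phi x) =
      - \int[mu2]_(x in Om) (w x * phi x).

Definition posdef (A : 'M[R]_2) : Prop :=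
  A^T = A /\ forall xi : 'cV[R]_2, xi != 0 -> 0 < (xi^T *m A *m xi) ord0 ord0.

(* A^(-1/2): the positive definite square root of the inverse *)
Definition invsqrtmx (A : 'M[R]_2) : 'M[R]_2 :=
  xget 1%:M [set B | posdef B /\ B *m B = invmx A].

Definition metric_field (Om : set (R * R)) (g : R * R -> 'M[R]_2) : Prop :=
  [/\ forall i j, W1infty Om (fun x => g x i j),
      forall x, Om x -> (g x)^T = g x &
      exists2 c0 : R, 0 < c0 & forall x, Om x -> forall xi : 'cV[R]_2,
        c0 * (xi^T *m xi) ord0 ord0 <= (xi^T *m g x *m xi) ord0 ord0].

Definition frob (m n : nat) (A B : 'M[R]_(m, n)) : R :=
  \sum_i \sum_j A i j * B i j.

End Plane.

Section Mesh.
Context {R : realType}.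

Record element := Element { is_quad : bool; emap : R * R -> R * R }.

Definition ref_elem (q : bool) : set (R * R) :=
  [set x | if q then (0 <= x.1 <= 1) && (0 <= x.2 <= 1)
           else [&& 0 <= x.1, 0 <= x.2 & x.1 + x.2 <= 1]].

Definition nvert (q : bool) : nat := if q then 4 else 3.

(* vertices in counterclockwise order *)
Definition ref_vertex (q : bool) (i : nat) : R * R :=
  nth 0 (if q then [:: (0, 0); (1, 0); (1, 1); (0, 1)]
         else [:: (0, 0); (1, 0); (0, 1)]) (i %% nvert q).

Definition elem_set (T : element) : set (R * R) :=
  emap T @` ref_elem (is_quad T).

Definition vertex (T : element) (i : nat) : R * R :=
  emap T (ref_vertex (is_quad T) i).

Definition edge_par (T : element) (i : nat) (t : R) : R * R :=
  emap T ((1 - t) *: ref_vertex (is_quad T) i +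
          t *: ref_vertex (is_quad T) i.+1).

Definition edge_set (T : element) (i : nat) : set (R * R) :=
  edge_par T i @` `[0, 1].

Definition hT (T : element) : R := diam (elem_set T).

(* The diffeomorphism property of emap T from the (closed) reference element
   onto T is that of an extension to open neighbourhoods U and W, with inverse
   psi'.  The tensor norms are the maxima of the entries. *)
Definition isoparametric (k : nat) (c : R) (T : element) : Prop :=
  let psi := emap T in
  [/\ poly_fun (is_quad T) k (fst \o psi), poly_fun (is_quad T) k (snd \o psi),
      forall s x, (1 <= size s <= k.+1)%N -> ref_elem (is_quad T) x ->
        `|pds s (fst \o psi) x| <= c * hT T ^+ size s /\
        `|pds s (snd \o psi) x| <= c * hT T ^+ size s &
      exists (U W : set (R * R)) (psi' : R * R -> R * R),
      [/\ [/\ open U, ref_elem (is_quad T) `<=` U, open W &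
              elem_set T `<=` W],
          forall x, U x -> W (psi x) /\ psi' (psi x) = x,
          forall y, W y -> U (psi' y) /\ psi (psi' y) = y,
          Cm_on k.+1 W (fst \o psi') /\ Cm_on k.+1 W (snd \o psi') &
          forall s y, (1 <= size s <= k.+1)%N -> elem_set T y ->
            `|pds s (fst \o psi') y| <= c * hT T ^- size s /\
            `|pds s (snd \o psi') y| <= c * hT T ^- size s]].

Definition ledge (n : nat) : finType := ('I_n * 'I_4)%type.

(* [normal_flip] fixes the orientation of the unit normal of each edge. *)
Record mesh := Mesh {
  nelem : nat;
  elt : 'I_nelem -> element;
  normal_flip : ledge nelem * ledge nelem -> bool }.

(* An edge is interior when it is shared by two elements; it is represented
   once, by its two local descriptions, the smaller element index first. *)
Definition edge (M : mesh) : finType :=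
  (ledge (nelem M) * ledge (nelem M))%type.

Definition is_ledge (M : mesh) (l : ledge (nelem M)) : bool :=
  (l.2 < nvert (is_quad (elt l.1)))%N.

Definition edge_pts (M : mesh) (e : edge M) : set (R * R) :=
  edge_set (elt e.1.1) e.1.2.

Definition interior_edges (M : mesh) : {set edge M} :=
  [set e : edge M | [&& (e.1.1 < e.2.1)%N, is_ledge e.1, is_ledge e.2 &
     `[< edge_set (elt e.1.1) e.1.2 = edge_set (elt e.2.1) e.2.2 >]]].

Definition crease_edges (M : mesh) (Sig : set (R * R)) : {set edge M} :=
  [set e in interior_edges M | `[< edge_pts e `<=` closure Sig >]].

Definition free_edges (M : mesh) (Sig : set (R * R)) : {set edge M} :=
  interior_edges M :\: crease_edges M Sig.

Definition conforming (Om : set (R * R)) (M : mesh) : Prop :=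
  \bigcup_(T in [set: 'I_(nelem M)]) elem_set (elt T) = closure Om /\
  forall T T' : 'I_(nelem M), T != T' ->
    let I := elem_set (elt T) `&` elem_set (elt T') in
    [\/ I = set0,
        exists i j : nat,
          I = [set vertex (elt T) i] /\ vertex (elt T) i = vertex (elt T') j |
        exists i j : nat,
          I = edge_set (elt T) i /\ edge_set (elt T) i = edge_set (elt T') j].

(* The crease is open at its end points, the edges are closed. *)
Definition resolves (M : mesh) (Sig : set (R * R)) : Prop :=
  closure Sig = \bigcup_(e in [set` crease_edges M Sig]) edge_pts e.

Definition mesh_size (M : mesh) : R :=
  sup (range (fun T : 'I_(nelem M) => hT (elt T))).

Definition hmin (M : mesh) : R :=
  inf (range (fun T : 'I_(nelem M) => hT (elt T))).

(* The meshes of the sequence are indexed by their mesh size h in H. *)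
Definition mesh_sequence (Om Sig : set (R * R)) (k : nat) (H : set R)
    (M : R -> mesh) : Prop :=
  [/\ forall h, H h -> [/\ 0 < h, mesh_size (M h) = h, conforming Om (M h) &
        resolves (M h) Sig],
      exists2 c, 0 < c & forall h, H h -> forall T,
        isoparametric k c (@elt (M h) T),
      exists2 c, 0 < c & forall h, H h -> forall T, exists x : R * R,
        [set y | enorm (y - x) < c * hT (@elt (M h) T)]
          `<=` elem_set (@elt (M h) T) &
      exists2 c, 0 < c & forall h, H h -> forall T,
        c * h <= hT (@elt (M h) T)].

End Mesh.
Arguments element R : clear implicits.
Arguments mesh R : clear implicits.

Section Discrete.
Context {R : realType}.
Variables (Om Sig : set (R * R)) (M : mesh R).

Definition Sh (k : nat) (v : R * R -> R) : Prop :=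
  {within closure Om, continuous v} /\
  forall T : 'I_(nelem M), exists2 p, poly_fun (is_quad (elt T)) k p &
    forall x, ref_elem (is_quad (elt T)) x -> v (emap (elt T) x) = p x.

Definition Sh3 (k : nat) (y : 'I_3 -> R * R -> R) : Prop :=
  forall m, Sh k (y m).

Definition mesh_interior : set (R * R) :=
  \bigcup_(T in [set: 'I_(nelem M)]) (elem_set (elt T))°.

(* Piecewise functions live in the open elements; the representative that
   vanishes on the (null) mesh skeleton is used throughout. *)
Definition grad (v : R * R -> R) (x : R * R) : 'cV[R]_2 :=
  \col_j (pd j v \_ mesh_interior) x.

Definition hess (v : R * R -> R) (x : R * R) : 'M[R]_2 :=
  \matrix_(i, j) (pd i (pd j v) \_ mesh_interior) x.

Definition jac (y : 'I_3 -> R * R -> R) (x : R * R) : 'M[R]_(3, 2) :=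
  \matrix_(i, j) grad (y i) x j ord0.

Definition Vh (l : nat) (v : R * R -> R) : Prop :=
  (forall x, ~ mesh_interior x -> v x = 0) /\
  forall T : 'I_(nelem M), exists2 p, poly_fun (is_quad (elt T)) l p &
    forall x, ref_elem (is_quad (elt T)) x ->
      (elem_set (elt T))° (emap (elt T) x) -> v (emap (elt T) x) = p x.

(* Functions on an edge are written in the parameter t of [epar] below, the
   end points of the edge (t = 0, 1) being left out. *)
Definition epar (e : edge M) : R -> R * R := edge_par (elt e.1.1) e.1.2.

Definition epar' (e : edge M) (t : R) : R * R :=
  (derive1 (fst \o epar e) t, derive1 (snd \o epar e) t).

Definition int_edge (e : edge M) (f : R -> R) : R :=
  \int[lebesgue_measure]_(t in `]0, 1[) (f t * enorm (epar' e t)).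

Definition he (e : edge M) : R := diam (edge_pts e).

Definition normal (e : edge M) (t : R) : R * R :=
  ((-1) ^+ normal_flip e / enorm (epar' e t)) *: rotr90 (epar' e t).

Definition side_plus (e : edge M) (w : R * R -> R) (t : R) : R :=
  lim (w (epar e t + s *: normal e t) @[s --> 0^'+]).

Definition side_minus (e : edge M) (w : R * R -> R) (t : R) : R :=
  lim (w (epar e t - s *: normal e t) @[s --> 0^'+]).

Definition jump (e : edge M) (w : R * R -> R) (t : R) : R :=
  side_minus e w t - side_plus e w t.

Definition avg (e : edge M) (w : R * R -> R) (t : R) : R :=
  2^-1 * (side_plus e w t + side_minus e w t).

Definition jump_grad (e : edge M) (v : R * R -> R) (t : R) : 'cV[R]_2 :=
  \col_j jump e (fun x => grad v x j ord0) t.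

Definition avg_mx (e : edge M) (tau : R * R -> 'M[R]_2) (t : R) : 'M[R]_2 :=
  \matrix_(i, j) avg e (fun x => tau x i j) t.

Definition normal_col (e : edge M) (t : R) : 'cV[R]_2 :=
  \col_j (if j == ord0 then (normal e t).1 else (normal e t).2).

Definition edge_patch (e : edge M) : set (R * R) :=
  elem_set (elt e.1.1) `|` elem_set (elt e.2.1).

Definition Vh22 (l : nat) (tau : R * R -> 'M[R]_2) : Prop :=
  forall i j, Vh l (fun x => tau x i j).

Definition lifting (l : nat) (e : edge M) (phi : R -> 'cV[R]_2) :
    R * R -> 'M[R]_2 :=
  xget (fun=> 0) [set r | [/\ Vh22 l r,
    forall x, ~ edge_patch e x -> r x = 0 &
    forall tau, Vh22 l tau ->
      \int[mu2]_(x in edge_patch e) frob (r x) (tau x) =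
      int_edge e (fun t =>
        frob (avg_mx e tau t *m normal_col e t) (phi t))]].

Definition dhess (l : nat) (v : R * R -> R) (x : R * R) : 'M[R]_2 :=
  hess v x - \sum_(e in free_edges M Sig) lifting l e (jump_grad e v) x.

(* (h^-1 [grad v], [grad w]) over the edges off the crease *)
Definition jump_form (v w : R * R -> R) : R :=
  \sum_(e in free_edges M Sig)
    (he e)^-1 * int_edge e (fun t => frob (jump_grad e v t) (jump_grad e w t)).

Definition H2_form (v w : R * R -> R) : R :=
  \int[mu2]_(x in Om) frob (hess v x) (hess w x) + jump_form v w +
  \int[mu2]_(x in Om) (v x * w x).

Definition H2_inner (y v : 'I_3 -> R * R -> R) : R := \sum_m H2_form (y m) (v m).

Variables (g : R * R -> 'M[R]_2) (mu lambda gamma theta : R) (l : nat).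

Definition gconj (A : R * R -> 'M[R]_2) (x : R * R) : 'M[R]_2 :=
  invsqrtmx (g x) *m A x *m invsqrtmx (g x).

Definition Hg (v : R * R -> R) : R * R -> 'M[R]_2 := gconj (dhess l v).

Definition strain (y : 'I_3 -> R * R -> R) : R * R -> 'M[R]_2 :=
  gconj (fun x => (jac y x)^T *m jac y x - g x).

Definition dstrain (y v : 'I_3 -> R * R -> R) : R * R -> 'M[R]_2 :=
  gconj (fun x => (jac v x)^T *m jac y x + (jac y x)^T *m jac v x).

Definition energyS (y : 'I_3 -> R * R -> R) : R :=
  8^-1 * \int[mu2]_(x in Om)
    (2 * mu * frob (strain y x) (strain y x) + lambda * \tr (strain y x) ^+ 2).

Definition energyB (y : 'I_3 -> R * R -> R) : R :=
  24^-1 * \int[mu2]_(x in Om)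
    (2 * mu * (\sum_m frob (Hg (y m) x) (Hg (y m) x)) +
     2 * mu * lambda / (2 * mu + lambda) * (\sum_m \tr (Hg (y m) x) ^+ 2)) +
  gamma / 2 * \sum_m jump_form (y m) (y m).

Definition energy (y : 'I_3 -> R * R -> R) : R :=
  energyS y + theta ^+ 2 * energyB y.

Definition aB (y v : 'I_3 -> R * R -> R) : R :=
  mu / 6 * \int[mu2]_(x in Om) (\sum_m frob (Hg (y m) x) (Hg (v m) x)) +
  mu * lambda / (6 * (2 * mu + lambda)) *
    \int[mu2]_(x in Om) (\sum_m \tr (Hg (y m) x) * \tr (Hg (v m) x)) +
  gamma * \sum_m jump_form (y m) (v m).

Definition aS (z y v : 'I_3 -> R * R -> R) : R :=
  mu / 2 * \int[mu2]_(x in Om) frob (dstrain y v x) (strain z x) +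
  lambda / 4 * \int[mu2]_(x in Om) (\tr (dstrain y v x) * \tr (strain z x)).

Definition dstep (tau : R) (y : 'I_3 -> R * R -> R) : R :=
  (1 + tau ^+ 2 * energy y) * (hmin M)^-1 * (1 + Num.sqrt (energy y)) +
  tau * energy y + Num.sqrt (energy y).

Definition flow_step (k : nat) (tau : R) (y z : 'I_3 -> R * R -> R) : Prop :=
  Sh3 k z /\
  forall v, Sh3 k v ->
    tau^-1 * H2_inner (fun m => z m \- y m) v + aS y y v
      + theta ^+ 2 * aB z v = 0.

End Discrete.

(* Main.v *)
Require Import Defs.
From mathcomp Require Import all_boot all_order all_algebra.
From mathcomp Require Import all_classical all_reals all_analysis.
From mathcomp Require Import ring lra.
Import Order.TTheory GRing.Theory Num.Theory.
Import numFieldNormedType.Exports.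
Import measurable_realfun.
Local Open Scope classical_set_scope.
Local Open Scope ring_scope.
Set Implicit Arguments.
Unset Strict Implicit.
Unset Printing Implicit Defensive.

(** One step of the flow is a linear problem
    [tau^-1 (z, v) + theta^2 aB z v = tau^-1 (y, v) - aS y y v] on the
    finite-dimensional space of discrete deformations.  Its form is symmetric
    and nonnegative, and it vanishes at [(u, u)] only if the [L^2] norm of [u]
    does, that is, if [u = 0] on the closed domain ([Sh_L2_eq0],
    [step_form_eq0]).  The Gram matrix of the problem therefore has the load
    vector in its row space ([galerkin]); this gives existence, and definiteness
    gives uniqueness.

    The work lies in the bilinearity of the forms, since integrals, one-sided
    limits and liftings are total operations that are additive only where they
    are well-behaved.
    - Gradients, Hessians and discrete tensor fields extend continuously from
      every open element to the closed one ([pw]), because the element maps are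
      [C^2] diffeomorphisms up to the boundary ([regular]).  They are thus
      bounded and measurable.
    - Jumps and averages are linear because the one-sided limits exist
      ([traces]).  Indeed, off its end points, the normal line of an interior
      edge crosses from one neighbouring element into the other
      ([normal_sides]): the affine equation of the side in reference
      coordinates vanishes along the edge and has nonzero gradient there, so
      its normal derivative is nonzero, and two elements cannot lie on the
      same side of their common edge.
    - The lifting of a jump is the solution of a linear problem of the same
      kind, on the two elements at the edge ([lifting_exists],
      [lifting_unique]), and depends linearly on the jump ([lifting_lin]).
    - The inverse square root of the metric is given by an explicit formula
      ([invsqrtmxE]), so it is measurable, and uniform positivity bounds it
      ([invsqrtmx_bound]).

    As for the energy, the one-step estimate makes it nonincreasing as long as
    the step size is admissible.  Since the bound on the step size depends on
    the iterate only through its energy, and relaxes when the energy decreases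
    ([time_step_mono]), the step size remains admissible along the whole
    sequence, and the one-step estimates add up ([telescope_descent]). *)

(** * Bounded measurable functions and plane Lebesgue measure *)

Section BoundedMeasurable.
Context {d : measure_display} {T : measurableType d} {R : realType}.
Implicit Types (D : set T) (f g : T -> R).

(** Bounded measurable functions on [D].  On such functions, the real-valued
    integral over a set of finite measure is linear. *)
Definition bmeas D f : Prop :=
  measurable_fun D f /\ exists K : R, forall x, D x -> `|f x| <= K.

Lemma bmeas_ext D f g : (forall x, D x -> f x = g x) -> bmeas D f -> bmeas D g.
Proof.
move=> fg [mf [K hK]]; split.
  by apply: (eq_measurable_fun f) => // x; rewrite inE => /fg.
by exists K => x Dx; rewrite -fg// hK.
Qed.

Lemma bmeas_cst D (c : R) : bmeas D (fun=> c).
Proof. by split; [exact: measurable_cst|exists `|c|]. Qed.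

Lemma bmeasD D f g : bmeas D f -> bmeas D g -> bmeas D (fun x => f x + g x).
Proof.
move=> [mf [K hK]] [mg [L hL]]; split; first exact: measurable_funD.
by exists (K + L) => x Dx; rewrite (le_trans (ler_normD _ _))// lerD ?hK ?hL.
Qed.

Lemma bmeasM D f g : bmeas D f -> bmeas D g -> bmeas D (fun x => f x * g x).
Proof.
move=> [mf [K hK]] [mg [L hL]]; split; first exact: measurable_funM.
by exists (K * L) => x Dx; rewrite normrM ler_pM ?hK ?hL.
Qed.

Lemma bmeasZ D (a : R) f : bmeas D f -> bmeas D (fun x => a * f x).
Proof. by move=> hf; apply: bmeasM => //; exact: bmeas_cst. Qed.

Lemma bmeas_sum (I : Type) (r : seq I) (P : pred I) D (F : I -> T -> R) :
  (forall i, P i -> bmeas D (F i)) -> bmeas D (fun x => \sum_(i <- r | P i) F i x).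
Proof.
move=> hF; elim: r => [|i r IH].
  by apply: bmeas_ext (bmeas_cst D 0) => x _; rewrite big_nil.
case Pi: (P i); last by apply: bmeas_ext IH => x _; rewrite big_cons Pi.
by apply: bmeas_ext (bmeasD (hF i Pi) IH) => x _; rewrite big_cons Pi.
Qed.

Lemma bmeas_frob D (m n : nat) (A B : T -> 'M[R]_(m, n)) :
  (forall i j, bmeas D (fun x => A x i j)) ->
  (forall i j, bmeas D (fun x => B x i j)) ->
  bmeas D (fun x => frob (A x) (B x)).
Proof.
move=> hA hB; do 2 (apply: bmeas_sum => ? _); exact: bmeasM.
Qed.

Lemma bmeas_tr D (n : nat) (A : T -> 'M[R]_n) :
  (forall i j, bmeas D (fun x => A x i j)) -> bmeas D (fun x => \tr (A x)).
Proof. by move=> hA; apply: bmeas_sum. Qed.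

Lemma bmeas_mulmx D (m n p : nat) (A : T -> 'M[R]_(m, n)) (B : T -> 'M[R]_(n, p)) :
  (forall i j, bmeas D (fun x => A x i j)) ->
  (forall i j, bmeas D (fun x => B x i j)) ->
  forall i j, bmeas D (fun x => (A x *m B x) i j).
Proof.
move=> hA hB i j.
apply: (@bmeas_ext _ (fun x => \sum_k A x i k * B x k j)).
  by move=> x _; rewrite mxE.
by apply: bmeas_sum => k _; exact: bmeasM.
Qed.

Variables (mu : {measure set T -> \bar R}) (D : set T).
Hypotheses (mD : measurable D) (fD : (mu D < +oo)%E).

Lemma bmeas_integrable f : bmeas D f -> mu.-integrable D (EFin \o f).
Proof.
move=> [mf [K hK]]; apply: measurable_bounded_integrable => //.
exists K; split; first by rewrite num_real.
by move=> M KM x Dx /=; rewrite (le_trans (hK _ Dx))// ltW.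
Qed.

Lemma Rint_lin (a : R) f g : bmeas D f -> bmeas D g ->
  \int[mu]_(x in D) (a * f x + g x) =
  a * \int[mu]_(x in D) f x + \int[mu]_(x in D) g x.
Proof.
move=> hf hg; rewrite RintegralD//; last exact: bmeas_integrable.
  by rewrite RintegralZl//; exact: bmeas_integrable.
by apply: (bmeas_integrable (f := fun x => a * f x)); exact: bmeasZ.
Qed.

Lemma Rint_eq f g : (forall x, D x -> f x = g x) ->
  \int[mu]_(x in D) f x = \int[mu]_(x in D) g x.
Proof. by move=> fg; apply: eq_Rintegral => x; rewrite inE => /fg. Qed.

End BoundedMeasurable.

Section PlaneMeasure.
Context {R : realType}.
Local Notation T2 := (measurableTypeR R * measurableTypeR R)%type.

(** An open set of the plane is a countable union of rectangles with rational
    corners. *)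
Lemma open_measurable2 (A : set (R * R)) : open A -> measurable (A : set T2).
Proof.
move=> oA.
pose rect (a b c e : rat) : set T2 :=
  [set x | (ratr a < x.1 < ratr b) && (ratr c < x.2 < ratr e)].
pose F a b c e : set T2 := if `[< rect a b c e `<=` A >] then rect a b c e else set0.
have -> : A = \bigcup_a \bigcup_b \bigcup_c \bigcup_e F a b c e.
  apply/seteqP; split => [x Ax|x [a _ [b _ [c _ [e _]]]]]; last first.
    by rewrite /F; case: asboolP => // h /h.
  have /nbhs_ballP[r /= r0 hr] : nbhs x A by exact: open_nbhs_nbhs.
  have [a] := @rat_in_itvoo R (x.1 - r) x.1 ltac:(lra).
  have [b] := @rat_in_itvoo R x.1 (x.1 + r) ltac:(lra).
  have [c] := @rat_in_itvoo R (x.2 - r) x.2 ltac:(lra).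
  have [e] := @rat_in_itvoo R x.2 (x.2 + r) ltac:(lra).
  rewrite !in_itv/= => /andP[e1 e2] /andP[c1 c2] /andP[b1 b2] /andP[a1 a2].
  exists a => //; exists b => //; exists c => //; exists e => //.
  rewrite /F; case: asboolP => [_|].
    by rewrite /rect/= a2 b1 c2 e1.
  case=> y; rewrite /rect/= => /andP[/andP[y1 y2] /andP[y3 y4]].
  by apply: hr; split; rewrite /ball/= ltr_norml; lra.
apply: bigcupT_measurable_rat => a; apply: bigcupT_measurable_rat => b.
apply: bigcupT_measurable_rat => c; apply: bigcupT_measurable_rat => e.
rewrite /F; case: ifP => // _.
rewrite (_ : rect _ _ _ _ = `]ratr a, ratr b[ `*` `]ratr c, ratr e[); first exact: measurableX.
by apply/seteqP; split => x; rewrite /rect/= !in_itv/= => /andP.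
Qed.

Lemma continuous_measurable2 (D : set (R * R)) (f : R * R -> R) : open D ->
  (forall x, D x -> {for x, continuous f}) -> measurable_fun (D : set T2) f.
Proof.
move=> oD cf.
apply: (measurability _ (RGenOpens.measurableE R)) => //.
move=> _ [_ [a [b ->] <-]]; apply: open_measurable2.
rewrite openE => x [Dx fx]; apply: filterI; first exact: open_nbhs_nbhs.
by apply: cf => //; apply: open_nbhs_nbhs; split => //; exact: interval_open.
Qed.

Lemma bounded_subset_box (A : set (R * R)) : bounded_set A ->
  exists2 r : R, 0 < r & A `<=` [set` `[- r, r]] `*` [set` `[- r, r]].
Proof.
move=> [M [_ hM]]; exists (`|M| + 1); first by rewrite ltr_wpDl.
move=> x Ax; have := hM (`|M| + 1) ltac:(by rewrite (le_lt_trans (ler_norm M))// ltrDl) x Ax.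
rewrite /= prod_normE ge_max !ler_norml => /andP[h1 h2].
by split; rewrite /= in_itv.
Qed.

Lemma closed_bounded_compact2 (A : set (R * R)) : bounded_set A -> closed A -> compact A.
Proof.
move=> /bounded_subset_box[r _ hr] cA; apply: subclosed_compact cA _ hr.
by apply: compact_setX; exact: segment_compact.
Qed.

Lemma mu2_box (a b c e : R) : a <= b -> c <= e ->
  mu2 ([set` `[a, b]] `*` [set` `[c, e]]) = ((b - a) * (e - c))%:E.
Proof.
move=> ab ce; rewrite /mu2 product_measure1E//= !lebesgue_measure_itv/=.
have itv (u v : R) : u <= v ->
    (if (u%:E < v%:E)%E then (v%:E + (- u)%:E)%E else 0%E) = (v - u)%:E.
  by rewrite lte_fin; case: ltgtP => // -> _; rewrite subrr.
by rewrite !itv.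
Qed.

Lemma mu2_bounded (A : set (R * R)) : measurable (A : set T2) ->
  bounded_set A -> (mu2 A < +oo)%E.
Proof.
move=> mA /bounded_subset_box[r r0 hr].
apply: (@le_lt_trans _ _ (mu2 ([set` `[- r, r]] `*` [set` `[- r, r]]))).
  apply: le_measure => //; rewrite inE//.
  by apply: measurableX.
by rewrite mu2_box ?ltry//; lra.
Qed.

(** A nonnegative function with zero integral vanishes at its points of
    continuity inside the domain. *)
Lemma Rint_eq0_pt (D : set (R * R)) (f : R * R -> R) (x : R * R) :
  measurable (D : set T2) -> (mu2 D < +oo)%E -> bmeas (D : set T2) f ->
  (forall y, D y -> 0 <= f y) -> \int[mu2]_(y in D) f y = 0 ->
  D° x -> {for x, continuous f} -> f x = 0.
Proof.
move=> mD fD hf f0 If Dx cf.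
have Dx' : D x by exact: interior_subset.
apply/eqP/negP => /negP fx0.
have fxp : 0 < f x by rewrite lt_neqAle eq_sym fx0 f0.
have : \forall y \near x, D y /\ f x / 2 < f y.
  apply: filterI => //.
  have /cf : nbhs (f x) [set r | f x / 2 < r].
    by apply: open_nbhs_nbhs; split; [exact: open_gt|rewrite /=; lra].
  by [].
move=> /nbhs_ballP[r /= r0 hr].
(* The integrand is at least half its value at x on a square around x. *)
pose B : set T2 := [set` `[x.1 - r/2, x.1 + r/2]] `*` [set` `[x.2 - r/2, x.2 + r/2]].
have BD y : B y -> D y /\ f x / 2 < f y.
  move=> [/=]; rewrite !in_itv/= => y1 y2; apply: hr.
  by split; rewrite /ball/= ltr_norml; lra.
have mB : measurable B by exact: measurableX.
have : \int[mu2]_(y in D) (f x / 2 * \1_B y) <= \int[mu2]_(y in D) f y.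
  have b1 : bmeas (D : set T2) (fun y => f x / 2 * \1_B y).
    apply: bmeasZ; split; first exact: measurable_indic.
    by exists 1 => y _; rewrite /indic; case: (_ \in _); rewrite ?normr1 ?normr0.
  apply: le_Rintegral => //; [exact: bmeas_integrable b1|exact: bmeas_integrable hf|].
  move=> y Dy; rewrite indicE; case: (asboolP (B y)) => hB.
    by rewrite mem_set// mulr1 ltW//; case: (BD _ hB).
  by rewrite memNset// mulr0 f0.
rewrite If.
rewrite (_ : (fun y => _) = ((cst (f x / 2)) \_ B)); last first.
  apply/funext => y; rewrite /patch indicE; case: ifP => _; by rewrite ?mulr1 ?mulr0.
rewrite -Rintegral_mkcondr (_ : D `&` B = B); last first.
  by apply/seteqP; split => [y []//|y hB]; split => //; case: (BD _ hB).
have vB := @mu2_box (x.1 - r / 2) (x.1 + r / 2) (x.2 - r / 2) (x.2 + r / 2)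
  ltac:(lra) ltac:(lra).
rewrite Rintegral_cst// (congr1 fine vB : fine _ = _)/= => h.
suff : 0 < f x / 2 * ((x.1 + r / 2 - (x.1 - r / 2)) * (x.2 + r / 2 - (x.2 - r / 2))).
  by rewrite ltNge h.
by rewrite !mulr_gt0//; lra.
Qed.

End PlaneMeasure.

(** * Functions of class C^m in the plane *)

Section Smooth.
Context {R : realType}.
Implicit Types (f g : R * R -> R) (W : set (R * R)).

(** Continuity of all partial derivatives of order at most [m] on [W], by
    recursion on the order. *)
Fixpoint Cn (m : nat) W f : Prop :=
  (forall x, W x -> {for x, continuous f}) /\
  if m is m'.+1 then
    forall j, (forall x, W x -> derivable f x (evec j)) /\ Cn m' W (pd j f)
  else True.

Lemma Cn_cont m W f x : Cn m W f -> W x -> {for x, continuous f}.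
Proof. by case: m => [|m] [cf _]; exact: cf. Qed.

Lemma Cn_pd m W f j : Cn m.+1 W f -> Cn m W (pd j f).
Proof. by move=> [_ /(_ j)[]]. Qed.

Lemma Cn_derivable m W f x j : Cn m.+1 W f -> W x -> derivable f x (evec j).
Proof. by move=> [_ /(_ j)[h _]] /h. Qed.

Lemma CnW m W f : Cn m.+1 W f -> Cn m W f.
Proof.
elim: m f => [|m IH] f [cf hf]; split=> // j.
by have [d p] := hf j; split => //; exact: IH.
Qed.

Lemma Cm_on_Cn m W f : Cm_on m W f -> Cn m W f.
Proof.
elim: m f => [|m IH] f hf; split.
- by move=> x Wx; have [] := hf [::] isT x Wx.
- by [].
- by move=> x Wx; have [] := hf [::] isT x Wx.
- move=> j; split => [x Wx|]; first by have [_] := hf [::] isT x Wx; exact.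
  apply: IH => s sm x Wx.
  have -> : pds s (pd j f) = pds (rcons s j) f by rewrite /pds foldr_rcons.
  by have := hf (rcons s j); rewrite size_rcons !ltnS; apply.
Qed.

Lemma open_nearE W (P : R * R -> Prop) x : open W -> (forall y, W y -> P y) -> W x ->
  \forall y \near x, P y.
Proof.
by move=> oW h Wx; apply: filterS (h) _; exact: open_nbhs_nbhs.
Qed.

Lemma pd_near f g j x : (\forall y \near x, f y = g y) -> pd j f x = pd j g x.
Proof. exact: near_eq_derive. Qed.

Lemma cont_near f g x : (\forall y \near x, f y = g y) ->
  {for x, continuous f} -> {for x, continuous g}.
Proof.
move=> fg cf; rewrite /prop_for /continuous_at -(nbhs_singleton fg).
by apply: cvg_trans cf; exact: near_eq_cvg.
Qed.

Lemma pd_open W f g j x : open W -> (forall y, W y -> f y = g y) -> W x ->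
  pd j f x = pd j g x.
Proof. by move=> oW fg Wx; apply: pd_near; exact: open_nearE Wx. Qed.

Lemma Cn_ext m W f g : open W -> (forall x, W x -> f x = g x) ->
  Cn m W f -> Cn m W g.
Proof.
move=> oW; elim: m f g => [|m IH] f g fg [cf hf]; split => //.
- by move=> x Wx; apply: cont_near (cf _ Wx); exact: open_nearE Wx.
- by move=> x Wx; apply: cont_near (cf _ Wx); exact: open_nearE Wx.
- move=> j; have [df hpf] := hf j; split.
    by move=> x Wx; apply: near_eq_derivable (df _ Wx); exact: open_nearE Wx.
  by apply: IH hpf => x Wx; exact: pd_open Wx.
Qed.

Lemma Cn_cst m W (c : R) : Cn m W (fun=> c).
Proof.
elim: m c => [|m IH] c; split => //; try by move=> x _; exact: cvg_cst.
move=> j; split; first by move=> x _; exact: derivable_cst.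
have -> : pd j (fun=> c) = fun=> 0.
  by apply/funext => x; rewrite /pd derive_cst.
exact: IH.
Qed.

Lemma CnD m W f g : open W -> Cn m W f -> Cn m W g -> Cn m W (fun x => f x + g x).
Proof.
move=> oW; elim: m f g => [|m IH] f g [cf hf] [cg hg]; split => //;
  try by move=> x Wx; apply: cvgD; [exact: cf|exact: cg].
move=> j; have [df pf] := hf j; have [dg pg] := hg j; split.
  by move=> x Wx; apply: derivableD; [exact: df|exact: dg].
apply: Cn_ext (IH _ _ pf pg) => // x Wx.
by rewrite /pd deriveD//; [exact: df|exact: dg].
Qed.

Lemma CnM m W f g : open W -> Cn m W f -> Cn m W g -> Cn m W (fun x => f x * g x).
Proof.
move=> oW; elim: m f g => [|m IH] f g hf0 hg0; move: (hf0) (hg0) => [cf hf] [cg hg];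
  split => //;
  try by move=> x Wx; apply: cvgM; [exact: cf|exact: cg].
move=> j; have [df pf] := hf j; have [dg pg] := hg j; split.
  by move=> x Wx; apply: derivableM; [exact: df|exact: dg].
apply: Cn_ext (CnD oW (IH _ _ (CnW hf0) pg) (IH _ _ (CnW hg0) pf)) => // x Wx.
by rewrite /pd deriveM//; [exact: df|exact: dg].
Qed.

Lemma CnX m W f n : open W -> Cn m W f -> Cn m W (fun x => f x ^+ n).
Proof.
move=> oW hf; elim: n => [|n IH].
  by apply: Cn_ext (Cn_cst m W 1) => // x _; rewrite expr0.
by apply: Cn_ext (CnM oW hf IH) => // x _; rewrite exprS.
Qed.

Lemma Cn_sum m W (I : Type) (r : seq I) (P : pred I) (F : I -> R * R -> R) :
  open W -> (forall i, Cn m W (F i)) -> Cn m W (fun x => \sum_(i <- r | P i) F i x).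
Proof.
move=> oW hF; elim: r => [|i r IH].
  by apply: Cn_ext (Cn_cst m W 0) => // x _; rewrite big_nil.
case Pi: (P i); last by apply: Cn_ext IH => // x _; rewrite big_cons Pi.
by apply: Cn_ext (CnD oW (hF i) IH) => // x _; rewrite big_cons Pi.
Qed.

(** Composition of a polynomial with two functions of class [C^m]. *)
Lemma Cn_poly m W q l p f g : open W -> poly_fun q l p -> Cn m W f -> Cn m W g ->
  Cn m W (fun x => p (f x, g x)).
Proof.
move=> oW [c hp] hf hg.
apply: (@Cn_ext m W (fun x => \sum_(i < l.+1) \sum_(j < l.+1 | q || (i + j <= l)%N)
            c i j * f x ^+ i * g x ^+ j)) => //.
do 2 (apply: Cn_sum => // ?); apply: CnM => //; last exact: CnX.
by apply: CnM => //; [exact: Cn_cst|exact: CnX].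
Qed.

Lemma evec0 : evec ord0 = (1, 0) :> R * R. Proof. by []. Qed.
Lemma evec1 : evec ord_max = (0, 1) :> R * R. Proof. by []. Qed.

Lemma ord2P (j : 'I_2) : j = ord0 \/ j = ord_max.
Proof. by case: j => -[|[|//]] i; [left|right]; apply/val_inj. Qed.

Lemma cont_fst (x : R * R) : {for x, continuous (fst : R * R -> R)}.
Proof. exact: cvg_fst. Qed.

Lemma cont_snd (x : R * R) : {for x, continuous (snd : R * R -> R)}.
Proof. exact: cvg_snd. Qed.

(** The derivative along a line is the directional derivative. *)
Lemma is_derive_line f a v t : derivable f (a + t *: v) v ->
  is_derive t 1 (fun s : R => f (a + s *: v)) ('D_v f (a + t *: v)).
Proof.
move=> df.
have E : (fun h : R => h^-1 *: (((fun s : R => f (a + s *: v)) \o shift t) (h *: 1) -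
    f (a + t *: v))) =
  (fun h : R => h^-1 *: ((f \o shift (a + t *: v)) (h *: v) - f (a + t *: v))).
  apply/funext => h /=; congr (_ *: (f _ - _)).
  by rewrite [h%:A]mulr1 scalerDl addrCA.
by split; rewrite /derivable /derive E.
Qed.

(** A linear function has constant partial derivatives. *)
Lemma derivable_coord (j : 'I_2) (h : R * R -> R) x :
  (forall (a b : R * R) (t : R), h (t *: a + b) = t * h a + h b) ->
  is_derive x (evec j) h (h (evec j)).
Proof.
move=> hl.
have E (e : R) : e != 0 ->
    e^-1 *: ((h \o shift x) (e *: evec j) - h x) = h (evec j).
  by move=> e0; rewrite /= hl addrK [LHS]mulKf.
have c : e^-1 *: ((h \o shift x) (e *: evec j) - h x) @[e --> 0^'] --> h (evec j).
  apply: cvg_near_cst; near=> e; apply: E; near: e; exact: nbhs_dnbhs_neq.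
by split; [apply/cvg_ex; exists (h (evec j))|exact: cvg_lim].
Unshelve. all: by end_near.
Qed.

Lemma Cn_lin m W (h : R * R -> R) : open W ->
  (forall (a b : R * R) (t : R), h (t *: a + b) = t * h a + h b) ->
  (forall x, {for x, continuous h}) -> Cn m W h.
Proof.
move=> oW hl ch; case: m => [|m]; split => // j; split.
  by move=> x Wx; have [] := derivable_coord j x hl.
apply: Cn_ext (Cn_cst m W (h (evec j))) => // x _.
by rewrite /pd; have [_ ->] := derivable_coord j x hl.
Qed.

Lemma Cn_fst m W : open W -> Cn m W fst.
Proof. by move=> oW; exact: (Cn_lin m oW (fun a b t => erefl) cont_fst). Qed.

Lemma Cn_snd m W : open W -> Cn m W snd.
Proof. by move=> oW; exact: (Cn_lin m oW (fun a b t => erefl) cont_snd). Qed.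

Lemma Cn_polyT m q l p : poly_fun q l p -> Cn m setT p.
Proof.
move=> hp; apply: Cn_ext (Cn_poly openT hp (Cn_fst m openT) (Cn_snd m openT)).
  exact: openT.
by move=> [].
Qed.

(** The mean value theorem, for end points in any order. *)
Lemma mvt_between (F F' : R -> R) (u v : R) :
  (forall c, Num.min u v <= c <= Num.max u v -> is_derive c 1 F (F' c)) ->
  exists2 c, Num.min u v <= c <= Num.max u v & F v - F u = F' c * (v - u).
Proof.
wlog uv : u v / u <= v.
  move=> H hF; have /orP[uv|vu] := le_total u v; first exact: (H _ _ uv hF).
  have [|c] := H v u vu; first by rewrite minC maxC.
  rewrite minC maxC => hc e; exists c => //.
  by rewrite -[RHS]opprK -mulrN opprB -e opprB.
rewrite (min_idPl uv) (max_idPr uv) => hF.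
have [||c] := @MVT_segment R F F' u v uv.
- by move=> x; rewrite in_itv/= => /andP[a b]; apply: hF; rewrite !ltW.
- apply: derivable_within_continuous => x; rewrite in_itv/= => h.
  by have [] := hF _ h.
by rewrite in_itv/= => hc e; exists c.
Qed.

End Smooth.

(** * The chain rule *)

Section Chain.
Context {R : realType}.
Implicit Types (f g : R * R -> R) (W : set (R * R)).

Lemma slice1 f (u w : R) : derivable f (u, w) (evec ord0) ->
  is_derive u 1 (fun s : R => f (s, w)) (pd ord0 f (u, w)).
Proof.
have E (s : R) : (0, w) + s *: evec ord0 = (s, w) :> R * R.
  by rewrite evec0; congr (_, _); rewrite /= ?add0r ?[s *: 1]mulr1// scaler0 addr0.
move=> df; have := @is_derive_line R f (0, w) (evec ord0) u.
rewrite E => /(_ df).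
by rewrite (_ : (fun s => f _) = fun s => f (s, w))//; apply/funext => s; rewrite E.
Qed.

Lemma slice2 f (u w : R) : derivable f (u, w) (evec ord_max) ->
  is_derive w 1 (fun s : R => f (u, s)) (pd ord_max f (u, w)).
Proof.
have E (s : R) : (u, 0) + s *: evec ord_max = (u, s) :> R * R.
  by rewrite evec1; congr (_, _); rewrite /= ?add0r ?[s *: 1]mulr1// scaler0 addr0.
move=> df; have := @is_derive_line R f (u, 0) (evec ord_max) w.
rewrite E => /(_ df).
by rewrite (_ : (fun s => f _) = fun s => f (u, s))//; apply/funext => s; rewrite E.
Qed.

(** The increment of a [C^1] function at [p] in Hadamard's form, with
    coefficients that are continuous at [p]. *)
Lemma hadamard f W (p : R * R) : open W -> Cn 1 W f -> W p ->
  exists A B : R * R -> R,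
    [/\ A q @[q --> p] --> pd ord0 f p, B q @[q --> p] --> pd ord_max f p &
        forall q, f q - f p = A q * (q.1 - p.1) + B q * (q.2 - p.2)].
Proof.
move=> oW [cf hf] Wp.
have [d1 [c1 _]] := hf ord0; have [d2 [c2 _]] := hf ord_max.
pose A (q : R * R) : R := if q.1 == p.1 then pd ord0 f p else (f q - f (p.1, q.2)) / (q.1 - p.1).
pose B (q : R * R) : R := if q.2 == p.2 then pd ord_max f p
                else (f (p.1, q.2) - f p) / (q.2 - p.2).
(* The mean value theorem applied along the two legs p, (p.1, q.2), q. *)
have between (u v c r : R) : Num.min u v <= c <= Num.max u v ->
    `|u - v| < r -> `|u - c| < r.
  by case: (leP u v) => _ /andP[? ?]; rewrite !ltr_norml; lra.
exists A, B; split.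
- apply/cvgrPdist_lt => e e0.
  have : \forall q \near p, W q /\ `|pd ord0 f p - pd ord0 f q| < e.
    apply: filterI; first exact: open_nbhs_nbhs.
    by move/cvgrPdist_lt: (c1 _ Wp) => /(_ _ e0).
  move=> /nbhs_ballP[r /= r0 hr];
  change (nbhs p (fun q => `|pd ord0 f p - A q| < e)).
  apply/nbhs_ballP; exists r => //= q [q1 q2].
  rewrite /A; case: eqP => [_|/eqP q1p]; first by rewrite subrr normr0.
  have Hb c : Num.min p.1 q.1 <= c <= Num.max p.1 q.1 -> ball p r (c, q.2).
    by move=> hc; split => //; exact: between hc q1.
  have -> : f q = f (q.1, q.2) by case: (q).
  have [c hc ->] := @mvt_between R (fun s => f (s, q.2)) (fun s => pd ord0 f (s, q.2))
    p.1 q.1 (fun c hc => slice1 (d1 _ (proj1 (hr _ (Hb c hc))))).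
  by rewrite mulfK ?subr_eq0//; exact: (proj2 (hr _ (Hb c hc))).
- apply/cvgrPdist_lt => e e0.
  have : \forall q \near p, W q /\ `|pd ord_max f p - pd ord_max f q| < e.
    apply: filterI; first exact: open_nbhs_nbhs.
    by move/cvgrPdist_lt: (c2 _ Wp) => /(_ _ e0).
  move=> /nbhs_ballP[r /= r0 hr];
  change (nbhs p (fun q => `|pd ord_max f p - B q| < e)).
  apply/nbhs_ballP; exists r => //= q [q1 q2].
  rewrite /B; case: eqP => [_|/eqP q2p]; first by rewrite subrr normr0.
  have Hb c : Num.min p.2 q.2 <= c <= Num.max p.2 q.2 -> ball p r (p.1, c).
    by move=> hc; split; [exact: ballxx|exact: between hc q2].
  have -> : f p = f (p.1, p.2) by case: (p).
  have [c hc ->] := @mvt_between R (fun s => f (p.1, s)) (fun s => pd ord_max f (p.1, s))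
    p.2 q.2 (fun c hc => slice2 (d2 _ (proj1 (hr _ (Hb c hc))))).
  by rewrite mulfK ?subr_eq0//; exact: (proj2 (hr _ (Hb c hc))).
- move=> q; have A1 : A q * (q.1 - p.1) = f q - f (p.1, q.2).
    rewrite /A; case: eqP => [e|/eqP e]; last by rewrite divfK ?subr_eq0.
    by rewrite e subrr mulr0 -e -surjective_pairing subrr.
  have -> : B q * (q.2 - p.2) = f (p.1, q.2) - f p.
    rewrite /B; case: eqP => [e|/eqP e]; last by rewrite divfK ?subr_eq0.
    by rewrite e subrr mulr0 -surjective_pairing subrr.
  by rewrite A1; ring.
Qed.

(** The chain rule along a plane curve that is only differentiable at [t]. *)
Lemma chain f W (c : R -> R * R) (t d1 d2 : R) : open W -> Cn 1 W f -> W (c t) ->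
  is_derive t 1 (fst \o c) d1 -> is_derive t 1 (snd \o c) d2 ->
  is_derive t 1 (f \o c) (pd ord0 f (c t) * d1 + pd ord_max f (c t) * d2).
Proof.
move=> oW hf Wt [D1 E1] [D2 E2].
have [A [B [cA cB hAB]]] := hadamard oW hf Wt.
have C1 : h^-1 *: ((fst \o c \o shift t) (h *: 1) - (c t).1) @[h --> 0^'] --> d1.
  by rewrite -E1; exact: D1.
have C2 : h^-1 *: ((snd \o c \o shift t) (h *: 1) - (c t).2) @[h --> 0^'] --> d2.
  by rewrite -E2; exact: D2.
have cc : (c \o shift t) (h *: (1 : R)) @[h --> 0^'] --> c t.
  have k1 : {for t, continuous (fst \o c)} := differentiable_continuous (iffLR (derivable1_diffP _ _) D1).
  have k2 : {for t, continuous (snd \o c)} := differentiable_continuous (iffLR (derivable1_diffP _ _) D2).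
  have kt : (h *: (1 : R) + t) @[h --> 0^'] --> t.
    rewrite -[X in _ --> X]add0r; apply: cvgD; last exact: cvg_cst.
    apply: cvg_trans (nbhs_dnbhs (x := (0 : R))) => //.
    by apply: near_eq_cvg; near=> h; rewrite [h%:A]mulr1.
  rewrite [X in _ --> X]surjective_pairing.
  have -> : (fun h => (c \o shift t) (h *: (1 : R))) =
    (fun h : R => ((fst \o c) (h *: (1 : R) + t), (snd \o c) (h *: (1 : R) + t))).
    by apply/funext => h /=; rewrite -surjective_pairing.
  exact: (cvg_pair (cvg_comp _ _ kt k1) (cvg_comp _ _ kt k2)).
have Q : h^-1 *: ((f \o c \o shift t) (h *: 1) - f (c t)) @[h --> 0^'] -->
    pd ord0 f (c t) * d1 + pd ord_max f (c t) * d2.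
  have -> : (fun h : R => h^-1 *: ((f \o c \o shift t) (h *: 1) - f (c t))) =
    (fun h : R => A ((c \o shift t) (h *: (1 : R))) *
          (h^-1 *: ((fst \o c \o shift t) (h *: 1) - (c t).1)) +
        B ((c \o shift t) (h *: (1 : R))) *
          (h^-1 *: ((snd \o c \o shift t) (h *: 1) - (c t).2))).
    apply/funext => h; rewrite [X in _ *: X]hAB /=.
    by rewrite scalerDr !scalerAr.
  exact: (cvgD (cvgM (cvg_comp _ _ cc cA) C1) (cvgM (cvg_comp _ _ cc cB) C2)).
by split; [apply/cvg_ex; eexists; exact: Q|exact: cvg_lim Q].
Unshelve. all: by end_near.
Qed.

Lemma pd_lin (a : R) (f g : R * R -> R) (x : R * R) j : derivable f x (evec j) -> derivable g x (evec j) ->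
  pd j (fun y => a * f y + g y) x = a * pd j f x + pd j g x.
Proof.
move=> df dg; rewrite /pd.
rewrite (_ : (fun y => _) = (a \*: f) + g)//.
by rewrite (deriveD (derivableZ (k := a) df) dg) (deriveZ a df).
Qed.

End Chain.

(* Comparing derivatives of two functions by unfolding them is never useful. *)
Opaque Cn pd.

(** * The reference elements *)

Section ReferenceElement.
Context {R : realType}.

(** The affine function [w.1.1 + w.1.2 * x.1 + w.2 * x.2]. *)
Definition aff (w : R * R * R) (x : R * R) : R := w.1.1 + w.1.2 * x.1 + w.2 * x.2.

(** The affine function vanishing on the [i]-th side of the reference element
    and positive inside. *)
Definition sidec (q : bool) (i : nat) : R * R * R :=
  nth (0, 0, 0) (if q then [:: (0, 0, 1); (1, -1, 0); (1, 0, -1); (0, 1, 0)]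
                 else [:: (0, 0, 1); (1, -1, -1); (0, 1, 0)]) (i %% nvert q).

(** The affine function giving the position on the [i]-th side, from 0 to 1. *)
Definition eposc (q : bool) (i : nat) : R * R * R :=
  nth (0, 0, 0) (if q then [:: (0, 1, 0); (0, 0, 1); (1, -1, 0); (1, 0, -1)]
                 else [:: (0, 1, 0); (0, 0, 1); (1, 0, -1)]) (i %% nvert q).

(** The [i]-th side of the reference element, from vertex [i] to vertex [i + 1]. *)
Definition ref_edge (q : bool) (i : nat) (t : R) : R * R :=
  (1 - t) *: ref_vertex q i + t *: ref_vertex q i.+1.

Lemma addp1 (a b : R * R) : (a + b).1 = a.1 + b.1. Proof. by []. Qed.
Lemma addp2 (a b : R * R) : (a + b).2 = a.2 + b.2. Proof. by []. Qed.
Lemma scp1 (t : R) (a : R * R) : (t *: a).1 = t * a.1. Proof. by []. Qed.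
Lemma scp2 (t : R) (a : R * R) : (t *: a).2 = t * a.2. Proof. by []. Qed.
Definition pairE := (addp1, addp2, scp1, scp2).

Lemma affD w a b (t : R) :
  aff w (a + t *: b) = aff w a + t * (w.1.2 * b.1 + w.2 * b.2).
Proof. by rewrite /aff !pairE; ring. Qed.

Lemma ref_edge_line q i t :
  ref_edge q i t = ref_vertex q i + t *: (ref_vertex q i.+1 - ref_vertex q i).
Proof. by rewrite /ref_edge scalerBl scale1r scalerBr addrA addrAC. Qed.

(** Indices of sides and vertices are read modulo the number of vertices. *)
Lemma ref_case (q : bool) (P : nat -> nat -> Prop) :
  (forall r, (r < nvert q)%N -> P r (r.+1 %% nvert q)%N) ->
  forall i, P (i %% nvert q)%N (i.+1 %% nvert q)%N.
Proof.
move=> H i; have n0 : (0 < nvert q)%N by case: q {H}.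
have -> : (i.+1 %% nvert q = (i %% nvert q).+1 %% nvert q)%N.
  by rewrite -addn1 -[in RHS]addn1 modnDml.
by apply: H; rewrite ltn_mod.
Qed.

(** The reference element is the intersection of the half-planes of its sides. *)
Lemma ref_elemP q x : ref_elem q x <-> forall i, 0 <= aff (sidec q i) x.
Proof.
split.
  move=> hx i; rewrite /sidec; move: hx.
  apply: (ref_case (P := fun r _ => ref_elem q x -> 0 <= aff (nth _ _ r) x)).
  by case: q => -[|[|[|[|//]]]] _ // ; rewrite /ref_elem /aff /=; move=> h; lra.
move=> h; move: (h 0%N) (h 1%N) (h 2%N) (h 3%N).
by case: q {h}; rewrite /sidec /ref_elem /aff/=; lra.
Qed.

Lemma side_edge q i t : aff (sidec q i) (ref_edge q i t) = 0.
Proof.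
rewrite /sidec /ref_edge /ref_vertex.
apply: (ref_case (P := fun r s => aff (nth (0, 0, 0) _ r)
  ((1 - t) *: nth 0 _ r + t *: nth 0 _ s) = 0)).
by case: q => -[|[|[|[|//]]]] _ //; rewrite /aff !pairE /=; ring.
Qed.

Lemma epos_edge q i t : aff (eposc q i) (ref_edge q i t) = t.
Proof.
rewrite /eposc /ref_edge /ref_vertex.
apply: (ref_case (P := fun r s => aff (nth (0, 0, 0) _ r)
  ((1 - t) *: nth 0 _ r + t *: nth 0 _ s) = t)).
by case: q => -[|[|[|[|//]]]] _ //; rewrite /aff !pairE /=; ring.
Qed.

Lemma ref_edge_in q i t : 0 <= t <= 1 -> ref_elem q (ref_edge q i t).
Proof.
move=> ht; apply/ref_elemP => j; rewrite /sidec /ref_edge /ref_vertex.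
apply: (ref_case (P := fun r _ => 0 <= aff (nth (0, 0, 0) _ r) _)).
move=> r hr.
apply: (ref_case (P := fun i s => 0 <= aff (nth (0, 0, 0) _ r)
  ((1 - t) *: nth 0 _ i + t *: nth 0 _ s))).
move: r hr; case: q => -[|[|[|[|//]]]] _ // -[|[|[|[|//]]]] _ //;
 rewrite /aff !pairE /=; lra.
Qed.

Lemma side_edge_gt0 q i t : 0 < t < 1 -> forall j, (j %% nvert q != i %% nvert q)%N ->
  0 < aff (sidec q j) (ref_edge q i t).
Proof.
move=> ht j; rewrite /sidec /ref_edge /ref_vertex.
apply: (ref_case (P := fun r _ => (r != i %% nvert q)%N -> 0 < aff (nth (0, 0, 0) _ r) _)).
move=> r hr.
apply: (ref_case (P := fun i s => r != i -> 0 < aff (nth (0, 0, 0) _ r)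
  ((1 - t) *: nth 0 _ i + t *: nth 0 _ s))).
move: r hr; case: q => -[|[|[|[|//]]]] _ // -[|[|[|[|//]]]] _ //;
 rewrite /aff !pairE /= => _; lra.
Qed.

Lemma sidec_neq0 q i : (sidec q i).1.2 ^+ 2 + (sidec q i).2 ^+ 2 != 0.
Proof.
apply: lt0r_neq0; rewrite /sidec.
apply: (ref_case (P := fun r _ => 0 < (nth (0, 0, 0) _ r).1.2 ^+ 2
  + (nth (0, 0, 0) _ r).2 ^+ 2)).
by case: q => -[|[|[|[|//]]]] _ //=; lra.
Qed.

Lemma aff_cont w x : {for x, continuous (aff w)}.
Proof.
exact: (cvgD (cvgD (cvg_cst _) (cvgM (cvg_cst _) (@cont_fst R x)))
             (cvgM (cvg_cst _) (@cont_snd R x))).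
Qed.

(** A nonconstant affine function that is nonnegative near [x] is positive at
    [x]. *)
Lemma aff_min (w : R * R * R) (x : R * R) : w.1.2 ^+ 2 + w.2 ^+ 2 != 0 ->
  (\forall y \near x, 0 <= aff w y) -> 0 < aff w x.
Proof.
move=> w0 H; have w1 : 0 < w.1.2 ^+ 2 + w.2 ^+ 2.
  by rewrite lt_neqAle eq_sym w0 addr_ge0// sqr_ge0.
have ck : (x + s *: ((- w.1.2, - w.2) : R * R)) @[s --> (0 : R)] --> x.
  have := cvgD (cvg_cst x) (cvgZr_tmp (s := id) (a := ((- w.1.2, - w.2) : R * R)) (@cvg_id R (nbhs (0 : R)))).
  by rewrite scale0r addr0; apply.
have /nbhs_ballP[r /= r0 hr] : nbhs (0 : R) (fun s => 0 <= aff w (x + s *: (- w.1.2, - w.2))).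
  exact: ck H.
have := hr (r / 2); rewrite affD/=.
have b : ball (0 : R) r (r / 2) by rewrite /ball/= sub0r normrN gtr0_norm; lra.
move=> /(_ b); nra.
Qed.

End ReferenceElement.

(** * Charts of the elements *)

Section Chart.
Context {R : realType}.
Implicit Type T : element R.

Lemma pos_near (V : topologicalType) (f : V -> R) (x : V) : {for x, continuous f} -> 0 < f x ->
  \forall y \near x, 0 < f y.
Proof.
move=> cf h; have : nbhs (f x) [set r | 0 < r].
  by apply: open_nbhs_nbhs; split; [exact: open_gt|].
exact: cf.
Qed.

(** A [C^2] diffeomorphism of open neighbourhoods [U] and [W] that extends the
    element map, with inverse [psi']. *)
Definition chart T (U W : set (R * R)) (psi' : R * R -> R * R) : Prop :=
  [/\ [/\ open U, ref_elem (is_quad T) `<=` U, open W & elem_set T `<=` W],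
      forall x, U x -> W (emap T x) /\ psi' (emap T x) = x,
      forall y, W y -> U (psi' y) /\ emap T (psi' y) = y,
      Cn 2 W (fst \o psi') /\ Cn 2 W (snd \o psi') &
      Cn 2 setT (fst \o emap T) /\ Cn 2 setT (snd \o emap T)].

(** The element map is a [C^2] diffeomorphism up to the boundary. *)
Definition regular T : Prop := exists U W psi', chart T U W psi'.

(** Charts of class [C^(k + 1)] are of class [C^2] as soon as [k >= 1]. *)
Lemma isoparametric_regular k c T : (1 <= k)%N -> isoparametric k c T -> regular T.
Proof.
move=> k1 [p1 p2 _ [U [W [psi' [h1 h2 h3 [h4 h5] _]]]]].
have CnS m W0 (f : R * R -> R) : (2 <= m)%N -> Cm_on m W0 f -> Cn 2 W0 f.
  move=> m2 hf; apply: Cm_on_Cn => s s2 x Wx.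
  have [cf df] := hf s (leq_trans s2 m2) x Wx; split=> // sl.
  exact/df/(leq_trans sl).
have k3 : (2 <= k.+1)%N by [].
exists U, W, psi'.
exact: (And5 h1 h2 h3 (conj (CnS _ _ _ k3 h4) (CnS _ _ _ k3 h5))
  (conj (Cn_polyT 2 p1) (Cn_polyT 2 p2))).
Qed.

Lemma cont_pair (f g : R * R -> R) x : {for x, continuous f} -> {for x, continuous g} ->
  {for x, continuous (fun y => (f y, g y))}.
Proof. by move=> cf cg; exact: (cvg_pair cf cg). Qed.

Lemma cont_split (f : R * R -> R * R) x : {for x, continuous (fst \o f)} ->
  {for x, continuous (snd \o f)} -> {for x, continuous f}.
Proof.
move=> h1 h2; have := cont_pair h1 h2.
by rewrite (_ : (fun y => _) = f)//; apply/funext => y; rewrite /= -surjective_pairing.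
Qed.

Lemma emap_cont T : regular T -> forall x, {for x, continuous (emap T)}.
Proof.
move=> [U [W [psi' [_ _ _ _ [c1 c2]]]]] x.
by apply: cont_split; [exact: (Cn_cont c1 I)|exact: (Cn_cont c2 I)].
Qed.

Lemma ref_elem_compact q : compact (@ref_elem R q).
Proof.
apply: closed_bounded_compact2.
  exists 1; split; first by rewrite num_real.
  move=> M M1 x /=; rewrite prod_normE ge_max !ler_norml /ref_elem /=.
  by case: q; lra.
have -> : @ref_elem R q = \bigcap_(i in [set: nat]) (aff (sidec q i) @^-1` [set r | 0 <= r]).
  apply/seteqP; split => x; first by move=> /ref_elemP h i _; exact: h.
  by move=> h; apply/ref_elemP => i; exact: h.
apply: closed_bigI => i _; apply: closed_comp; last exact: closed_ge.
by move=> x _; exact: aff_cont.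
Qed.

Lemma elem_compact T : regular T -> compact (elem_set T).
Proof.
move=> hT; apply: continuous_compact; last exact: ref_elem_compact.
by apply: continuous_subspaceT; exact: emap_cont.
Qed.

Section WithChart.
Variables (T : element R) (U W : set (R * R)) (psi' : R * R -> R * R).
Hypothesis hT : chart T U W psi'.
Let q := is_quad T.

Let rT : regular T. Proof. by exists U, W, psi'. Qed.

Lemma chartK x : ref_elem q x -> psi' (emap T x) = x.
Proof. by case: hT => [[_ rU _ _] K _ _ _] /rU /K[]. Qed.

Lemma chart_elem y : W y -> elem_set T y <-> ref_elem q (psi' y).
Proof.
move=> Wy; split; first by move=> [x rx <-]; rewrite chartK.
by move=> h; exists (psi' y) => //; case: hT => [_ _ /(_ _ Wy)[_ ]].
Qed.

Lemma elemW : elem_set T `<=` W. Proof. by case: hT => [[]]. Qed.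

Lemma openW : open W. Proof. by case: hT => [[]]. Qed.

(** The function [aff w] of the reference coordinates, as a function on the
    neighbourhood of the element. *)
Definition lft (w : R * R * R) (y : R * R) : R := aff w (psi' y).

Lemma Cn_lft w : Cn 2 W (lft w).
Proof.
case: hT => [_ _ _ [c1 c2] _]; have oW := openW.
exact: (CnD oW (CnD oW (Cn_cst 2 W w.1.1) (CnM oW (Cn_cst 2 W w.1.2) c1))
  (CnM oW (Cn_cst 2 W w.2) c2)).
Qed.

(** In reference coordinates, the open element is where all the side functions
    are positive; this lemma and the next one are the two inclusions. *)
Lemma interior_side y : (elem_set T)° y -> forall i, 0 < lft (sidec q i) y.
Proof.
move=> iy i; have ey : elem_set T y := interior_subset iy.
have Wy := elemW ey; have [[oU _ _ _] K1 K2 _ _] := hT.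
have [Uy eyK] := K2 _ Wy.
apply: aff_min; first exact: sidec_neq0.
have : \forall z \near psi' y, U z /\ (elem_set T)° (emap T z).
  apply: filterI; first exact: open_nbhs_nbhs.
  apply: (emap_cont rT); rewrite eyK; apply: open_nbhs_nbhs; split=> //.
  exact: open_interior.
apply: filterS => z [Uz iz]; have ez := interior_subset iz.
have := (chart_elem (elemW ez)).1 ez.
by have [_ ->] := K1 _ Uz; move=> /ref_elemP; exact.
Qed.

Lemma side_interior y : W y -> (forall i, 0 < lft (sidec q i) y) -> (elem_set T)° y.
Proof.
move=> Wy hy.
have : \forall z \near y, W z /\ forall i, (i < nvert q)%N -> 0 < lft (sidec q i) z.
  apply: filterI; first by apply: open_nbhs_nbhs; split => //; exact: openW.
  elim: (nvert q) => [|n IH]; first by near=> z.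
  have : \forall z \near y, 0 < lft (sidec q n) z.
    exact: pos_near (Cn_cont (Cn_lft (sidec q n)) Wy) (hy n).
  move: IH; apply: filterS2 => z h1 h2 i; rewrite ltnS leq_eqVlt => /orP[/eqP->//|].
  exact: h1.
apply: filterS => z [Wz hz]; apply/(chart_elem Wz)/ref_elemP => i.
rewrite /sidec -modn_mod; apply/ltW/hz; rewrite ltn_mod.
by case: (q).
Unshelve. all: by end_near.
Qed.

Lemma edge_lft i y : edge_set T i y -> lft (sidec q i) y = 0.
Proof.
by move=> [t]; rewrite /= in_itv/= => ht <-; rewrite /lft chartK ?side_edge//; exact: ref_edge_in.
Qed.

Lemma edge_elem i y : edge_set T i y -> elem_set T y.
Proof.
move=> [t]; rewrite /= in_itv/= => ht <-; exists (ref_edge q i t) => //.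
exact: ref_edge_in.
Qed.

(** Edges do not meet the interior of their element. *)
Lemma edge_interior i y : edge_set T i y -> ~ (elem_set T)° y.
Proof. by move=> /edge_lft h /interior_side /(_ i); rewrite h ltxx. Qed.

Lemma vertex_edge i : edge_set T i (vertex T i).
Proof.
exists 0; first by rewrite /= in_itv/= lexx ler01.
by rewrite /edge_par scale0r addr0 subr0 scale1r.
Qed.

End WithChart.
End Chart.

(** * Curves entering an element *)

Section Curves.
Context {R : realType}.
Implicit Types (a b p n : R * R) (F : R * R -> R) (W : set (R * R)).

Lemma derive_uniq (f : R -> R) (t d1 d2 : R) : is_derive t (1 : R) f d1 -> is_derive t (1 : R) f d2 -> d1 = d2.
Proof. by move=> [_ <-] [_ <-]. Qed.

Lemma is_derive_aff (u v t : R) : is_derive t 1 (fun s : R => u + s * v) v.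
Proof.
have := is_deriveD (is_derive_cst u t (1 : R)) (is_deriveZ v (is_derive_id t (1 : R))).
rewrite add0r [v%:A]mulr1.
rewrite (_ : cst u + v \*: id = fun s : R => u + s * v)//.
by apply/funext => s; rewrite mulrC.
Qed.

Lemma cont_line a b t : {for t, continuous (fun s : R => a + s *: b)}.
Proof. exact: (cvgD (cvg_cst a) (cvgZr_tmp (s := id) (a := b) (@cvg_id R (nbhs t)))). Qed.

Lemma chain_line F W a b t : open W -> Cn 1 W F -> W (a + t *: b) ->
  is_derive t 1 (fun s : R => F (a + s *: b))
    (pd ord0 F (a + t *: b) * b.1 + pd ord_max F (a + t *: b) * b.2).
Proof.
move=> oW hF Wt.
exact: (chain (c := fun s : R => a + s *: b) oW hF Wt (is_derive_aff a.1 b.1 t)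
  (is_derive_aff a.2 b.2 t)).
Qed.

(** A function vanishing at 0 with positive derivative there is positive just
    after 0. *)
Lemma is_derive_pos (f : R -> R) (D : R) : is_derive (0 : R) (1 : R) f D -> f 0 = 0 -> 0 < D ->
  \forall s \near 0^'+, 0 < f s.
Proof.
move=> [df Df] f0 D0.
have c : h^-1 *: ((f \o shift 0) (h *: 1) - f 0) @[h --> 0^'] --> D by rewrite -Df; exact: df.
have c' := cvg_dnbhs_at_right c.
have : \forall s \near 0^'+, 0 < s^-1 *: ((f \o shift 0) (s *: (1 : R)) - f 0).
  have : nbhs D [set r | 0 < r].
    by apply: open_nbhs_nbhs; split; [exact: open_gt|].
  exact: c'.
have : \forall s \near (0 : R)^'+, 0 < s by exact: nbhs_right_gt.
apply: filterS2 => s s0; rewrite f0 subr0 /= addr0 [s%:A]mulr1.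
by rewrite [_ *: _]/(_ * _) pmulr_rgt0// invr_gt0.
Qed.

(** Entering an element transversally through the relative interior of its
    [i]-th side. *)
Lemma ray_in (T : element R) U W psi' i p n : chart T U W psi' -> W p ->
  lft psi' (sidec (is_quad T) i) p = 0 ->
  (forall j, (j %% nvert (is_quad T) != i %% nvert (is_quad T))%N ->
     0 < lft psi' (sidec (is_quad T) j) p) ->
  0 < pd ord0 (lft psi' (sidec (is_quad T) i)) p * n.1
      + pd ord_max (lft psi' (sidec (is_quad T) i)) p * n.2 ->
  \forall s \near 0^'+, (elem_set T)° (p + s *: n).
Proof.
set q := is_quad T => hT Wp Lp Lj D0.
have oW := openW hT.
have cl : (p + s *: n) @[s --> 0^'+] --> p.
  have := cvg_at_right_filter (@cont_line p n 0).
  by rewrite scale0r addr0.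
have E0 : p + 0 *: n = p by rewrite scale0r addr0.
have h1 : \forall s \near 0^'+, 0 < lft psi' (sidec q i) (p + s *: n).
  apply: is_derive_pos D0; last by rewrite E0.
  have := @chain_line _ W p n 0 oW (CnW (Cn_lft hT (sidec q i))).
  by rewrite E0; exact.
have h2 : \forall s \near 0^'+, W (p + s *: n).
  by apply: (cl W); apply: open_nbhs_nbhs.
have h3 : \forall s \near 0^'+, forall j, (j < nvert q)%N ->
    j <> (i %% nvert q)%N -> 0 < lft psi' (sidec q j) (p + s *: n).
  have : forall m, (m <= nvert q)%N -> \forall s \near 0^'+, forall j, (j < m)%N ->
      j <> (i %% nvert q)%N -> 0 < lft psi' (sidec q j) (p + s *: n).
    elim=> [|m IH] mq; first by near=> s.
    have [e|ne] := eqVneq m (i %% nvert q)%N.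
      apply: filterS (IH (ltnW mq)) => s h j; rewrite ltnS leq_eqVlt.
      by move=> /orP[/eqP->|]; [rewrite e|exact: h].
    have lm : 0 < lft psi' (sidec q m) p by apply: Lj; rewrite modn_small.
    have : \forall s \near 0^'+, 0 < lft psi' (sidec q m) (p + s *: n).
      exact: (cl _ (pos_near (Cn_cont (Cn_lft hT (sidec q m)) Wp) lm)).
    move: (IH (ltnW mq)); apply: filterS2 => s a1 a2 j; rewrite ltnS leq_eqVlt.
    by move=> /orP[/eqP->//|]; exact: a1.
  by apply.
apply: filterS3 h1 h2 h3 => s a1 a2 a3; apply: (side_interior hT) => // j.
have [e|ne] := eqVneq (j %% nvert q)%N (i %% nvert q)%N.
  by rewrite /sidec e.
have -> : sidec (is_quad T) j = sidec q (j %% nvert q) :> R * R * R by rewrite /sidec modn_mod.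
by apply: a3; [rewrite ltn_mod; case: (q)|exact/eqP].
Unshelve. all: by end_near.
Qed.

End Curves.

(** * Interior edges and their normals *)

Section MeshGeometry.
Context {R : realType}.
Variables (Om : set (R * R)) (M : mesh R).
Hypotheses (hreg : forall T : 'I_(nelem M), regular (elt T)) (hconf : conforming Om M).

(** By conformity, the interior of an element does not meet another element:
    the intersection of the two is void, a vertex or an edge. *)
Lemma interior_disjoint (T T' : 'I_(nelem M)) x : T != T' ->
  (elem_set (elt T))° x -> ~ elem_set (elt T') x.
Proof.
move=> TT' iT eT'; have [U [W [psi' hT]]] := hreg T.
have eT : elem_set (elt T) x := interior_subset iT.
have [_ /(_ _ _ TT')] := hconf.
have Ix : (elem_set (elt T) `&` elem_set (elt T')) x by [].
case=> [I0|[i [j [I0 _]]]|[i [j [I0 _]]]]; rewrite I0 in Ix; first by [].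
  apply: (edge_interior hT _ iT (i := i)).
  by rewrite Ix; exact: vertex_edge.
exact: (edge_interior hT Ix iT).
Qed.

Lemma elem_closure (T : 'I_(nelem M)) : elem_set (elt T) `<=` closure Om.
Proof. by move=> x hx; rewrite -hconf.1; exists T. Qed.

Section Edge.
Variable e : edge M.
Hypothesis he : e \in interior_edges M.

Local Notation T1 := (elt e.1.1).
Local Notation T2 := (elt e.2.1).

Lemma edge_neq : e.1.1 != e.2.1.
Proof. by move: he; rewrite inE => /and4P[h _ _ _]; rewrite neq_ltn h. Qed.

Lemma edge_sets : edge_set T1 e.1.2 = edge_set T2 e.2.2.
Proof. by move: he; rewrite inE => /and4P[_ _ _ /asboolP]. Qed.

Lemma edge_set_epar (t : R) : 0 <= t <= 1 -> edge_set T1 e.1.2 (epar e t).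
Proof. by move=> ht; exists t => //; rewrite /= in_itv. Qed.

Let ref_a := @ref_vertex R (is_quad T1) e.1.2.
Let ref_b := @ref_vertex R (is_quad T1) e.1.2.+1 - ref_a.

Lemma eparE (t : R) : epar e t = emap T1 (ref_a + t *: ref_b).
Proof. by rewrite -ref_edge_line. Qed.

Lemma epar_cont (t : R) : {for t, continuous (epar e)}.
Proof.
have -> : epar e = (emap T1) \o (fun t : R => ref_a + t *: ref_b).
  by apply/funext => s; rewrite eparE.
by apply: continuous_comp; [exact: cont_line|exact: emap_cont].
Qed.

Let dpar (F : R * R -> R) (t : R) : R :=
  pd ord0 F (ref_a + t *: ref_b) * ref_b.1 + pd ord_max F (ref_a + t *: ref_b) * ref_b.2.

Lemma epar_derive (t : R) :
  is_derive t (1 : R) (fst \o epar e) (epar' e t).1 /\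
  is_derive t (1 : R) (snd \o epar e) (epar' e t).2.
Proof.
have [U [W [psi' [_ _ _ _ [c1 c2]]]]] := hreg e.1.1.
have D (F : R * R -> R) : Cn 2 setT (F \o emap T1) ->
    derivable (F \o epar e) t 1.
  move=> c; have [] := @chain_line R _ setT ref_a ref_b t openT (CnW c) I.
  by rewrite (_ : (fun s => _) = F \o epar e)//; apply/funext => s; rewrite /= eparE.
by split; apply: DeriveDef; rewrite /epar' ?derive1E; [exact: D|..|exact: D|].
Qed.

Lemma epar'_cont (t : R) : {for t, continuous (fun s => (epar' e s).1)} /\
  {for t, continuous (fun s => (epar' e s).2)}.
Proof.
have [U [W [psi' [_ _ _ _ [c1 c2]]]]] := hreg e.1.1.
have D (F : R * R -> R) : Cn 2 setT (F \o emap T1) ->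
    {for t, continuous (fun s => derive1 (F \o epar e) s)}.
  move=> c; have -> : (fun s => derive1 (F \o epar e) s) = dpar (F \o emap T1).
    apply/funext => s; rewrite derive1E.
    have [_] := @chain_line R _ setT ref_a ref_b s openT (CnW c) I.
    by rewrite (_ : (fun s => _) = F \o epar e)//; apply/funext => u; rewrite /= eparE.
  have cp j : {for t, continuous (fun s : R => pd j (F \o emap T1) (ref_a + s *: ref_b))}.
    apply: (continuous_comp (f := fun s : R => ref_a + s *: ref_b)); first exact: cont_line.
    exact: (Cn_cont (Cn_pd j c) I).
  exact: (cvgD (cvgM (cp ord0) (cvg_cst _)) (cvgM (cp ord_max) (cvg_cst _))).
by split; exact: D.
Qed.

Lemma chain_epar (F : R * R -> R) W (t : R) : open W -> Cn 1 W F -> W (epar e t) ->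
  is_derive t (1 : R) (F \o epar e)
    (pd ord0 F (epar e t) * (epar' e t).1 + pd ord_max F (epar e t) * (epar' e t).2).
Proof.
by move=> oW hF Wt; have [d1 d2] := epar_derive t; exact: (chain oW hF Wt d1 d2).
Qed.

Lemma near_oo (t : R) : 0 < t < 1 -> \forall s \near t, 0 < s < 1.
Proof.
move=> ht; have : nbhs t `]0, 1[%classic.
  by apply: open_nbhs_nbhs; split; [exact: interval_open|rewrite /= in_itv].
by apply: filterS => s; rewrite /= in_itv.
Qed.

(** The parametrization of an edge is regular: the position function of the
    reference side inverts it. *)
Lemma epar'_neq0 (t : R) : 0 < t < 1 -> epar' e t != 0.
Proof.
move=> ht; have [U [W [psi' hT]]] := hreg e.1.1; have oW := openW hT.
have et (s : R) : 0 < s < 1 -> W (epar e s).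
  move=> hs; apply: (elemW hT); apply: edge_elem (edge_set_epar _); lra.
have h := chain_epar oW (CnW (Cn_lft hT (eposc (is_quad T1) e.1.2))) (et _ ht).
have h1 : is_derive t (1 : R) (lft psi' (eposc (is_quad T1) e.1.2) \o epar e) 1.
  apply: near_eq_is_derive (is_derive_id t (1 : R)).
  apply: filterS (near_oo ht) => s hs; rewrite /lft /= (chartK hT) ?epos_edge//.
  by apply: ref_edge_in; lra.
apply/eqP => e0; move: (derive_uniq h h1); rewrite e0 /= !mulr0 addr0 => /eqP.
by rewrite eq_sym oner_eq0.
Qed.

Lemma enorm_gt0 (x : R * R) : x != 0 -> 0 < enorm x.
Proof.
move=> x0; rewrite sqrtr_gt0 lt_neqAle addr_ge0 ?sqr_ge0// andbT eq_sym.
apply: contra x0; rewrite paddr_eq0 ?sqr_ge0// !sqrf_eq0 => /andP[/eqP a /eqP b].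
by rewrite [x]surjective_pairing a b.
Qed.

(** The unit normal is continuous along the open edge. *)
Lemma normal_cont (t : R) : 0 < t < 1 -> {for t, continuous (fun s => (normal e s).1)} /\
  {for t, continuous (fun s => (normal e s).2)}.
Proof.
move=> ht; have [c1 c2] := epar'_cont t.
have cn : {for t, continuous (fun s => (-1) ^+ normal_flip e / enorm (epar' e s))}.
  apply: (cvgM (cvg_cst _)); apply: cvgV; first by rewrite gt_eqF// enorm_gt0// epar'_neq0.
  apply: (continuous_comp (f := fun s => (epar' e s).1 ^+ 2 + (epar' e s).2 ^+ 2)).
    exact: (cvgD (cvgM c1 c1) (cvgM c2 c2)).
  exact: sqrt_continuous.
by split; [exact: (cvgM cn c2)|exact: (cvgM cn (cvgN c1))].
Qed.

(** A side function vanishing along the edge has a nonzero gradient at the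
    points of the open edge of the neighbouring element; being orthogonal to the
    tangent, it is not orthogonal to the normal. *)
Lemma normal_transversal (T : 'I_(nelem M)) U W psi' i (t u : R) :
  chart (elt T) U W psi' -> (forall s, 0 < s < 1 -> edge_set (elt T) i (epar e s)) ->
  0 < t < 1 -> 0 <= u <= 1 -> epar e t = edge_par (elt T) i u ->
  pd ord0 (lft psi' (sidec (is_quad (elt T)) i)) (epar e t) * (normal e t).1 +
  pd ord_max (lft psi' (sidec (is_quad (elt T)) i)) (epar e t) * (normal e t).2 != 0.
Proof.
set F := lft _ _; move=> hT hedge ht hu et; have oW := openW hT.
have We : W (epar e t) by apply: (elemW hT); apply: edge_elem (hedge _ ht).
have hF : Cn 2 W F := Cn_lft hT _.
pose a := pd ord0 F (epar e t); pose b := pd ord_max F (epar e t).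
have tang : a * (epar' e t).1 + b * (epar' e t).2 = 0.
  apply: derive_uniq (chain_epar oW (CnW hF) We) _.
  apply: near_eq_is_derive (is_derive_cst (0 : R) t (1 : R)).
  by apply: filterS (near_oo ht) => s hs; rewrite /= /F (edge_lft hT (hedge _ hs)).
pose w : R * R * R := sidec (is_quad (elt T)) i.
(* The reference coordinates invert the element map, so the side function
   grows at nonzero rate along the image of the reference normal. *)
have grad0 : ~ (a = 0 /\ b = 0).
  move=> [a0 b0]; pose x0 := ref_edge (is_quad (elt T)) i u.
  pose v : R * R := (w.1.2, w.2).
  have [_ _ _ _ [c1 c2]] := hT.
  have x00 : x0 + (0 : R) *: v = x0 by rewrite scale0r addr0.
  have d1 := @chain_line R _ setT x0 v 0 openT (CnW c1) I.
  have d2 := @chain_line R _ setT x0 v 0 openT (CnW c2) I.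
  have ex0 : (emap (elt T) \o (fun s : R => x0 + s *: v)) 0 = epar e t by rewrite /= x00 et.
  have := @chain R F W (emap (elt T) \o (fun s : R => x0 + s *: v)) 0 _ _ oW (CnW hF).
  rewrite ex0 => /(_ _ _ We d1 d2); rewrite -/a -/b a0 b0 !mul0r addr0 => h.
  have h' : is_derive (0 : R) (1 : R) (F \o (emap (elt T) \o (fun s : R => x0 + s *: v)))
     (w.1.2 ^+ 2 + w.2 ^+ 2).
    have [[oU rU _ _] K1 _ _ _] := hT.
    apply: near_eq_is_derive (is_derive_aff (aff w x0) _ _).
    have : \forall s \near (0 : R), U (x0 + s *: v).
      apply: (@cont_line R x0 v 0 U); rewrite x00; apply: open_nbhs_nbhs; split => //.
      exact/rU/ref_edge_in.
    by apply: filterS => s /K1[_ K]; rewrite /F /= /lft -/w K (affD w x0 v s) /= !expr2.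
  by move: (derive_uniq h h') => /esym/eqP; exact/negP/sidec_neq0.
rewrite -/a -/b /normal pairE [(_ *: _).2]scp2 /rotr90/=.
set k := _ / _; have k0 : k != 0.
  rewrite /k mulf_neq0// ?invr_eq0; first by rewrite signr_eq0.
  by rewrite gt_eqF// enorm_gt0// epar'_neq0.
rewrite mulrCA [X in _ + X]mulrCA -mulrDr mulf_neq0//.
have := epar'_neq0 ht; apply: contra => /eqP E; apply/eqP.
set x := (epar' e t).1 in tang E *; set y := (epar' e t).2 in tang E *.
have N : a ^+ 2 + b ^+ 2 != 0.
  apply/negP; rewrite paddr_eq0 ?sqr_ge0// !sqrf_eq0 => /andP[/eqP ? /eqP ?].
  exact: grad0.
have X0 : (a ^+ 2 + b ^+ 2) * x = 0.
  by transitivity (a * (a * x + b * y) - b * (a * y + b * - x)); [ring|rewrite tang E; ring].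
have Y0 : (a ^+ 2 + b ^+ 2) * y = 0.
  by transitivity (b * (a * x + b * y) + a * (a * y + b * - x)); [ring|rewrite tang E; ring].
rewrite [epar' e t]surjective_pairing -/x -/y; congr (_, _); apply/eqP.
  by move/eqP: X0; rewrite mulf_eq0 (negbTE N).
by move/eqP: Y0; rewrite mulf_eq0 (negbTE N).
Qed.

(** The two parametrizations of a shared edge match open edge to open edge. *)
Lemma edge_match (t : R) : 0 < t < 1 ->
  exists2 u : R, 0 < u < 1 & epar e t = edge_par T2 e.2.2 u.
Proof.
move=> ht; have [U [W [psi' hT]]] := hreg e.2.1.
have [U1 [W1 [psi1' hT1]]] := hreg e.1.1.
pose phi s := lft psi' (eposc (is_quad T2) e.2.2) (epar e s).
have phiE s : 0 <= s <= 1 -> 0 <= phi s <= 1 /\ epar e s = edge_par T2 e.2.2 (phi s).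
  move=> hs; have := edge_set_epar hs; rewrite edge_sets => -[r /=]; rewrite in_itv/= => hr E.
  suff -> : phi s = r by rewrite E.
  by rewrite /phi -E /lft (chartK hT) ?epos_edge//; exact: ref_edge_in.
have epos1 s : 0 <= s <= 1 -> lft psi1' (eposc (is_quad T1) e.1.2) (epar e s) = s.
  by move=> hs; rewrite /lft (chartK hT1) ?epos_edge//; exact: ref_edge_in.
have inj : {in `[0, 1] &, injective phi}.
  move=> r s; rewrite !in_itv/= => hr hs E.
  by rewrite -(epos1 r hr) -(epos1 s hs) (phiE _ hr).2 (phiE _ hs).2 E.
have cphi : {within `[0, 1], continuous phi}.
  apply: continuous_in_subspaceT => s; rewrite inE /= in_itv/= => hs.
  apply: (continuous_comp (f := epar e)); first exact: epar_cont.
  apply: (Cn_cont (Cn_lft hT _)); apply: (elemW hT); apply: (edge_elem (i := e.2.2)).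
  by rewrite -edge_sets; exact: edge_set_epar.
have t1 : t \in `[0, 1] by rewrite in_itv/=; lra.
have i0 : (0 : R) \in `[0, 1] by rewrite in_itv/= lexx ler01.
have i1 : (1 : R) \in `[0, 1] by rewrite in_itv/= lexx ler01.
have [p0 _] := phiE 0 ltac:(lra); have [p1 _] := phiE 1 ltac:(lra).
have [pt et] := phiE t ltac:(lra).
exists (phi t) => //.
have [mono|mono] := itv_continuous_inj_mono cphi inj.
  have := mono 0 t i0 t1; have := mono t 1 t1 i1; lra.
have := mono t 0 t1 i0; have := mono 1 t i1 t1; lra.
Qed.

(** Off the end points, the normal line crosses the edge from one neighbour
    into the other; [b] tells into which of the two the normal points. *)
Lemma normal_sides : exists2 b : R -> bool,
    measurable_fun (`]0, 1[%classic : set (measurableTypeR R)) b &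
  forall t, 0 < t < 1 ->
    let Tp := if b t then T1 else T2 in let Tm := if b t then T2 else T1 in
    (\forall s \near 0^'+, (elem_set Tp)° (epar e t + s *: normal e t)) /\
    (\forall s \near 0^'+, (elem_set Tm)° (epar e t - s *: normal e t)).
Proof.
have [U1 [W1 [psi1 hT1]]] := hreg e.1.1; have [U2 [W2 [psi2 hT2]]] := hreg e.2.1.
have oW1 := openW hT1; have oW2 := openW hT2.
pose F1 := lft psi1 (sidec (is_quad T1) e.1.2).
pose F2 := lft psi2 (sidec (is_quad T2) e.2.2).
have hF1 : Cn 2 W1 F1 := Cn_lft hT1 _.
pose D F t := pd ord0 F (epar e t) * (normal e t).1 + pd ord_max F (epar e t) * (normal e t).2.
have es1 t : 0 < t < 1 -> edge_set T1 e.1.2 (epar e t).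
  by move=> ht; apply: edge_set_epar; lra.
have es2 t : 0 < t < 1 -> edge_set T2 e.2.2 (epar e t).
  by move=> ht; rewrite -edge_sets; exact: es1.
exists (fun t => 0 < D F1 t).
  apply: measurable_fun_ltr; first exact: measurable_cst.
  apply: open_continuous_measurable_fun; first exact: interval_open.
  move=> t; rewrite inE /= in_itv/= => ht.
  have [n1 n2] := normal_cont ht.
  have cp j : {for t, continuous (fun s => pd j F1 (epar e s))}.
    apply: (continuous_comp (f := epar e)); first exact: epar_cont.
    by apply: (Cn_cont (Cn_pd j hF1)); exact/(elemW hT1)/edge_elem/(es1 _ ht).
  exact: (cvgD (cvgM (cp ord0) n1) (cvgM (cp ord_max) n2)).
move=> t ht.
have [u hu eu] := edge_match ht.
have nz1 : D F1 t != 0.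
  apply: (normal_transversal hT1 es1 ht (u := t)) => //; lra.
have nz2 : D F2 t != 0.
  apply: (normal_transversal hT2 es2 ht (u := u)) => //; lra.
have Wt1 : W1 (epar e t) by exact/(elemW hT1)/edge_elem/(es1 _ ht).
have Wt2 : W2 (epar e t) by exact/(elemW hT2)/edge_elem/(es2 _ ht).
have ray (T : element R) U W psi i r n : chart T U W psi -> W (epar e t) ->
   edge_set T i (epar e t) -> 0 < r < 1 -> epar e t = edge_par T i r ->
   0 < pd ord0 (lft psi (sidec (is_quad T) i)) (epar e t) * n.1
      + pd ord_max (lft psi (sidec (is_quad T) i)) (epar e t) * n.2 ->
   \forall s \near 0^'+, (elem_set T)° (epar e t + s *: n).
  move=> hT Wt est hr er; apply: (ray_in hT Wt); first exact: (edge_lft hT).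
  move=> j ji; rewrite er /lft (chartK hT); last by apply: ref_edge_in; lra.
  exact: side_edge_gt0.
have rayN (T : element R) U W psi i r : chart T U W psi -> W (epar e t) ->
   edge_set T i (epar e t) -> 0 < r < 1 -> epar e t = edge_par T i r ->
   D (lft psi (sidec (is_quad T) i)) t < 0 ->
   \forall s \near 0^'+, (elem_set T)° (epar e t - s *: normal e t).
  move=> hT Wt est hr er Dn.
  have := ray _ _ _ _ _ _ (- normal e t) hT Wt est hr er.
  rewrite [(- _).1]/(- _) [(- _).2]/(- _) !mulrN -opprD oppr_gt0 => /(_ Dn).
  by apply: filterS => s; rewrite scalerN.
have p1 := ray _ _ _ _ _ _ (normal e t) hT1 Wt1 (es1 _ ht) ht erefl.
have m1 := rayN _ _ _ _ _ _ hT1 Wt1 (es1 _ ht) ht erefl.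
have p2 := ray _ _ _ _ _ _ (normal e t) hT2 Wt2 (es2 _ ht) hu eu.
have m2 := rayN _ _ _ _ _ _ hT2 Wt2 (es2 _ ht) hu eu.
(* The normal and its opposite enter the two elements in one of four ways;
   entering both elements at once is excluded by disjointness. *)
have clash (c : R -> R * R) : (\forall s \near 0^'+, (elem_set T1)° (c s)) ->
    (\forall s \near 0^'+, (elem_set T2)° (c s)) -> False.
  move=> q1 q2; have : \forall s \near (0 : R)^'+, False.
    apply: filterS2 q1 q2 => s i1 i2.
    exact: (interior_disjoint edge_neq i1 (interior_subset i2)).
  by move/filter_ex => -[].
have s1 : (0 < D F1 t) = ~~ (D F1 t < 0) by rewrite -leNgt lt_neqAle eq_sym nz1.
have s2 : (0 < D F2 t) = ~~ (D F2 t < 0) by rewrite -leNgt lt_neqAle eq_sym nz2.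
have [D1|D1] := boolP (0 < D F1 t).
  have [D2|] := boolP (0 < D F2 t); first by case: (clash _ (p1 D1) (p2 D2)).
  by rewrite s2 negbK => D2 /=; split; [exact: p1|exact: m2].
move: D1; rewrite s1 negbK => D1.
have [D2|] := boolP (0 < D F2 t); first by split; [exact: p2|exact: m1].
by rewrite s2 negbK => D2; case: (clash _ (m1 D1) (m2 D2)).
Qed.

End Edge.
End MeshGeometry.

(** * Piecewise continuous functions and their traces *)

Section Piecewise.
Context {R : realType}.
Local Notation T2R := (measurableTypeR R * measurableTypeR R)%type.
Local Notation I01 := (`]0, 1[%classic : set (measurableTypeR R)).
Variables (Om : set (R * R)) (M : mesh R).
Hypotheses (hreg : forall T : 'I_(nelem M), regular (elt T)) (hconf : conforming Om M).

(** Functions that vanish off the open elements and extend continuously from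
    each open element to the closed one. *)
Definition pw (w : R * R -> R) : Prop :=
  (forall x, ~ mesh_interior M x -> w x = 0) /\
  forall T : 'I_(nelem M), exists2 wT : R * R -> R,
    forall x, elem_set (elt T) x -> {for x, continuous wT} &
    forall x, (elem_set (elt T))° x -> w x = wT x.

Lemma pw0 : pw (fun=> 0).
Proof.
split=> // T; exists (fun=> 0) => // x _; exact: cvg_cst.
Qed.

Lemma pw_lin (a : R) u w : pw u -> pw w -> pw (fun x => a * u x + w x).
Proof.
move=> [u0 hu] [w0 hw]; split.
  by move=> x hx; rewrite u0// w0// mulr0 addr0.
move=> T; have [uT cu eu] := hu T; have [wT cw ew] := hw T.
exists (fun x => a * uT x + wT x); last by move=> x hx; rewrite eu// ew.
by move=> x hx; exact: (cvgD (cvgM (cvg_cst a) (cu x hx)) (cw x hx)).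
Qed.

Lemma pw_sum (I : Type) (r : seq I) (P : pred I) (F : I -> R * R -> R) :
  (forall i, P i -> pw (F i)) -> pw (fun x => \sum_(i <- r | P i) F i x).
Proof.
move=> hF; elim: r => [|i r IH].
  by rewrite (_ : (fun _ => _) = fun=> 0); [exact: pw0|apply/funext => x; rewrite big_nil].
case Pi: (P i).
  have := pw_lin 1 (hF i Pi) IH.
  rewrite (_ : (fun x => 1 * _ + _) = (fun x => \sum_(j <- i :: r | P j) F j x))//.
  by apply/funext => x; rewrite big_cons Pi mul1r.
rewrite (_ : (fun x => _) = (fun x => \sum_(j <- r | P j) F j x))//.
by apply/funext => x; rewrite big_cons Pi.
Qed.

Lemma mesh_interior_open : open (mesh_interior M).
Proof. by apply: bigcup_open => T _; exact: open_interior. Qed.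

Lemma pw_cont w x : pw w -> mesh_interior M x -> {for x, continuous w}.
Proof.
move=> [_ hw] [T _ ix]; have [wT cw ew] := hw T.
apply: (cont_near (f := wT)); last exact: cw (interior_subset ix).
have oi : open ((elem_set (elt T))°) by exact: open_interior.
by apply: (open_nearE oi _ ix) => y iy; rewrite ew.
Qed.

Lemma compact_bound (K : set (R * R)) (f : R * R -> R) : compact K ->
  (forall x, K x -> {for x, continuous f}) -> exists B, forall x, K x -> `|f x| <= B.
Proof.
move=> cK cf; have : compact (f @` K).
  apply: continuous_compact cK.
  by apply: continuous_in_subspaceT => x; rewrite inE; exact: cf.
move=> /compact_bounded[B [_ hB]]; exists (`|B| + 1) => x Kx.
by apply: (hB (`|B| + 1)); [rewrite (le_lt_trans (ler_norm B))// ltrDl|exists x].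
Qed.

(** Continuous on the open set of the open elements, zero elsewhere, and bounded
    by compactness of the elements. *)
Lemma pw_bmeas w (D : set (R * R)) : pw w -> measurable (D : set T2R) ->
  bmeas (D : set T2R) w.
Proof.
move=> hw mD; have oI := mesh_interior_open; split.
  apply: (@measurable_funS _ _ _ _ setT) => //.
  have -> : w = w \_ (mesh_interior M).
    apply/funext => x; rewrite /patch; case: ifPn => // /negP h.
    by rewrite hw.1// => h'; apply: h; rewrite inE.
  apply/(measurable_restrictT _ (open_measurable2 oI)).
  by apply: continuous_measurable2 => // x; exact: pw_cont.
have H (T : 'I_(nelem M)) : exists B, forall x, (elem_set (elt T))° x -> `|w x| <= B.
  have [wT cw ew] := hw.2 T.
  have [B hB] := compact_bound (elem_compact (hreg T)) cw.
  by exists B => x ix; rewrite ew//; apply: hB; exact: interior_subset.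
have [B hB] := choice H.
exists (\sum_T `|B T|) => x _; have [[T _ ix]|nx] := pselect (mesh_interior M x).
  by rewrite (le_trans (hB _ _ ix))// (bigD1 T)//= (le_trans (ler_norm _))// lerDl sumr_ge0.
by rewrite hw.1// normr0 sumr_ge0.
Qed.

Section Edge.
Variable e : edge M.
Hypothesis he : e \in interior_edges M.

Local Notation E1 := (elt e.1.1).
Local Notation E2 := (elt e.2.1).

Lemma I01P (t : R) : I01 t -> 0 < t < 1.
Proof. by rewrite /= in_itv. Qed.

Lemma mI01 : measurable I01. Proof. exact: measurable_itv. Qed.

Lemma cont_meas01 (f : R -> R) : (forall t, 0 < t < 1 -> {for t, continuous f}) ->
  measurable_fun I01 f.
Proof.
move=> cf; apply: open_continuous_measurable_fun; first exact: interval_open.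
by move=> t; rewrite inE => /I01P; exact: cf.
Qed.

Lemma cont_bmeas01 (f : R -> R) : (forall t, {for t, continuous f}) -> bmeas I01 f.
Proof.
move=> cf; split; first by apply: cont_meas01.
have : compact (f @` `[0, 1]%classic).
  apply: continuous_compact; last exact: segment_compact.
  by apply: continuous_subspaceT.
move=> /compact_bounded[B [_ hB]]; exists (`|B| + 1) => t /I01P ht.
apply: (hB (`|B| + 1)); first by rewrite (le_lt_trans (ler_norm B))// ltrDl.
by exists t => //; rewrite /= in_itv/=; lra.
Qed.

Lemma epar_E1 (t : R) : 0 < t < 1 -> elem_set E1 (epar e t).
Proof. by move=> ht; apply: edge_elem (edge_set_epar e _); lra. Qed.

Lemma epar_E2 (t : R) : 0 < t < 1 -> elem_set E2 (epar e t).
Proof.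
move=> ht; apply: (edge_elem (i := e.2.2)); rewrite -(edge_sets he).
by apply: edge_set_epar; lra.
Qed.

(** The trace on the edge of a function that is continuous on a neighbouring
    closed element. *)
Lemma trace_bmeas (T : 'I_(nelem M)) (wT : R * R -> R) :
  (forall x, elem_set (elt T) x -> {for x, continuous wT}) ->
  (forall t : R, 0 < t < 1 -> elem_set (elt T) (epar e t)) ->
  bmeas I01 (fun t => wT (epar e t)).
Proof.
move=> cw hT; split.
  apply: cont_meas01 => t ht.
  apply: (continuous_comp (f := epar e)); first exact: (epar_cont hreg).
  exact/cw/hT.
have [B hB] := compact_bound (elem_compact (hreg T)) cw.
by exists B => t /I01P ht; apply/hB/hT.
Qed.

Lemma bmeas_if (b : R -> bool) (f g : R -> R) : measurable_fun I01 b ->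
  bmeas I01 f -> bmeas I01 g -> bmeas I01 (fun t => if b t then f t else g t).
Proof.
move=> mb [mf [B hB]] [mg [C hC]]; split.
  apply: (measurable_fun_if mI01 mb).
    exact: (measurable_funS mI01 (@subIsetl _ _ _) mf).
  exact: (measurable_funS mI01 (@subIsetl _ _ _) mg).
exists (`|B| + `|C|) => t ht; case: (b t).
  by rewrite (le_trans (hB _ ht))// (le_trans (ler_norm _))// lerDl.
by rewrite (le_trans (hC _ ht))// (le_trans (ler_norm _))// lerDr.
Qed.

(** Both one-sided limits exist along the open edge and are bounded measurable
    functions of the parameter. *)
Lemma traces w : pw w -> exists wp wm : R -> R,
  [/\ bmeas I01 wp, bmeas I01 wm & forall t, 0 < t < 1 ->
    w (epar e t + s *: normal e t) @[s --> 0^'+] --> wp t /\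
    w (epar e t - s *: normal e t) @[s --> 0^'+] --> wm t].
Proof.
move=> [_ hw]; have [b mb hb] := normal_sides hreg hconf he.
have [w1 c1 q1] := hw e.1.1; have [w2 c2 q2] := hw e.2.1.
have b1 := trace_bmeas c1 epar_E1; have b2 := trace_bmeas c2 epar_E2.
exists (fun t => if b t then w1 (epar e t) else w2 (epar e t)).
exists (fun t => if b t then w2 (epar e t) else w1 (epar e t)).
split; [exact: bmeas_if|exact: bmeas_if|move=> t ht].
have cp : (epar e t + s *: normal e t) @[s --> (0 : R)^'+] --> epar e t.
  have := cvg_at_right_filter (@cont_line R (epar e t) (normal e t) 0).
  by rewrite scale0r addr0; apply.
have cm : (epar e t - s *: normal e t) @[s --> (0 : R)^'+] --> epar e t.
  have := cvg_at_right_filter (@cont_line R (epar e t) (- normal e t) 0).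
  rewrite scale0r addr0 (_ : (fun s : R => _ + s *: - _) = fun s : R => epar e t - s *: normal e t).
    exact.
  by apply/funext => s; rewrite scalerN.
have lim (c : R -> R * R) (T : 'I_(nelem M)) wT : c s @[s --> (0 : R)^'+] --> epar e t ->
   {for epar e t, continuous wT} ->
   (forall x, (elem_set (elt T))° x -> w x = wT x) ->
   (\forall s \near (0 : R)^'+, (elem_set (elt T))° (c s)) ->
   w (c s) @[s --> (0 : R)^'+] --> wT (epar e t).
  move=> cc cT ew hc; have := cvg_comp _ _ cc cT.
  apply: cvg_trans; apply: near_eq_cvg; apply: filterS hc => s hs.
  by rewrite /= ew.
have k1 := c1 _ (epar_E1 ht); have k2 := c2 _ (epar_E2 ht).
have := hb t ht; case: (b t) => -[p m]; split.
- exact: (lim _ e.1.1 w1 cp k1 q1 p).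
- exact: (lim _ e.2.1 w2 cm k2 q2 m).
- exact: (lim _ e.2.1 w2 cp k2 q2 p).
- exact: (lim _ e.1.1 w1 cm k1 q1 m).
Qed.

Lemma side_bmeas w : pw w -> bmeas I01 (side_plus e w) /\ bmeas I01 (side_minus e w).
Proof.
move=> hw; have [wp [wm [bp bm h]]] := traces hw.
by split; [apply: bmeas_ext bp|apply: bmeas_ext bm] => t /I01P /h[p m]; symmetry;
  exact: cvg_lim.
Qed.

(** Limits are linear only where they exist; their existence is the content of
    [traces]. *)
Lemma side_lin (a : R) u w t : pw u -> pw w -> 0 < t < 1 ->
  side_plus e (fun x => a * u x + w x) t = a * side_plus e u t + side_plus e w t /\
  side_minus e (fun x => a * u x + w x) t = a * side_minus e u t + side_minus e w t.
Proof.
move=> hu hw ht; have [up [um [_ _ /(_ t ht)[pu mu]]]] := traces hu.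
have [wp [wm [_ _ /(_ t ht)[p m]]]] := traces hw.
rewrite /side_plus /side_minus (cvg_lim _ pu)// (cvg_lim _ mu)// (cvg_lim _ p)// (cvg_lim _ m)//.
split; apply: cvg_lim => //.
  exact: (cvgD (cvgM (cvg_cst a) pu) p).
exact: (cvgD (cvgM (cvg_cst a) mu) m).
Qed.

(** One-sided limits only depend on the values in the two adjacent open
    elements. *)
Lemma side_eq u w t :
  (forall x, (elem_set E1)° x \/ (elem_set E2)° x -> u x = w x) -> 0 < t < 1 ->
  side_plus e u t = side_plus e w t /\ side_minus e u t = side_minus e w t.
Proof.
move=> uw ht; have [b _ /(_ t ht)] := normal_sides hreg hconf he.
have E (c : R -> R * R) (T : 'I_(nelem M)) : (T = e.1.1) \/ (T = e.2.1) ->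
  (\forall s \near (0 : R)^'+, (elem_set (elt T))° (c s)) ->
  lim (u (c s) @[s --> (0 : R)^'+]) = lim (w (c s) @[s --> (0 : R)^'+]).
  move=> hT hc; congr lim; apply/seteqP.
  have H : \forall s \near (0 : R)^'+, u (c s) = w (c s).
    by apply: filterS hc => s hs; apply: uw; case: hT => <-; [left|right].
  split; apply: near_eq_cvg => //; by apply: filterS H => s.
by case: (b t) => -[p m]; split; apply: E;
  [left|exact: p|right|exact: m|right|exact: p|left|exact: m].
Qed.

Lemma jump_bmeas w : pw w -> bmeas I01 (jump e w).
Proof.
move=> /side_bmeas[p m].
by apply: bmeas_ext (bmeasD m (bmeasZ (-1) p)) => t _; rewrite mulN1r.
Qed.

Lemma avg_bmeas w : pw w -> bmeas I01 (avg e w).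
Proof. by move=> /side_bmeas[p m]; apply: bmeasZ; exact: bmeasD. Qed.

Lemma jump_lin (a : R) u w t : pw u -> pw w -> 0 < t < 1 ->
  jump e (fun x => a * u x + w x) t = a * jump e u t + jump e w t.
Proof.
by move=> hu hw ht; have [p m] := side_lin a hu hw ht; rewrite /jump p m; ring.
Qed.

Lemma avg_lin (a : R) u w t : pw u -> pw w -> 0 < t < 1 ->
  avg e (fun x => a * u x + w x) t = a * avg e u t + avg e w t.
Proof.
by move=> hu hw ht; have [p m] := side_lin a hu hw ht; rewrite /avg p m; ring.
Qed.

Lemma avg_eq u w t :
  (forall x, (elem_set E1)° x \/ (elem_set E2)° x -> u x = w x) -> 0 < t < 1 ->
  avg e u t = avg e w t.
Proof. by move=> uw ht; have [p m] := side_eq uw ht; rewrite /avg p m. Qed.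

Lemma normal_bmeas : bmeas I01 (fun t => (normal e t).1) /\ bmeas I01 (fun t => (normal e t).2).
Proof.
have bnd (x y : R) : x ^+ 2 + y ^+ 2 = 1 -> `|x| <= 1.
  by move=> h; rewrite ler_norml; nra.
have N t : 0 < t < 1 -> (normal e t).1 ^+ 2 + (normal e t).2 ^+ 2 = 1.
  move=> ht; have := enorm_gt0 (epar'_neq0 hreg e ht).
  rewrite /normal scp1 scp2 /=; set a := enorm _ => a0.
  have E : (epar' e t).1 ^+ 2 + (epar' e t).2 ^+ 2 = a ^+ 2.
    by rewrite sqr_sqrtr// addr_ge0// sqr_ge0.
  have [-> ->] : (snd \o epar e)^`()%classic t = (epar' e t).2 /\
    (fst \o epar e)^`()%classic t = (epar' e t).1 by [].
  rewrite !exprMn sqrrN -mulrDr addrC E sqrr_sign mul1r exprVn mulVf//.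
  by rewrite expf_neq0// gt_eqF.
split; split; try by apply: cont_meas01 => t /(normal_cont hreg e)[].
  by exists 1 => t /I01P /N; exact: bnd.
by exists 1 => t /I01P /N; rewrite addrC; exact: bnd.
Qed.

Lemma enorm_bmeas : bmeas I01 (fun t => enorm (epar' e t)).
Proof.
apply: cont_bmeas01 => t; have [c1 c2] := epar'_cont hreg e t.
apply: (continuous_comp (f := fun s => (epar' e s).1 ^+ 2 + (epar' e s).2 ^+ 2)).
  exact: (cvgD (cvgM c1 c1) (cvgM c2 c2)).
exact: sqrt_continuous.
Qed.

Lemma int_edge_lin (a : R) f g : bmeas I01 f -> bmeas I01 g ->
  int_edge e (fun t => a * f t + g t) = a * int_edge e f + int_edge e g.
Proof.
move=> hf hg; have hn := enorm_bmeas.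
have fin : (lebesgue_measure I01 < +oo)%E.
  by rewrite lebesgue_measure_itv /= lte_fin ltr01 oppr0 adde0 ltry.
rewrite /int_edge -(Rint_lin mI01 fin a (bmeasM hf hn) (bmeasM hg hn)).
by apply: Rint_eq => t _; ring.
Qed.

Lemma int_edge_eq f g : (forall t, 0 < t < 1 -> f t = g t) -> int_edge e f = int_edge e g.
Proof. by move=> fg; apply: Rint_eq => t /I01P /fg ->. Qed.

Lemma int_edge_ge0 f : (forall t, 0 < t < 1 -> 0 <= f t) -> 0 <= int_edge e f.
Proof.
move=> f0; apply: Rintegral_ge0 => t /I01P ht.
by rewrite mulr_ge0 ?f0// sqrtr_ge0.
Qed.

End Edge.
End Piecewise.

(** * Finite-dimensional linear problems *)

Section Galerkin.
Variables (R : realFieldType).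

(** A nonempty family of row vectors that is closed under linear combinations is
    the row space of a matrix, whose rows belong to the family. *)
Lemma subspace_rows (N : nat) (S : 'rV[R]_N -> Prop) : S 0 ->
  (forall a u v, S u -> S v -> S (a *: u + v)) ->
  exists (n : nat) (A : 'M[R]_(n, N)), (forall i, S (row i A)) /\
    forall v, S v -> (v <= A)%MS.
Proof.
move=> S0 Sl.
pose P r := `[< exists (n : nat) (A : 'M[R]_(n, N)), (forall i, S (row i A)) /\ \rank A = r >].
have P0 : exists r, P r.
  exists 0%N; apply/asboolP; exists 1%N, 0; split; last by rewrite mxrank0.
  by move=> i; rewrite row0.
have Pub r : P r -> (r <= N)%N by move=> /asboolP[n [A [_ <-]]]; exact: rank_leq_col.
case: (ex_maxnP P0 Pub) => r /asboolP[n [A [SA rA]]] rmax.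
exists n, A; split => // v Sv; case: (boolP (v <= A)%MS) => // nv; exfalso.
have : P (\rank (col_mx A v)).
  apply/asboolP; exists (n + 1)%N, (col_mx A v); split => // i.
  rewrite -[i]splitK; case: (fintype.split i) => j /=.
    by rewrite rowKu; exact: SA.
  by rewrite rowKd row_id.
move=> /rmax; rewrite -rA leqNgt; case/negP.
apply: rank_ltmx; rewrite /ltmx -addsmxE addsmxSl /=.
by apply: contra nv; rewrite -addsmxE; apply: submx_trans; exact: addsmxSr.
Qed.

Variables (V : lmodType R) (I : finType) (P : V -> Prop) (rep : (I -> R) -> V -> Prop).
Variables (B : V -> V -> R) (F : V -> R).

(** Existence part of the Lax-Milgram lemma on a finite-dimensional space of
    functions.  The space [P] is described by (not necessarily unique)
    coordinates [rep c u]; the form [B] need only be nonnegative in the sense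
    that the functional [F] vanishes where [B u u] does. *)
Lemma galerkin :
  P 0 -> (forall a u v, P u -> P v -> P (a *: u + v)) ->
  (forall u, P u -> exists c, rep c u) ->
  (forall a c d u v, rep c u -> rep d v -> rep (fun i => a * c i + d i) (a *: u + v)) ->
  (forall a u v w, P u -> P v -> P w -> B (a *: u + v) w = a * B u w + B v w) ->
  (forall a u v w, P u -> P v -> P w -> B w (a *: u + v) = a * B w u + B w v) ->
  (forall a u v, P u -> P v -> F (a *: u + v) = a * F u + F v) ->
  (forall u, P u -> B u u = 0 -> F u = 0) ->
  (forall u, P u -> rep (fun=> 0) u -> F u = 0 /\ forall v, P v -> B v u = 0) ->
  exists2 u, P u & forall v, P v -> B u v = F v.
Proof.
move=> P0 Pl hrep repl Bl Br Fl Bdef null.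
pose cf (c : 'rV[R]_#|I|) : I -> R := fun i => c 0 (enum_rank i).
pose S c := exists2 u, P u & rep (cf c) u.
have F0 : F 0 = 0 by have := Fl (-1) 0 0 P0 P0; rewrite scaler0 addr0 mulN1r addNr.
have B0r v : P v -> B v 0 = 0.
  by move=> Pv; have := Br (-1) 0 0 v P0 P0 Pv; rewrite scaler0 addr0 mulN1r addNr.
have B0l v : P v -> B 0 v = 0.
  by move=> Pv; have := Bl (-1) 0 0 v P0 P0 Pv; rewrite scaler0 addr0 mulN1r addNr.
have repE c d u : rep c u -> (forall i, c i = d i) -> rep d u.
  by move=> h E; rewrite (_ : d = c)//; apply/funext => i; rewrite E.
have rep0 : exists2 u, P u & rep (fun=> 0) u.
  have [c hc] := hrep _ P0; exists (-1 *: 0 + 0); first exact: Pl.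
  by apply: repE (repl (-1) c c 0 0 hc hc) _ => i; rewrite mulN1r addNr.
have S0 : S 0 by have [u Pu hu] := rep0; exists u => //; apply: repE hu _ => i; rewrite /cf mxE.
have Sl a c d : S c -> S d -> S (a *: c + d).
  move=> [u Pu hu] [v Pv hv]; exists (a *: u + v); first exact: Pl.
  by apply: repE (repl a _ _ _ _ hu hv) _ => i; rewrite /cf !mxE.
have [n [A [SA Amax]]] := subspace_rows S0 Sl.
have H i : exists u, P u /\ rep (cf (row i A)) u by have [u ? ?] := SA i; exists u.
have [U hU] := choice H.
pose comb (c : 'I_n -> R) := \sum_i c i *: U i.
have combP (J : seq 'I_n) c : P (\sum_(i <- J) c i *: U i).
  elim: J => [|i J IH]; first by rewrite big_nil.
  by rewrite big_cons; apply: Pl => //; exact: (hU i).1.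
have combB (J : seq 'I_n) c v : P v ->
    B (\sum_(i <- J) c i *: U i) v = \sum_(i <- J) c i * B (U i) v.
  move=> Pv; elim: J => [|i J IH]; first by rewrite !big_nil B0l.
  by rewrite !big_cons Bl ?IH//; exact: (hU i).1.
have combB' (J : seq 'I_n) c v : P v ->
    B v (\sum_(i <- J) c i *: U i) = \sum_(i <- J) c i * B v (U i).
  move=> Pv; elim: J => [|i J IH]; first by rewrite !big_nil B0r.
  by rewrite !big_cons Br ?IH//; exact: (hU i).1.
have combF (J : seq 'I_n) c : F (\sum_(i <- J) c i *: U i) = \sum_(i <- J) c i * F (U i).
  elim: J => [|i J IH]; first by rewrite !big_nil.
  by rewrite !big_cons Fl ?IH//; exact: (hU i).1.
(* [rep] need not relate the zero vector to zero coordinates, whence the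
   correction [z] with vanishing coordinates. *)
have combrep (J : seq 'I_n) c : exists2 z, rep (fun=> 0) z & P z /\
    rep (fun k => \sum_(i <- J) c i * cf (row i A) k) (\sum_(i <- J) c i *: U i + z).
  elim: J => [|i J [z hz [Pz IH]]].
    have [z Pz hz] := rep0; exists z => //; split => //.
    by rewrite big_nil add0r; apply: repE hz _ => k; rewrite big_nil.
  exists z => //; split => //; rewrite big_cons -addrA.
  by apply: repE (repl (c i) _ _ _ _ (hU i).2 IH) _ => k; rewrite big_cons.
pose G : 'M[R]_n := \matrix_(i, j) B (U i) (U j).
pose f : 'rV[R]_n := \row_j F (U j).
(* The load vector is in the row space of the Gram matrix: a vector of the
   cokernel gives a combination [u] with [B u u = 0], on which [F] vanishes. *)
have fG : (f <= G)%MS.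
  rewrite submxE; apply/eqP/matrixP => r k; rewrite [r]ord1 {r} mxE [RHS]mxE.
  pose c i := cokermx G i k.
  have Pc : P (comb c) by exact: combP.
  have FE : F (comb c) = \sum_i f 0 i * cokermx G i k.
    by rewrite /comb combF; apply: eq_bigr => i _; rewrite [f 0 i]mxE mulrC.
  rewrite -FE; apply: Bdef => //.
  rewrite /comb combB//; apply: big1 => i _.
  rewrite combB'; last exact: (hU i).1.
  have /matrixP/(_ i k) := mulmx_coker G; rewrite mxE [RHS]mxE => E.
  rewrite (_ : \sum_(j <- _) _ = 0) ?mulr0// -[RHS]E.
  by apply: eq_bigr => j _; rewrite [G i j]mxE mulrC.
have /submxP[x fx] := fG.
exists (comb (fun i => x 0 i)); first exact: combP.
move=> v Pv; have [c hc] := hrep _ Pv.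
pose cv : 'rV[R]_#|I| := \row_j c (enum_val j).
have Sv : S cv by exists v => //; apply: repE hc _ => i; rewrite /cf mxE enum_rankK.
have /submxP[y cy] := Amax _ Sv.
have [z hz [Pz hyz]] := combrep (index_enum 'I_n) (fun i => y 0 i).
(* The part of [v] that the chosen basis does not reach has zero coordinates. *)
pose w := -1 *: (comb (fun i => y 0 i) + z) + v.
have Pcy : P (comb (fun i => y 0 i)) by exact: combP.
have Pcz : P (comb (fun i => y 0 i) + z).
  by have := Pl 1 _ _ Pcy Pz; rewrite scale1r.
have Pw : P w by exact: Pl.
have hw : rep (fun=> 0) w.
  apply: repE (repl (-1) _ _ _ _ hyz hc) _ => i.
  have -> : c i = cv 0 (enum_rank i) by rewrite mxE enum_rankK.
  rewrite cy !mxE mulN1r addrC; apply/eqP; rewrite subr_eq0; apply/eqP.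
  by apply: eq_bigr => j _; rewrite /cf !mxE.
have [Fw Bw] := null _ Pw hw; have [Fz Bz] := null _ Pz hz.
have vE : v = 1 *: comb (fun i => y 0 i) + (1 *: z + w).
  by rewrite !scale1r /w scaleN1r addrA addrA subrr add0r.
have P1 : P (1 *: z + w) by exact: Pl.
have Px : P (comb (fun i => x 0 i)) by exact: combP.
rewrite vE Br// Br// Fl// Fl// Fz Fw Bz// Bw// !mulr0 !addr0 !mul1r.
rewrite /comb combB' // combF; apply: eq_bigr => j _; congr (_ * _).
rewrite combB; last exact: (hU j).1.
have /matrixP/(_ 0 j) := fx; rewrite !mxE => ->.
by apply: eq_bigr => i _; rewrite !mxE.
Qed.

End Galerkin.

(** * The inverse square root of the metric *)

Section Metric.
Context {R : realType}.
Local Notation o := (@ord0 1).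
Local Notation i := (@ord_max 1).

Lemma sum2 (F : 'I_2 -> R) : \sum_k F k = F o + F i.
Proof. by rewrite !big_ord_recl big_ord0 addr0; congr (_ + F _); apply: val_inj. Qed.

Lemma mx2P (A B : 'M[R]_2) : A o o = B o o -> A o i = B o i -> A i o = B i o ->
  A i i = B i i -> A = B.
Proof.
by move=> *; apply/matrixP => r c; case: (ord2P r) => ->; case: (ord2P c) => ->.
Qed.

Lemma mulmx2 (A B : 'M[R]_2) r c : (A *m B) r c = A r o * B o c + A r i * B i c.
Proof. by rewrite mxE sum2. Qed.

Lemma quad_formE (A : 'M[R]_2) (xi : 'cV[R]_2) : (xi^T *m A *m xi) ord0 ord0 =
  A o o * xi o ord0 ^+ 2 + (A o i + A i o) * (xi o ord0 * xi i ord0)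
  + A i i * xi i ord0 ^+ 2.
Proof. by rewrite mxE sum2 !mxE !sum2 !mxE; ring. Qed.

Lemma norm_formE (xi : 'cV[R]_2) : (xi^T *m xi) ord0 ord0 = xi o ord0 ^+ 2 + xi i ord0 ^+ 2.
Proof. by rewrite mxE sum2 !mxE; ring. Qed.

(** The column vector with entries [x] and [y]. *)
Definition cvec (x y : R) : 'cV[R]_2 := \col_j (if j == ord0 then x else y).

Lemma cvec0 x y : cvec x y o ord0 = x. Proof. by rewrite mxE. Qed.
Lemma cvec1 x y : cvec x y i ord0 = y. Proof. by rewrite mxE. Qed.

(** The symmetric matrix with diagonal entries [p] and [r] and off-diagonal
    entry [q]. *)
Definition sym2 (p q r : R) : 'M[R]_2 :=
  \matrix_(a, b) (if a == b then if a == ord0 then p else r else q).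

Lemma sym2E p q r : ((sym2 p q r o o = p) * (sym2 p q r o i = q) * (sym2 p q r i o = q) *
  (sym2 p q r i i = r))%type.
Proof. by rewrite !mxE. Qed.

(** The entries of the inverse square root of a symmetric positive definite
    matrix, by the Cayley-Hamilton theorem: if [B ^ 2 = N] then
    [(\tr B) B = N + \det B].  For the inverse [N] of the matrix with diagonal
    [a], [d] and off-diagonal entry [b], [isq_s] is [\det B] and [isq_t] is
    [\tr B]. *)
Definition isq_s (a b d : R) : R := Num.sqrt (a * d - b ^+ 2)^-1.
Definition isq_t (a b d : R) : R :=
  Num.sqrt ((a + d) * (a * d - b ^+ 2)^-1 + 2 * isq_s a b d).
Definition isq (a b d : R) : 'M[R]_2 :=
  sym2 ((d * (a * d - b ^+ 2)^-1 + isq_s a b d) * (isq_t a b d)^-1)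
       (- b * (a * d - b ^+ 2)^-1 * (isq_t a b d)^-1)
       ((a * (a * d - b ^+ 2)^-1 + isq_s a b d) * (isq_t a b d)^-1).

Section OneMatrix.
Variables (A : 'M[R]_2) (c0 : R).
Hypotheses (c0p : 0 < c0) (symA : A^T = A).
Hypothesis hA : forall xi : 'cV[R]_2,
  c0 * (xi^T *m xi) ord0 ord0 <= (xi^T *m A *m xi) ord0 ord0.

Let a := A o o.
Let b := A o i.
Let d := A i i.
Let D := a * d - b ^+ 2.

Let symb : A i o = b.
Proof. by rewrite /b -[in RHS]symA mxE. Qed.

Let hq x y : c0 * (x ^+ 2 + y ^+ 2) <= a * x ^+ 2 + 2 * b * (x * y) + d * y ^+ 2.
Proof.
have := hA (cvec x y); rewrite quad_formE norm_formE !cvec0 !cvec1 symb -/a -/b -/d.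
by rewrite (_ : b + b = 2 * b)//; ring.
Qed.

Let ha : c0 <= a.
Proof. by have := hq 1 0; rewrite expr1n expr0n /= !mulr0 !addr0 !mulr1. Qed.

Let hd : c0 <= d.
Proof. by have := hq 0 1; rewrite expr1n expr0n /= !mulr0 mul0r !mulr0 !add0r !mulr1. Qed.

Let hDa : c0 * a <= D.
Proof.
have a0 : 0 < a by exact: lt_le_trans ha.
have := hq (- b) a; rewrite -(ler_pM2l a0 (c0 * a)) => h.
apply: le_trans (_ : c0 * ((- b) ^+ 2 + a ^+ 2) <= _).
  have := sqr_ge0 b; rewrite sqrrN => b0.
  have : 0 <= c0 * b ^+ 2 by rewrite mulr_ge0// ltW.
  lra.
have <- : a * (- b) ^+ 2 + 2 * b * (- b * a) + d * a ^+ 2 = a * D by rewrite /D; ring.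
exact: h.
Qed.

Let hDd : c0 * d <= D.
Proof.
have d0 : 0 < d by exact: lt_le_trans hd.
have := hq d (- b); rewrite -(ler_pM2l d0 (c0 * d)) => h.
apply: le_trans (_ : c0 * (d ^+ 2 + (- b) ^+ 2) <= _).
  have := sqr_ge0 b; rewrite sqrrN => b0.
  have : 0 <= c0 * b ^+ 2 by rewrite mulr_ge0// ltW.
  lra.
have <- : a * d ^+ 2 + 2 * b * (d * - b) + d * (- b) ^+ 2 = d * D by rewrite /D; ring.
exact: h.
Qed.

Lemma det_gt0 : 0 < A o o * A i i - A o i ^+ 2.
Proof. by apply: lt_le_trans hDa; rewrite mulr_gt0// (lt_le_trans c0p ha). Qed.

Let D0 : 0 < D. Proof. exact: det_gt0. Qed.
Let a0 : 0 < a. Proof. exact: lt_le_trans ha. Qed.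
Let d0 : 0 < d. Proof. exact: lt_le_trans hd. Qed.
Let s := isq_s a b d.
Let t := isq_t a b d.

Let s0 : 0 < s. Proof. by rewrite sqrtr_gt0 invr_gt0. Qed.
Let s2 : s ^+ 2 = D^-1. Proof. by rewrite sqr_sqrtr// invr_ge0 ltW. Qed.

Lemma isq_t_arg_gt0 : 0 < (a + d) * D^-1 + 2 * s.
Proof.
have D1 : 0 < D^-1 by rewrite invr_gt0.
have h := mulr_gt0 (addr_gt0 a0 d0) D1.
have := s0; lra.
Qed.

Let t0 : 0 < t. Proof. by rewrite sqrtr_gt0 isq_t_arg_gt0. Qed.
Let t2 : t ^+ 2 = (a + d) * D^-1 + 2 * s.
Proof. by rewrite sqr_sqrtr// ltW// isq_t_arg_gt0. Qed.

Let N := sym2 (d * D^-1) (- b * D^-1) (a * D^-1).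

Let AN : A *m N = 1%:M.
Proof.
have DD : D * D^-1 = 1 by rewrite divff// gt_eqF.
by apply: mx2P; rewrite mulmx2 !sym2E ?symb -/a -/b -/d !mxE/= -?DD /D ?mulr1n ?mulr0n; ring.
Qed.

Let invA : invmx A = N.
Proof.
have [uA _] := mulmx1_unit AN.
by rewrite -[invmx A]mulmx1 -AN mulmxA mulVmx// mul1mx.
Qed.

Let B := isq a b d.

Let BB : B *m B = N.
Proof.
have DD : D * D^-1 = 1 by rewrite divff// gt_eqF.
have tt : t^-1 * t^-1 * t ^+ 2 = 1.
  by rewrite -expr2 -exprMn mulVf ?expr1n// gt_eqF.
set u := t^-1 in tt *; set v := D^-1 in DD *.
have s2v : s ^+ 2 = v := s2; have t2v : t ^+ 2 = (a + d) * v + 2 * s := t2.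
have vv : (a * d - b ^+ 2) * v ^+ 2 = v by rewrite -/D expr2 mulrA DD mul1r.
have K (x y : R) : x = t ^+ 2 * y -> u * u * x = y.
  by move=> ->; rewrite mulrA tt mul1r.
apply: mx2P; rewrite mulmx2 !sym2E -/s -/t -/D -/u -/v.
- transitivity (u * u * ((d * v + s) ^+ 2 + (b * v) ^+ 2)); first by ring.
  apply: K; rewrite t2v.
  have -> : (d * v + s) ^+ 2 = (d * v) ^+ 2 + 2 * s * d * v + s ^+ 2 by ring.
  by rewrite s2v -[X in _ + X + _]vv; ring.
- transitivity (u * u * (- b * v * ((a + d) * v + 2 * s))); first by ring.
  by apply: K; rewrite t2v; ring.
- transitivity (u * u * (- b * v * ((a + d) * v + 2 * s))); first by ring.
  by apply: K; rewrite t2v; ring.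
- transitivity (u * u * ((a * v + s) ^+ 2 + (b * v) ^+ 2)); first by ring.
  apply: K; rewrite t2v.
  have -> : (a * v + s) ^+ 2 = (a * v) ^+ 2 + 2 * s * a * v + s ^+ 2 by ring.
  by rewrite s2v -[X in _ + X + _]vv; ring.
Qed.

Let posB : posdef B.
Proof.
split; first by apply: mx2P; rewrite mxE !sym2E.
move=> xi xi0; rewrite quad_formE !sym2E -/s -/t -/D.
set x := xi o ord0; set y := xi i ord0.
have xy : 0 < x ^+ 2 + y ^+ 2.
  rewrite lt_neqAle addr_ge0 ?sqr_ge0// andbT eq_sym.
  apply: contra xi0; rewrite paddr_eq0 ?sqr_ge0// !sqrf_eq0 => /andP[/eqP x0 /eqP y0].
  by apply/eqP/matrixP => r c; rewrite [c]ord1 mxE; case: (ord2P r) => ->.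
have q0 : 0 <= d * x ^+ 2 - 2 * b * (x * y) + a * y ^+ 2.
  have h := hq y (- x); rewrite sqrrN in h.
  have : 0 <= c0 * (y ^+ 2 + x ^+ 2) by rewrite mulr_ge0 ?ltW// addrC.
  lra.
have -> : (d * D^-1 + s) * t^-1 * x ^+ 2 + (- b * D^-1 * t^-1 + - b * D^-1 * t^-1) * (x * y) +
   (a * D^-1 + s) * t^-1 * y ^+ 2 =
   t^-1 * (D^-1 * (d * x ^+ 2 - 2 * b * (x * y) + a * y ^+ 2) + s * (x ^+ 2 + y ^+ 2)) by ring.
by rewrite mulr_gt0 ?invr_gt0// ltr_wpDl ?mulr_gt0// mulr_ge0// invr_ge0 ltW.
Qed.

Let uniqB C : posdef C -> C *m C = N -> C = B.
Proof.
move=> [symC posC] CC; have C10 : C i o = C o i by rewrite -[in RHS]symC mxE.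
set p := C o o; set q := C o i; set r := C i i.
have pos x y : x != 0 -> 0 < p * x ^+ 2 + 2 * q * (x * y) + r * y ^+ 2.
  move=> x0; have := posC (cvec x y); rewrite quad_formE !cvec0 !cvec1 C10 -/p -/q -/r.
  rewrite (_ : q + q = 2 * q); last by ring.
  apply; apply: contra x0 => /eqP/matrixP/(_ o ord0); rewrite cvec0 mxE => ->//.
have p0 : 0 < p by have := pos 1 0 (oner_neq0 _); rewrite expr1n expr0n /= !mulr0 !addr0 mulr1.
have E0 : 0 < p * r - q ^+ 2.
  have [q0|q0] := eqVneq q 0.
    rewrite q0 expr0n /= subr0; apply: mulr_gt0 => //.
    have := posC (cvec 0 1); rewrite quad_formE !cvec0 !cvec1 expr0n expr1n /= mul0r !mulr0 !add0r mulr1.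
    apply; apply/negP => /eqP/matrixP/(_ i ord0); rewrite cvec1 mxE => /eqP.
    by rewrite oner_eq0.
  have := pos (- q) p; rewrite oppr_eq0 => /(_ q0).
  have -> : p * (- q) ^+ 2 + 2 * q * (- q * p) + r * p ^+ 2 = p * (p * r - q ^+ 2) by ring.
  by rewrite pmulr_rgt0.
have e1 : p ^+ 2 + q ^+ 2 = d * D^-1.
  by move/matrixP/(_ o o): CC; rewrite mulmx2 !sym2E C10 -/p -/q !expr2.
have e2 : q * (p + r) = - b * D^-1.
  by move/matrixP/(_ o i): CC; rewrite mulmx2 !sym2E -/p -/q -/r => <-; ring.
have e3 : q ^+ 2 + r ^+ 2 = a * D^-1.
  by move/matrixP/(_ i i): CC; rewrite mulmx2 !sym2E C10 -/q -/r !expr2.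
have r0 : 0 < r.
  have : 0 < p * r by have := sqr_ge0 q; lra.
  by rewrite pmulr_rgt0.
have Es : p * r - q ^+ 2 = s.
  apply/eqP; rewrite -(eqrXn2 (n := 2))//; [|exact: ltW|exact: ltW].
  rewrite s2; apply/eqP.
  transitivity ((p ^+ 2 + q ^+ 2) * (q ^+ 2 + r ^+ 2) - (q * (p + r)) ^+ 2); first by ring.
  rewrite e1 e2 e3.
  transitivity (D * D^-1 * D^-1); first by rewrite /D; ring.
  by rewrite divff ?mul1r// gt_eqF.
have Et : p + r = t.
  apply/eqP; rewrite -(eqrXn2 (n := 2))//; [|exact/ltW/addr_gt0|exact: ltW].
  rewrite t2 -Es; apply/eqP.
  transitivity ((p ^+ 2 + q ^+ 2) + (q ^+ 2 + r ^+ 2) + 2 * (p * r - q ^+ 2)); first by ring.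
  by rewrite e1 e3; ring.
have tn : t != 0 by rewrite gt_eqF.
apply: mx2P; rewrite ?C10 !sym2E -/p -/q -/r -/s -/t -/D; apply: (mulIf tn);
  rewrite divfK// -Et ?e2//.
- by rewrite -e1 -Es; ring.
- by rewrite -e3 -Es; ring.
Qed.

(** Positive definite square roots are unique, so the chosen inverse square root
    is given by the explicit formula. *)
Lemma invsqrtmxE : invsqrtmx A = isq (A o o) (A o i) (A i i).
Proof.
rewrite /invsqrtmx; case: xgetP => [C _ [pC]|]; first by rewrite invA; exact: uniqB.
by move=> /(_ B) []; split=> //; rewrite BB invA.
Qed.

Lemma invsqrtmx_conj : invsqrtmx A *m A *m invsqrtmx A = 1%:M.
Proof.
rewrite invsqrtmxE -/a -/b -/d -/B.
have BBA : B *m B *m A = 1%:M by rewrite BB -invA mulVmx//; case: (mulmx1_unit AN).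
have uB : B \in unitmx by have := mulmx1_unit (etrans (mulmxA B B A) BBA); case.
have /(congr1 (mulmx (invmx B))) := BBA.
rewrite -mulmxA mulKmx// mulmx1 => ->.
exact: mulVmx.
Qed.

(** The bound depends only on the ellipticity constant, since the squares of the
    entries are dominated by the diagonal of the inverse matrix. *)
Lemma invsqrtmx_bound r c : `|invsqrtmx A r c| <= 1 + c0^-1.
Proof.
have E (x : R) : x ^+ 2 <= c0^-1 -> `|x| <= 1 + c0^-1.
  have c1 : 0 < c0^-1 by rewrite invr_gt0.
  by move=> h; rewrite ler_norml; nra.
have cd (x : R) : c0 * x <= D -> x * D^-1 <= c0^-1.
  by move=> h; rewrite ler_pdivrMr// ler_pdivlMl.
have e1 : B o o ^+ 2 + B o i ^+ 2 = d * D^-1.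
  by have /matrixP/(_ o o) := BB; rewrite mulmx2 !sym2E !expr2.
have e3 : B o i ^+ 2 + B i i ^+ 2 = a * D^-1.
  by have /matrixP/(_ i i) := BB; rewrite mulmx2 !sym2E !expr2.
have B10 : B i o = B o i by rewrite !sym2E.
have h1 := cd _ hDd; have h3 := cd _ hDa.
have q1 := sqr_ge0 (B o o); have q2 := sqr_ge0 (B o i); have q3 := sqr_ge0 (B i i).
rewrite invsqrtmxE -/a -/b -/d -/B; apply: E.
by case: (ord2P r) => ->; case: (ord2P c) => ->; rewrite ?B10; lra.
Qed.

End OneMatrix.

Section Measurable.
Context {dd : measure_display} {T : measurableType dd}.
Variable D : set T.

Lemma measurable_inv (f : T -> R) : (forall x, D x -> 0 < f x) -> measurable_fun D f ->
  measurable_fun D (fun x => (f x)^-1).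
Proof.
move=> f0 mf.
apply: (measurable_comp (F := (`]0, +oo[%classic : set R)) (f := fun x : R => x^-1)) mf.
- exact: measurable_itv.
- by move=> _ [x Dx <-]; rewrite /= in_itv/= andbT f0.
- apply: open_continuous_measurable_fun; first exact: interval_open.
  move=> x; rewrite inE /= in_itv/= andbT => x0.
  by apply: inv_continuous; rewrite gt_eqF.
Qed.

Lemma measurable_sqrt (f : T -> R) : measurable_fun D f ->
  measurable_fun D (fun x => Num.sqrt (f x)).
Proof.
move=> mf; apply: (measurableT_comp (f := @Num.sqrt R)) mf.
by apply: continuous_measurable_fun => x; exact: sqrt_continuous.
Qed.

Lemma measurable_isq (a b d : T -> R) r c : measurable_fun D a -> measurable_fun D b ->
  measurable_fun D d -> (forall x, D x -> 0 < a x * d x - b x ^+ 2) ->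
  (forall x, D x -> 0 < isq_t (a x) (b x) (d x)) ->
  measurable_fun D (fun x => isq (a x) (b x) (d x) r c).
Proof.
move=> ma mb md det0 tp.
have mi : measurable_fun D (fun x => (a x * d x - b x ^+ 2)^-1).
  apply: measurable_inv => //; apply: measurable_funB; first exact: measurable_funM.
  exact: measurable_funX.
have ms : measurable_fun D (fun x => isq_s (a x) (b x) (d x)) by exact: measurable_sqrt.
have mt : measurable_fun D (fun x => (isq_t (a x) (b x) (d x))^-1).
  apply: measurable_inv => //; apply: measurable_sqrt; apply: measurable_funD.
    by apply: measurable_funM => //; exact: measurable_funD.
  by apply: measurable_funM => //; exact: measurable_cst.
have E x : isq (a x) (b x) (d x) r c = if r == c then if r == ord0
   then (d x * (a x * d x - b x ^+ 2)^-1 + isq_s (a x) (b x) (d x)) * (isq_t (a x) (b x) (d x))^-1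
   else (a x * (a x * d x - b x ^+ 2)^-1 + isq_s (a x) (b x) (d x)) * (isq_t (a x) (b x) (d x))^-1
   else - b x * (a x * d x - b x ^+ 2)^-1 * (isq_t (a x) (b x) (d x))^-1 by rewrite mxE.
rewrite (funext E).
case: (r == c); [case: (r == ord0)|]; do 2 ?[apply: measurable_funM => //].
- by apply: measurable_funD => //; exact: measurable_funM.
- by apply: measurable_funD => //; exact: measurable_funM.
- exact: measurable_funN.
Qed.

End Measurable.
End Metric.

(** * Discrete functions and their derivatives *)

Section DiscreteFunctions.
Context {R : realType}.
Local Notation T2R := (measurableTypeR R * measurableTypeR R)%type.
Local Notation I01 := (`]0, 1[%classic : set (measurableTypeR R)).
Variables (Om : set (R * R)) (M : mesh R).
Hypotheses (hreg : forall T : 'I_(nelem M), regular (elt T)) (hconf : conforming Om M).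

Lemma poly_fun_lin q k (a : R) (p p' : R * R -> R) : poly_fun q k p -> poly_fun q k p' ->
  poly_fun q k (fun x => a * p x + p' x).
Proof.
move=> [c hp] [c' hp']; exists (a *: c + c') => x.
rewrite hp hp' mulr_sumr -big_split; apply: eq_bigr => i _ /=.
rewrite mulr_sumr -big_split; apply: eq_bigr => j _ /=.
by rewrite !mxE; ring.
Qed.

Lemma poly_fun0 q k : poly_fun q k (fun=> 0 : R).
Proof. by exists 0 => x; do 2 (rewrite big1// => ? _); rewrite mxE !mul0r. Qed.

(** A piecewise polynomial function agrees on an element with a [C^2] function
    defined in a neighbourhood of the closed element. *)
Lemma poly_local (T : 'I_(nelem M)) k p : poly_fun (is_quad (elt T)) k p ->
  exists W f, [/\ open W, elem_set (elt T) `<=` W, Cn 2 W f &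
    forall x, ref_elem (is_quad (elt T)) x -> f (emap (elt T) x) = p x].
Proof.
move=> hp; have [U [W [psi' hT]]] := hreg T.
exists W, (fun y => p ((psi' y).1, (psi' y).2)); split.
- exact: openW hT.
- exact: elemW hT.
- by have [_ _ _ [c1 c2] _] := hT; exact: (Cn_poly (openW hT) hp c1 c2).
- by move=> x rx; rewrite (chartK hT rx) -surjective_pairing.
Qed.

Lemma Sh_local k v (T : 'I_(nelem M)) : Sh Om M k v ->
  exists W f, [/\ open W, elem_set (elt T) `<=` W, Cn 2 W f &
    forall y, elem_set (elt T) y -> v y = f y].
Proof.
move=> [_ /(_ T)[p hp vp]]; have [W [f [oW TW cf fp]]] := poly_local hp.
by exists W, f; split => // y [x rx <-]; rewrite vp// fp.
Qed.

Lemma Vh_pw l v : Vh M l v -> pw M v.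
Proof.
move=> [v0 hv]; split => // T; have [p hp vp] := hv T.
have [W [f [oW TW cf fp]]] := poly_local hp; exists f.
  by move=> x /TW; exact: (Cn_cont cf).
move=> y iy; have [x rx xy] : elem_set (elt T) y := interior_subset iy.
by rewrite -xy vp ?xy// -xy fp.
Qed.

Lemma Vh_lin l (a : R) u v : Vh M l u -> Vh M l v -> Vh M l (fun x => a * u x + v x).
Proof.
move=> [u0 hu] [v0 hv]; split; first by move=> x hx; rewrite u0// v0// mulr0 addr0.
move=> T; have [p hp up] := hu T; have [p' hp' vp] := hv T.
exists (fun x => a * p x + p' x); first exact: poly_fun_lin.
by move=> x rx ix; rewrite up// vp.
Qed.

Lemma Vh0 l : Vh M l (fun=> 0).
Proof. by split => // T; exists (fun=> 0) => //; exact: poly_fun0. Qed.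

Lemma Sh0 k : Sh Om M k (fun=> 0).
Proof.
split; first by move=> x; exact: cvg_cst.
by move=> T; exists (fun=> 0) => //; exact: poly_fun0.
Qed.

Lemma Sh_lin k (a : R) u v : Sh Om M k u -> Sh Om M k v ->
  Sh Om M k (fun x => a * u x + v x).
Proof.
move=> [cu hu] [cv hv]; split.
  by move=> x; exact: (cvgD (cvgM (cvg_cst a) (cu x)) (cv x)).
move=> T; have [p hp up] := hu T; have [p' hp' vp] := hv T.
exists (fun x => a * p x + p' x); first exact: poly_fun_lin.
by move=> x rx; rewrite up// vp.
Qed.

Lemma gradE v x j : mesh_interior M x -> grad M v x j ord0 = pd j v x.
Proof. by move=> ix; rewrite mxE /patch mem_set. Qed.

Lemma grad0E v x j : ~ mesh_interior M x -> grad M v x j ord0 = 0.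
Proof. by move=> ix; rewrite mxE /patch memNset. Qed.

Lemma hessE v x i j : mesh_interior M x -> hess M v x i j = pd i (pd j v) x.
Proof. by move=> ix; rewrite mxE /patch mem_set. Qed.

Lemma hess0E v x i j : ~ mesh_interior M x -> hess M v x i j = 0.
Proof. by move=> ix; rewrite mxE /patch memNset. Qed.

(** On an open element, the derivatives are those of any local representative. *)
Lemma pd_int v f (T : 'I_(nelem M)) x j :
  (forall y, elem_set (elt T) y -> v y = f y) -> (elem_set (elt T))° x ->
  pd j v x = pd j f x.
Proof.
move=> vf ix; have oi : open ((elem_set (elt T))°) by exact: open_interior.
by apply: (pd_open j oi _ ix) => y iy; apply: vf; exact: interior_subset.
Qed.

Lemma pdpd_int v f (T : 'I_(nelem M)) x i j :
  (forall y, elem_set (elt T) y -> v y = f y) -> (elem_set (elt T))° x ->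
  pd i (pd j v) x = pd i (pd j f) x.
Proof.
move=> vf ix; have oi : open ((elem_set (elt T))°) by exact: open_interior.
by apply: (pd_open i oi _ ix) => y iy; exact: pd_int vf iy.
Qed.

Lemma grad_pw k v j : Sh Om M k v -> pw M (fun x => grad M v x j ord0).
Proof.
move=> hv; split; first by move=> x; exact: grad0E.
move=> T; have [W [f [oW TW cf vf]]] := Sh_local T hv; exists (pd j f).
  by move=> x /TW; exact: (Cn_cont (Cn_pd j cf)).
by move=> x ix; rewrite gradE; [exact: pd_int vf ix|exists T].
Qed.

Lemma hess_pw k v i j : Sh Om M k v -> pw M (fun x => hess M v x i j).
Proof.
move=> hv; split; first by move=> x; exact: hess0E.
move=> T; have [W [f [oW TW cf vf]]] := Sh_local T hv; exists (pd i (pd j f)).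
  by move=> x /TW; exact: (Cn_cont (Cn_pd i (Cn_pd j cf))).
by move=> x ix; rewrite hessE; [exact: pdpd_int vf ix|exists T].
Qed.

(** Linear relations are transported along explicit equations. *)
Lemma lin3 (a x y z x' y' z' : R) : x = x' -> y = y' -> z = z' ->
  x' = a * y' + z' -> x = a * y + z.
Proof. by move=> -> -> ->. Qed.

Lemma zero3 (a x y z : R) : x = 0 -> y = 0 -> z = 0 -> x = a * y + z.
Proof. by move=> -> -> ->; rewrite mulr0 addr0. Qed.

Lemma grad_lin k (a : R) u v x j : Sh Om M k u -> Sh Om M k v ->
  grad M (fun y => a * u y + v y) x j ord0 = a * grad M u x j ord0 + grad M v x j ord0.
Proof.
move=> hu hv; have [ix|nx] := pselect (mesh_interior M x); last first.
  exact: (zero3 a (grad0E _ j nx) (grad0E u j nx) (grad0E v j nx)).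
have [T _ iT] := ix.
have [W [f [oW TW cf uf]]] := Sh_local T hu.
have [W' [g [oW' TW' cg vg]]] := Sh_local T hv.
have eT : elem_set (elt T) x := interior_subset iT.
apply: (lin3 (gradE _ j ix) (etrans (gradE u j ix) (pd_int j uf iT))
  (etrans (gradE v j ix) (pd_int j vg iT))).
rewrite -(pd_lin a (Cn_derivable cf (TW _ eT)) (Cn_derivable cg (TW' _ eT))).
apply: (pd_int (T := T)) iT => y ey.
by rewrite (uf y ey) (vg y ey).
Qed.

Lemma hess_lin k (a : R) u v x i j : Sh Om M k u -> Sh Om M k v ->
  hess M (fun y => a * u y + v y) x i j = a * hess M u x i j + hess M v x i j.
Proof.
move=> hu hv; have [ix|nx] := pselect (mesh_interior M x); last first.
  exact: (zero3 a (hess0E _ i j nx) (hess0E u i j nx) (hess0E v i j nx)).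
have [T _ iT] := ix.
have [W [f [oW TW cf uf]]] := Sh_local T hu.
have [W' [g [oW' TW' cg vg]]] := Sh_local T hv.
have oi : open ((elem_set (elt T))°) by exact: open_interior.
have eT y : (elem_set (elt T))° y -> elem_set (elt T) y := fun h => interior_subset h.
apply: (lin3 (hessE _ i j ix) (etrans (hessE u i j ix) (pdpd_int i j uf iT))
  (etrans (hessE v i j ix) (pdpd_int i j vg iT))).
rewrite -(pd_lin a (Cn_derivable (Cn_pd j cf) (TW _ (eT _ iT)))
                   (Cn_derivable (Cn_pd j cg) (TW' _ (eT _ iT)))).
apply: (pd_open i oi _ iT) => y iy.
rewrite -(pd_lin a (Cn_derivable cf (TW _ (eT _ iy))) (Cn_derivable cg (TW' _ (eT _ iy)))).
apply: (pd_int (T := T)) iy => z ez.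
by rewrite (uf z ez) (vg z ez).
Qed.

(** Derivatives only depend on the values on the closed domain. *)
Lemma grad_congr u v : (forall x, closure Om x -> u x = v x) -> grad M u = grad M v.
Proof.
move=> uv; apply/funext => x; apply/matrixP => j c; rewrite [c]ord1.
have [[T iT ix]|nx] := pselect (mesh_interior M x); last first.
  exact: (etrans (grad0E u j nx) (esym (grad0E v j nx))).
have mx : mesh_interior M x by exists T.
have uvT y : elem_set (elt T) y -> u y = v y := fun ey => uv y (elem_closure hconf ey).
exact: (etrans (gradE u j mx) (etrans (pd_int j uvT ix) (esym (gradE v j mx)))).
Qed.

Lemma hess_congr u v : (forall x, closure Om x -> u x = v x) -> hess M u = hess M v.
Proof.
move=> uv; apply/funext => x; apply/matrixP => i j.
have [[T iT ix]|nx] := pselect (mesh_interior M x); last first.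
  exact: (etrans (hess0E u i j nx) (esym (hess0E v i j nx))).
have mx : mesh_interior M x by exists T.
have uvT y : elem_set (elt T) y -> u y = v y := fun ey => uv y (elem_closure hconf ey).
exact: (etrans (hessE u i j mx) (etrans (pdpd_int i j uvT ix) (esym (hessE v i j mx)))).
Qed.

Lemma jump_grad_bmeas k e v j : e \in interior_edges M -> Sh Om M k v ->
  bmeas I01 (fun t => jump_grad e v t j ord0).
Proof.
move=> he hv.
apply: bmeas_ext (jump_bmeas hreg hconf he (grad_pw j hv)) => t _.
by rewrite [RHS]mxE.
Qed.

Lemma jump_grad_lin k e (a : R) u v t : e \in interior_edges M -> Sh Om M k u ->
  Sh Om M k v -> 0 < t < 1 ->
  jump_grad e (fun y => a * u y + v y) t = a *: jump_grad e u t + jump_grad e v t.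
Proof.
move=> he hu hv ht; apply/matrixP => j c; rewrite [c]ord1.
have JE w : jump_grad e w t j ord0 = jump e (fun x => grad M w x j ord0) t := mxE _ _ _ _.
transitivity (a * jump_grad e u t j ord0 + jump_grad e v t j ord0); last first.
  by rewrite [RHS]mxE [X in _ = X + _]mxE.
apply: (lin3 (JE _) (JE u) (JE v)).
rewrite -(jump_lin hreg hconf he a (grad_pw j hu) (grad_pw j hv) ht).
by congr (jump e _ t); apply/funext => x; exact: (grad_lin a x j hu hv).
Qed.

End DiscreteFunctions.

Opaque grad hess.

(** * The lifting of the jumps *)

Section Frobenius.
Context {R : realType}.

Lemma frobC m n (A B : 'M[R]_(m, n)) : frob A B = frob B A.
Proof. by do 2 (apply: eq_bigr => ? _); rewrite mulrC. Qed.

Lemma frob_linl m n (a : R) (A B C : 'M[R]_(m, n)) :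
  frob (a *: A + B) C = a * frob A C + frob B C.
Proof.
rewrite /frob mulr_sumr -big_split; apply: eq_bigr => i _ /=.
rewrite mulr_sumr -big_split; apply: eq_bigr => j _ /=.
by rewrite !mxE; ring.
Qed.

Lemma frob_linr m n (a : R) (A B C : 'M[R]_(m, n)) :
  frob C (a *: A + B) = a * frob C A + frob C B.
Proof. by rewrite frobC frob_linl !(frobC C). Qed.

Lemma frob_ge0 m n (A : 'M[R]_(m, n)) : 0 <= frob A A.
Proof. by do 2 (apply: sumr_ge0 => ? _); rewrite -expr2 sqr_ge0. Qed.

Lemma frob_eq0 m n (A : 'M[R]_(m, n)) : frob A A = 0 -> A = 0.
Proof.
move=> h; apply/matrixP => i j; rewrite mxE.
have h1 : \sum_j A i j * A i j = 0.
  apply: (psumr_eq0P _ h) => // r _.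
  by apply: sumr_ge0 => ? _; rewrite -expr2 sqr_ge0.
have h2 : A i j * A i j = 0.
  by apply: (psumr_eq0P _ h1) => // r _; rewrite -expr2 sqr_ge0.
by move/eqP: h2; rewrite mulf_eq0 orbb => /eqP.
Qed.

Lemma frob0l m n (A : 'M[R]_(m, n)) : frob 0 A = 0.
Proof. by do 2 (rewrite /frob big1// => ? _); rewrite mxE mul0r. Qed.

End Frobenius.

Section Lifting.
Context {R : realType}.
Local Notation T2R := (measurableTypeR R * measurableTypeR R)%type.
Local Notation I01 := (`]0, 1[%classic : set (measurableTypeR R)).
Variables (Om : set (R * R)) (M : mesh R) (l : nat).
Hypotheses (hreg : forall T : 'I_(nelem M), regular (elt T)) (hconf : conforming Om M).
Variable e : edge M.
Hypothesis he : e \in interior_edges M.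
Local Notation field := (R * R -> 'M[R]_2).
Local Notation E1 := (elt e.1.1).
Local Notation E2 := (elt e.2.1).

Lemma fieldE (a : R) (u v : field) x i j :
  (a *: u + v) x i j = a * u x i j + v x i j.
Proof. by rewrite [LHS]mxE [X in X + _ = _]mxE. Qed.

Lemma Vh22_lin (a : R) (u v : field) : Vh22 M l u -> Vh22 M l v -> Vh22 M l (a *: u + v).
Proof.
move=> hu hv i j.
rewrite (_ : (fun x => _) = (fun x => a * u x i j + v x i j)).
  exact: Vh_lin.
by apply/funext => x; exact: fieldE.
Qed.

Lemma Vh22_0 : Vh22 M l (0 : field).
Proof.
move=> i j; rewrite (_ : (fun x => _) = (fun=> 0)); first exact: Vh0.
by apply/funext => x; rewrite mxE.
Qed.

(** Vector fields on an edge with bounded measurable components. *)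
Definition edge_bounded (phi : R -> 'cV[R]_2) : Prop :=
  forall j, bmeas I01 (fun t => phi t j ord0).

(** The right-hand side of the equation that defines the lifting of [phi]. *)
Definition edge_form (tau : field) (phi : R -> 'cV[R]_2) : R :=
  int_edge e (fun t => frob (avg_mx e tau t *m normal_col e t) (phi t)).

Lemma normal_col_bmeas k c : bmeas I01 (fun t => normal_col e t k c).
Proof.
have [n1 n2] := normal_bmeas hreg e.
by case: (ord2P k) => ->; [apply: bmeas_ext n1|apply: bmeas_ext n2] => t _; rewrite [RHS]mxE.
Qed.

Lemma avg_mx_bmeas tau i j : Vh22 M l tau -> bmeas I01 (fun t => avg_mx e tau t i j).
Proof.
move=> ht; apply: bmeas_ext (avg_bmeas hreg hconf he (Vh_pw hreg (ht i j))) => t _.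
by rewrite [RHS]mxE.
Qed.

Lemma edge_form_bmeas tau phi : Vh22 M l tau -> edge_bounded phi ->
  bmeas I01 (fun t => frob (avg_mx e tau t *m normal_col e t) (phi t)).
Proof.
move=> ht hp; apply: bmeas_frob.
  by apply: bmeas_mulmx => i j; [exact: avg_mx_bmeas|exact: normal_col_bmeas].
by move=> i j; rewrite [j]ord1; exact: hp.
Qed.

Lemma avg_mx_lin (a : R) u v t : Vh22 M l u -> Vh22 M l v -> 0 < t < 1 ->
  avg_mx e (a *: u + v) t = a *: avg_mx e u t + avg_mx e v t.
Proof.
move=> hu hv ht; apply/matrixP => i j.
rewrite [LHS]mxE [RHS]mxE [X in _ = X + _]mxE [avg_mx e u t i j]mxE [avg_mx e v t i j]mxE.
rewrite -(avg_lin hreg hconf he a (Vh_pw hreg (hu i j)) (Vh_pw hreg (hv i j)) ht).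
by congr (avg e _ t); apply/funext => x; exact: fieldE.
Qed.

Lemma edge_form_linl (a : R) u v phi : Vh22 M l u -> Vh22 M l v -> edge_bounded phi ->
  edge_form (a *: u + v) phi = a * edge_form u phi + edge_form v phi.
Proof.
move=> hu hv hp; rewrite /edge_form.
rewrite -(int_edge_lin hreg e a (edge_form_bmeas hu hp) (edge_form_bmeas hv hp)).
apply: int_edge_eq => t ht.
by rewrite (avg_mx_lin a hu hv ht) mulmxDl -scalemxAl frob_linl.
Qed.

Lemma edge_form_linr (a : R) tau phi phi1 phi2 : Vh22 M l tau -> edge_bounded phi1 ->
  edge_bounded phi2 -> (forall t, 0 < t < 1 -> phi t = a *: phi1 t + phi2 t) ->
  edge_form tau phi = a * edge_form tau phi1 + edge_form tau phi2.
Proof.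
move=> ht h1 h2 hp; rewrite /edge_form.
rewrite -(int_edge_lin hreg e a (edge_form_bmeas ht h1) (edge_form_bmeas ht h2)).
by apply: int_edge_eq => t t01; rewrite (hp t t01) frob_linr.
Qed.

(** The [L^2] product of tensor fields over the two elements at the edge. *)
Definition patch_form (r tau : field) : R :=
  \int[mu2]_(x in edge_patch e) frob (r x) (tau x).

Lemma patch_compact : compact (edge_patch e).
Proof. by apply: compactU; exact: elem_compact. Qed.

Lemma patch_measurable : measurable (edge_patch e : set T2R).
Proof.
rewrite -[edge_patch e]setCK; apply: measurableC; apply: open_measurable2.
by rewrite openC; apply: compact_closed (patch_compact); exact: norm_hausdorff.
Qed.

Lemma patch_finite : (mu2 (edge_patch e) < +oo)%E.
Proof.
apply: mu2_bounded; first exact: patch_measurable.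
exact/compact_bounded/patch_compact.
Qed.

Lemma patch_bmeas r tau : Vh22 M l r -> Vh22 M l tau ->
  bmeas (edge_patch e : set T2R) (fun x => frob (r x) (tau x)).
Proof.
move=> hr ht; apply: bmeas_frob => i j.
  exact: (pw_bmeas hreg (Vh_pw hreg (hr i j)) patch_measurable).
exact: (pw_bmeas hreg (Vh_pw hreg (ht i j)) patch_measurable).
Qed.

Lemma patch_form_linl (a : R) u v w : Vh22 M l u -> Vh22 M l v -> Vh22 M l w ->
  patch_form (a *: u + v) w = a * patch_form u w + patch_form v w.
Proof.
move=> hu hv hw.
rewrite /patch_form -(Rint_lin patch_measurable patch_finite a (patch_bmeas hu hw) (patch_bmeas hv hw)).
by apply: Rint_eq => x _; exact: frob_linl.
Qed.

Lemma patch_formC r tau : patch_form r tau = patch_form tau r.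
Proof. by apply: Rint_eq => x _; exact: frobC. Qed.

(** The discrete tensor fields that vanish off the two elements at the edge. *)
Definition patch_space (r : field) : Prop :=
  Vh22 M l r /\ forall x, ~ edge_patch e x -> r x = 0.

Lemma patch_interior (T : 'I_(nelem M)) x : (elem_set (elt T))° x ->
  T != e.1.1 -> T != e.2.1 -> ~ edge_patch e x.
Proof.
by move=> iT n1 n2 [|]; [exact: (interior_disjoint hreg hconf n1 iT)|
  exact: (interior_disjoint hreg hconf n2 iT)].
Qed.

(** The [L^2] product over the patch is definite on the discrete fields
    supported there. *)
Lemma patch_form_def r : patch_space r -> patch_form r r = 0 -> r = 0.
Proof.
move=> [hr r0] hI; apply/funext => x.
have [px|] := pselect (edge_patch e x); last exact: r0.
have [ix|nx] := pselect (mesh_interior M x); last first.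
  by apply/matrixP => i j; rewrite (hr i j).1// mxE.
have pint : (edge_patch e)° x.
  have [T _ iT] := ix.
  have [Ee|n1] := eqVneq T e.1.1.
    by rewrite Ee in iT; apply: interiorS iT; exact: subsetUl.
  have [Ee|n2] := eqVneq T e.2.1.
    by rewrite Ee in iT; apply: interiorS iT; exact: subsetUr.
  by case: (patch_interior iT n1 n2).
apply: frob_eq0.
apply: (@Rint_eq0_pt R (edge_patch e) (fun y => frob (r y) (r y)) x
  patch_measurable patch_finite (patch_bmeas hr hr) _ hI pint).
  by move=> y _; exact: frob_ge0.
have c i j : {for x, continuous (fun y => r y i j)} := pw_cont (Vh_pw hreg (hr i j)) ix.
have E : (fun y => frob (r y) (r y)) = (fun y =>
    (r y ord0 ord0 * r y ord0 ord0 + r y ord0 ord_max * r y ord0 ord_max) +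
    (r y ord_max ord0 * r y ord_max ord0 + r y ord_max ord_max * r y ord_max ord_max)).
  by apply/funext => y; rewrite /frob !sum2.
rewrite E.
exact: (cvgD (cvgD (cvgM (c _ _) (c _ _)) (cvgM (c _ _) (c _ _)))
             (cvgD (cvgM (c _ _) (c _ _)) (cvgM (c _ _) (c _ _)))).
Qed.

(** Truncation of a discrete tensor field to the patch of [e]. *)
Definition to_patch (tau : field) : field :=
  fun x => if `[< edge_patch e x >] then tau x else 0.

Lemma to_patchE tau x : edge_patch e x -> to_patch tau x = tau x.
Proof. by move=> h; rewrite /to_patch asboolT. Qed.

Lemma to_patch_space tau : Vh22 M l tau -> patch_space (to_patch tau).
Proof.
move=> ht; split; last by move=> x h; rewrite /to_patch asboolF.
move=> i j; split.
  move=> x nx; rewrite /to_patch; case: asboolP => _; last by rewrite mxE.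
  exact: (ht i j).1.
move=> T; have [p hp tp] := (ht i j).2 T.
have inP : (T == e.1.1) || (T == e.2.1) -> exists2 p, poly_fun (is_quad (elt T)) l p &
    forall x, ref_elem (is_quad (elt T)) x ->
      (elem_set (elt T))° (emap (elt T) x) -> to_patch tau (emap (elt T) x) i j = p x.
  move=> hT; exists p => // x rx ix; rewrite to_patchE; first exact: tp.
  have ex : elem_set (elt T) (emap (elt T) x) := interior_subset ix.
  by case/orP: hT => /eqP Ee; rewrite Ee in ex *; [left|right].
have [|n1] := eqVneq T e.1.1; first by move=> Ee; apply: inP; rewrite Ee eqxx.
have [|n2] := eqVneq T e.2.1; first by move=> Ee; apply: inP; rewrite Ee eqxx orbT.
exists (fun=> 0); first exact: poly_fun0.
move=> x rx ix; rewrite /to_patch asboolF ?mxE//.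
exact: patch_interior ix n1 n2.
Qed.

Lemma patch_form_trunc r tau : patch_form r (to_patch tau) = patch_form r tau.
Proof. by apply: Rint_eq => x px; rewrite to_patchE. Qed.

Lemma edge_form_trunc tau phi : edge_form (to_patch tau) phi = edge_form tau phi.
Proof.
apply: int_edge_eq => t ht; congr (frob (_ *m _) _); apply/matrixP => i j.
rewrite [LHS]mxE [RHS]mxE; apply: (avg_eq hreg hconf he _ ht) => x hx.
rewrite to_patchE//; case: hx => ix; [left|right]; exact: interior_subset ix.
Qed.

(** Riesz representation on the discrete tensor fields of the patch. *)
Lemma lifting_exists phi : edge_bounded phi -> exists2 r, patch_space r &
  forall tau, Vh22 M l tau -> patch_form r tau = edge_form tau phi.
Proof.
move=> hphi.
pose I := ('I_(nelem M) * ('I_2 * 'I_2) * ('I_l.+1 * 'I_l.+1))%type.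
pose rep (c : I -> R) (r : field) := forall T i j x, ref_elem (is_quad (elt T)) x ->
  (elem_set (elt T))° (emap (elt T) x) -> r (emap (elt T) x) i j =
   \sum_(a < l.+1) \sum_(b < l.+1 | is_quad (elt T) || (a + b <= l)%N)
      c (T, (i, j), (a, b)) * x.1 ^+ a * x.2 ^+ b.
have P0 : patch_space 0 by split => //; exact: Vh22_0.
have Pl (a : R) (u v : field) : patch_space u -> patch_space v -> patch_space (a *: u + v).
  move=> [hu u0] [hv v0]; split; first exact: Vh22_lin.
  move=> x nx; apply/matrixP => i j.
  by apply: (etrans (fieldE a u v x i j)); rewrite u0// v0// mxE mulr0 addr0.
have null (r : field) : patch_space r -> rep (fun=> 0) r -> r = 0.
  move=> [hr r0] hrep; apply/funext => x; apply/matrixP => i j.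
  have [[T _ iT]|nx] := pselect (mesh_interior M x); last by rewrite (hr i j).1// mxE.
  have [y ry yx] : elem_set (elt T) x := interior_subset iT.
  rewrite -yx in iT *; rewrite (hrep T i j y ry iT) [RHS]mxE.
  by do 2 (rewrite big1// => ? _); rewrite !mul0r.
have ef0 : edge_form 0 phi = 0.
  have := edge_form_linl (-1) Vh22_0 Vh22_0 hphi.
  by rewrite scaler0 addr0 mulN1r addNr.
have [|||||||||r Pr hr] := @galerkin R field I patch_space rep patch_form
  (fun tau => edge_form tau phi).
- exact: P0.
- exact: Pl.
- move=> r [hr _].
  have H (q : 'I_(nelem M) * ('I_2 * 'I_2)) : exists c : 'M[R]_l.+1, forall x,
      ref_elem (is_quad (elt q.1)) x -> (elem_set (elt q.1))° (emap (elt q.1) x) ->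
      r (emap (elt q.1) x) q.2.1 q.2.2 =
      \sum_(a < l.+1) \sum_(b < l.+1 | is_quad (elt q.1) || (a + b <= l)%N)
        c a b * x.1 ^+ a * x.2 ^+ b.
    have [p [c hc] hp] := (hr q.2.1 q.2.2).2 q.1; exists c => x rx ix.
    by rewrite hp// hc.
  have [C hC] := choice H.
  exists (fun z : I => C z.1 z.2.1 z.2.2) => T i j x rx ix.
  exact: (hC (T, (i, j)) x rx ix).
- move=> a c d u v hu hv T i j x rx ix.
  rewrite fieldE (hu T i j x rx ix) (hv T i j x rx ix).
  rewrite mulr_sumr -big_split; apply: eq_bigr => a' _ /=.
  rewrite mulr_sumr -big_split; apply: eq_bigr => b' _ /=.
  ring.
- by move=> a u v w [hu _] [hv _] [hw _]; exact: patch_form_linl.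
- move=> a u v w [hu _] [hv _] [hw _].
  by rewrite (patch_formC w (a *: u + v)) (patch_formC w u) (patch_formC w v) patch_form_linl.
- by move=> a u v [hu _] [hv _]; exact: edge_form_linl.
- by move=> u Pu /(patch_form_def Pu) ->.
- move=> u Pu hu; rewrite (null u Pu hu); split => // v _.
  rewrite patch_formC /patch_form; under eq_Rintegral do rewrite frob0l.
  by rewrite Rintegral_cst ?mul0r//; exact: patch_measurable.
exists r => // tau htau.
by rewrite -patch_form_trunc -edge_form_trunc; apply: hr; exact: to_patch_space.
Qed.

Lemma lifting_unique r r' phi : patch_space r -> patch_space r' ->
  (forall tau, Vh22 M l tau -> patch_form r tau = edge_form tau phi) ->
  (forall tau, Vh22 M l tau -> patch_form r' tau = edge_form tau phi) -> r = r'.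
Proof.
move=> [hr r0] [hr' r0'] E E'.
have hd : Vh22 M l ((-1 : R) *: r' + r) by exact: Vh22_lin.
have D : patch_space ((-1 : R) *: r' + r).
  split => // x nx; apply/matrixP => i j.
  by apply: (etrans (fieldE (-1) r' r x i j)); rewrite r0// r0'// mxE mulr0 addr0.
have := patch_form_def D.
rewrite patch_form_linl// E// E'// mulN1r addNr => /(_ erefl).
by rewrite scaleN1r addrC => /eqP; rewrite subr_eq0 => /eqP.
Qed.

Lemma lifting_spec phi : edge_bounded phi ->
  patch_space (lifting l e phi) /\
  forall tau, Vh22 M l tau -> patch_form (lifting l e phi) tau = edge_form tau phi.
Proof.
move=> hphi; have [r [hr r0] Er] := lifting_exists hphi.
rewrite /lifting; case: xgetP => [r' _ [hr' r0' Er']|/(_ r) h]; first by split.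
by exfalso; apply: h; split.
Qed.

(** Linearity of the lifting, inherited from its defining equation by uniqueness. *)
Lemma lifting_lin (a : R) phi phi1 phi2 : edge_bounded phi -> edge_bounded phi1 ->
  edge_bounded phi2 -> (forall t, 0 < t < 1 -> phi t = a *: phi1 t + phi2 t) ->
  forall x, lifting l e phi x = a *: lifting l e phi1 x + lifting l e phi2 x.
Proof.
move=> h h1 h2 E x.
have [P0 F0] := lifting_spec h; have [P1 F1] := lifting_spec h1; have [P2 F2] := lifting_spec h2.
suff -> : lifting l e phi = a *: lifting l e phi1 + lifting l e phi2 by [].
apply: (lifting_unique (phi := phi) P0) => //.
  case: P1 P2 => hr r0 [hr' r0']; split; first exact: Vh22_lin.
  move=> y ny; apply/matrixP => i j.
  by apply: (etrans (fieldE a _ _ y i j)); rewrite r0// r0'// mxE mulr0 addr0.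
move=> tau htau; rewrite (edge_form_linr htau h1 h2 E).
rewrite patch_form_linl ?F1 ?F2//; [exact: P1.1|exact: P2.1].
Qed.

Lemma lifting_pw phi i j : edge_bounded phi -> pw M (fun x => lifting l e phi x i j).
Proof. by move=> h; have [[hr _] _] := lifting_spec h; exact: (Vh_pw hreg (hr i j)). Qed.

End Lifting.

(** * The forms on scalar discrete functions *)

Section Forms.
Context {R : realType}.
Local Notation T2R := (measurableTypeR R * measurableTypeR R)%type.
Local Notation I01 := (`]0, 1[%classic : set (measurableTypeR R)).
Variables (Om Sig : set (R * R)) (M : mesh R) (g : R * R -> 'M[R]_2) (k l : nat).
Hypotheses (oOm : open Om) (bOm : bounded_set Om).
Hypotheses (hreg : forall T : 'I_(nelem M), regular (elt T)) (hconf : conforming Om M).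
Hypothesis hg : metric_field Om g.
Implicit Types (u v w : R * R -> R) (y z : 'I_3 -> R * R -> R).

Lemma Om_measurable : measurable (Om : set T2R). Proof. exact: open_measurable2. Qed.

Lemma Om_finite : (mu2 Om < +oo)%E. Proof. exact: mu2_bounded Om_measurable bOm. Qed.

Lemma closure_compact : compact (closure Om).
Proof.
apply: closed_bounded_compact2; last exact: closed_closure.
have [r r0 hr] := bounded_subset_box bOm.
have cb : closed ([set` `[- r, r]] `*` [set` `[- r, r]]).
  apply: compact_closed; first exact: norm_hausdorff.
  by apply: compact_setX; exact: segment_compact.
exists r; split; first by rewrite num_real.
move=> s rs x /(closure_subset hr); rewrite -(closure_id _).1// => -[] /=.
by rewrite !in_itv/= => h1 h2; rewrite prod_normE ge_max !ler_norml; lra.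
Qed.

Lemma Sh_cont v x : Sh Om M k v -> Om x -> {for x, continuous v}.
Proof.
move=> [cv _] Ox; have := continuous_subspaceW (@subset_closure _ Om) cv.
by rewrite continuous_open_subspace//; apply; rewrite inE.
Qed.

Lemma Sh_bmeas v : Sh Om M k v -> bmeas (Om : set T2R) v.
Proof.
move=> hv; split; first by apply: continuous_measurable2 => // x; exact: Sh_cont.
have : compact (v @` closure Om) by apply: continuous_compact closure_compact; exact: hv.1.
move=> /compact_bounded[B [_ hB]]; exists (`|B| + 1) => x Ox.
apply: (hB (`|B| + 1)); first by rewrite (le_lt_trans (ler_norm B))// ltrDl.
by exists x => //; exact: subset_closure.
Qed.

Lemma free_interior e : e \in free_edges M Sig -> e \in interior_edges M.
Proof. by rewrite inE => /andP[]. Qed.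

Lemma jump_edge_bounded e v : e \in interior_edges M -> Sh Om M k v ->
  edge_bounded (jump_grad e v).
Proof. by move=> he hv j; exact: (jump_grad_bmeas hreg hconf j he hv). Qed.

Lemma hess_mx_lin (a : R) u v x : Sh Om M k u -> Sh Om M k v ->
  hess M (fun p => a * u p + v p) x = a *: hess M u x + hess M v x.
Proof.
move=> hu hv; apply/matrixP => i j; apply: (etrans (hess_lin hreg a x i j hu hv)).
by rewrite [RHS]mxE [X in _ = X + _]mxE.
Qed.

Lemma dhess_lin (a : R) u v x : Sh Om M k u -> Sh Om M k v ->
  dhess Sig M l (fun p => a * u p + v p) x =
  a *: dhess Sig M l u x + dhess Sig M l v x.
Proof.
move=> hu hv; have huv := Sh_lin a hu hv.
have L e : e \in free_edges M Sig ->
    lifting l e (jump_grad e (fun p => a * u p + v p)) x =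
    a *: lifting l e (jump_grad e u) x + lifting l e (jump_grad e v) x.
  move=> /free_interior he.
  exact: (lifting_lin l hreg hconf he (jump_edge_bounded he huv)
    (jump_edge_bounded he hu) (jump_edge_bounded he hv)
    (fun t ht => jump_grad_lin hreg hconf a he hu hv ht)).
have E2 : \sum_(e in free_edges M Sig) lifting l e (jump_grad e (fun p => a * u p + v p)) x =
  \sum_(e in free_edges M Sig) (a *: lifting l e (jump_grad e u) x
    + lifting l e (jump_grad e v) x) := eq_bigr _ L.
transitivity ((a *: hess M u x + hess M v x) - \sum_(e in free_edges M Sig)
    (a *: lifting l e (jump_grad e u) x + lifting l e (jump_grad e v) x)).
  exact: (congr2 (fun A B : 'M[R]_2 => A - B) (hess_mx_lin a x hu hv) E2).
rewrite /dhess.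
by rewrite big_split -scaler_sumr /= opprD addrACA -scalerBr.
Qed.

Lemma dhess_pw v i j : Sh Om M k v -> pw M (fun x => dhess Sig M l v x i j).
Proof.
move=> hv.
have hL : pw M (fun x => \sum_(e in free_edges M Sig) lifting l e (jump_grad e v) x i j).
  apply: pw_sum => e /free_interior he.
  exact: (lifting_pw l hreg hconf he i j (jump_edge_bounded he hv)).
have := pw_lin (-1) hL (hess_pw hreg i j hv).
rewrite (_ : (fun x => -1 * _ + _) = (fun x => dhess Sig M l v x i j))//.
apply/funext => x; rewrite /dhess [RHS]mxE [X in _ = _ + X]mxE summxE.
by rewrite mulN1r addrC.
Qed.

Lemma pw_bmeasOm w : pw M w -> bmeas (Om : set T2R) w.
Proof. by move=> hw; exact: (pw_bmeas hreg hw Om_measurable). Qed.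

Lemma metric_symE x : Om x -> (g x)^T = g x.
Proof. by case: hg => _ h _; exact: h. Qed.

(** Measurability is part of essential boundedness. *)
Lemma g_measurable i j : measurable_fun (Om : set T2R) (fun x => g x i j).
Proof.
case: hg => /(_ i j)[hL _] _ _; apply/(measurable_restrictT _ Om_measurable).
move: hL; rewrite /Linfty inE => /andP[+ _].
by rewrite inE.
Qed.

Lemma invsqrt_bmeas i j : bmeas (Om : set T2R) (fun x => invsqrtmx (g x) i j).
Proof.
have [_ _ [c0 c0p hc]] := hg; split.
  apply: (eq_measurable_fun (fun x => isq (g x ord0 ord0) (g x ord0 ord_max) (g x ord_max ord_max) i j)).
    move=> x; rewrite inE => Ox.
    by rewrite (invsqrtmxE c0p (metric_symE Ox) (hc x Ox)).
  apply: measurable_isq; try exact: g_measurable.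
    by move=> x Ox; exact: (det_gt0 c0p (metric_symE Ox) (hc x Ox)).
  move=> x Ox; rewrite sqrtr_gt0.
  exact: (isq_t_arg_gt0 c0p (metric_symE Ox) (hc x Ox)).
exists (1 + c0^-1) => x Ox.
exact: (invsqrtmx_bound c0p (metric_symE Ox) (hc x Ox)).
Qed.

Lemma gconj_bmeas (A : R * R -> 'M[R]_2) :
  (forall i j, bmeas (Om : set T2R) (fun x => A x i j)) ->
  forall i j, bmeas (Om : set T2R) (fun x => gconj g A x i j).
Proof.
move=> hA; apply: bmeas_mulmx; last exact: invsqrt_bmeas.
by apply: bmeas_mulmx => //; exact: invsqrt_bmeas.
Qed.

Lemma gconj_lin (a : R) (A A1 A2 : R * R -> 'M[R]_2) x : A x = a *: A1 x + A2 x ->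
  gconj g A x = a *: gconj g A1 x + gconj g A2 x.
Proof. by move=> E; rewrite /gconj E mulmxDr mulmxDl -scalemxAr -scalemxAl. Qed.

Lemma Hg_lin (a : R) u v x : Sh Om M k u -> Sh Om M k v ->
  Hg Sig M g l (fun p => a * u p + v p) x =
  a *: Hg Sig M g l u x + Hg Sig M g l v x.
Proof. by move=> hu hv; apply: gconj_lin; exact: dhess_lin. Qed.

Lemma Hg_bmeas v i j : Sh Om M k v -> bmeas (Om : set T2R) (fun x => Hg Sig M g l v x i j).
Proof. by move=> hv; apply: gconj_bmeas => r c; exact/pw_bmeasOm/dhess_pw. Qed.

Lemma jac_lin (a : R) y z x : Sh3 Om M k y -> Sh3 Om M k z ->
  jac M (fun m x => a * y m x + z m x) x = a *: jac M y x + jac M z x.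
Proof.
move=> hy hz; apply/matrixP => i j; rewrite [RHS]mxE [X in _ = X + _]mxE.
have JE (q : 'I_3 -> R * R -> R) : jac M q x i j = grad M (q i) x j ord0 := mxE _ _ _ _.
apply: (lin3 (JE _) (JE y) (JE z)).
exact: (grad_lin hreg a x j (hy i) (hz i)).
Qed.

Lemma jac_bmeas y i j : Sh3 Om M k y -> bmeas (Om : set T2R) (fun x => jac M y x i j).
Proof.
move=> hy; apply: bmeas_ext (pw_bmeasOm (grad_pw hreg j (hy i))) => x _.
by rewrite [RHS]mxE.
Qed.

Lemma jacT_bmeas y i j : Sh3 Om M k y -> bmeas (Om : set T2R) (fun x => (jac M y x)^T i j).
Proof.
by move=> hy; apply: bmeas_ext (jac_bmeas j i hy) => x _; rewrite [RHS]mxE.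
Qed.

(** The term with [g] contributes the identity, so [g] itself need not be bounded. *)
Lemma strain_bmeas y i j : Sh3 Om M k y -> bmeas (Om : set T2R) (fun x => strain M g y x i j).
Proof.
move=> hy; have [_ _ [c0 c0p hc]] := hg.
have h1 : bmeas (Om : set T2R) (fun x => gconj g (fun x => (jac M y x)^T *m jac M y x) x i j).
  apply: gconj_bmeas; apply: bmeas_mulmx => r c; [exact: jacT_bmeas|exact: jac_bmeas].
apply: bmeas_ext (bmeasD h1 (bmeas_cst _ (- ((1%:M : 'M[R]_2) i j)))) => x Ox.
have E : strain M g y x = gconj g (fun x => (jac M y x)^T *m jac M y x) x - 1%:M.
  rewrite -(invsqrtmx_conj c0p (metric_symE Ox) (hc x Ox)) /strain /gconj.
  by rewrite mulmxBr mulmxBl.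
by rewrite E [RHS]mxE [X in _ = _ + X]mxE.
Qed.

Lemma dstrain_bmeas y z i j : Sh3 Om M k y -> Sh3 Om M k z ->
  bmeas (Om : set T2R) (fun x => dstrain M g y z x i j).
Proof.
move=> hy hz; apply: gconj_bmeas => r c.
have b1 : bmeas (Om : set T2R) (fun x => ((jac M z x)^T *m jac M y x) r c).
  by apply: bmeas_mulmx => ? ?; [exact: jacT_bmeas|exact: jac_bmeas].
have b2 : bmeas (Om : set T2R) (fun x => ((jac M y x)^T *m jac M z x) r c).
  by apply: bmeas_mulmx => ? ?; [exact: jacT_bmeas|exact: jac_bmeas].
by apply: bmeas_ext (bmeasD b1 b2) => x _; rewrite [RHS]mxE.
Qed.

Lemma symprod_lin (a : R) (A B C : 'M[R]_(3, 2)) :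
  (a *: B + C)^T *m A + A^T *m (a *: B + C) =
  a *: (B^T *m A + A^T *m B) + (C^T *m A + A^T *m C).
Proof.
by rewrite linearP /= mulmxDl mulmxDr -scalemxAl -scalemxAr scalerDr addrACA.
Qed.

Lemma dstrain_lin (a : R) y z z' x : Sh3 Om M k z -> Sh3 Om M k z' ->
  dstrain M g y (fun m x => a * z m x + z' m x) x =
  a *: dstrain M g y z x + dstrain M g y z' x.
Proof.
move=> hz hz'; apply: gconj_lin.
rewrite (jac_lin a x hz hz'); exact: symprod_lin.
Qed.

Lemma mxtrace_lin n (a : R) (A B : 'M[R]_n) : \tr (a *: A + B) = a * \tr A + \tr B.
Proof. by rewrite mxtraceD mxtraceZ. Qed.

(** Linearity of an integral over the domain whose integrand is pointwise
    linear. *)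
Lemma RintOm_lin (a : R) (f f1 f2 : R * R -> R) : bmeas (Om : set T2R) f1 ->
  bmeas (Om : set T2R) f2 -> (forall x, f x = a * f1 x + f2 x) ->
  \int[mu2]_(x in Om) f x = a * \int[mu2]_(x in Om) f1 x + \int[mu2]_(x in Om) f2 x.
Proof.
move=> h1 h2 E; rewrite -(Rint_lin Om_measurable Om_finite a h1 h2).
by apply: Rint_eq => x _; exact: E.
Qed.

Lemma scale_lin (c a x y z : R) : x = a * y + z -> c * x = a * (c * y) + c * z.
Proof. by move=> ->; rewrite mulrDr mulrCA. Qed.

Lemma jump_form_lin (a : R) u v w : Sh Om M k u -> Sh Om M k v -> Sh Om M k w ->
  jump_form Sig M (fun p => a * u p + v p) w =
  a * jump_form Sig M u w + jump_form Sig M v w.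
Proof.
move=> hu hv hw; rewrite /jump_form mulr_sumr -big_split; apply: eq_bigr => e he0 /=.
have he := free_interior he0.
have b f : Sh Om M k f -> bmeas I01 (fun t => frob (jump_grad e f t) (jump_grad e w t)).
  by move=> hf; apply: bmeas_frob => i j; rewrite [j]ord1; exact: jump_edge_bounded.
have E : int_edge e (fun t => frob (jump_grad e (fun p => a * u p + v p) t) (jump_grad e w t)) =
  a * int_edge e (fun t => frob (jump_grad e u t) (jump_grad e w t)) +
  int_edge e (fun t => frob (jump_grad e v t) (jump_grad e w t)).
  rewrite -(int_edge_lin hreg e a (b u hu) (b v hv)); apply: int_edge_eq => t ht.
  by rewrite (jump_grad_lin hreg hconf a he hu hv ht) frob_linl.
exact: (scale_lin _ E).
Qed.

Lemma jump_formC u v : jump_form Sig M u v = jump_form Sig M v u.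
Proof.
have E (e : edge M) : int_edge e (fun t => frob (jump_grad e u t) (jump_grad e v t)) =
    int_edge e (fun t => frob (jump_grad e v t) (jump_grad e u t)).
  by apply: int_edge_eq => t _; exact: frobC.
by rewrite /jump_form; apply: eq_bigr => e _; exact: (congr1 (fun r => (he e)^-1 * r) (E e)).
Qed.

Lemma add3_lin (a x1 y1 z1 x2 y2 z2 x3 y3 z3 : R) : x1 = a * y1 + z1 ->
  x2 = a * y2 + z2 -> x3 = a * y3 + z3 ->
  x1 + x2 + x3 = a * (y1 + y2 + y3) + (z1 + z2 + z3).
Proof. by move=> -> -> ->; ring. Qed.

(** Also when the set is empty or unbounded: the supremum is then 0 by convention. *)
Lemma diam_ge0 (A : set (R * R)) : 0 <= diam A.
Proof.
rewrite /diam; set S := [set r | _].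
have [[r Sr]|S0] := pselect (S !=set0); last first.
  by have -> : S = set0; [apply/seteqP; split => // r Sr; apply: S0; exists r|rewrite sup0].
have r0 : 0 <= r by case: Sr => x [y [_ _ ->]]; exact: sqrtr_ge0.
have [ub|nub] := pselect (has_ubound S).
  by apply: (le_trans r0); exact: ub_le_sup.
by rewrite sup_out// => -[].
Qed.

Lemma jump_form_ge0 u : 0 <= jump_form Sig M u u.
Proof.
apply: sumr_ge0 => e _; apply: mulr_ge0; last first.
  by apply: int_edge_ge0 => t _; exact: frob_ge0.
by rewrite invr_ge0; exact: diam_ge0.
Qed.

Lemma jump_grad_congr (e : edge M) u v : (forall x, closure Om x -> u x = v x) ->
  jump_grad e u = jump_grad e v.
Proof. by move=> uv; rewrite /jump_grad (grad_congr hconf uv). Qed.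

Lemma H2_form_lin (a : R) u v w : Sh Om M k u -> Sh Om M k v -> Sh Om M k w ->
  H2_form Om Sig M (fun p => a * u p + v p) w =
  a * H2_form Om Sig M u w + H2_form Om Sig M v w.
Proof.
move=> hu hv hw.
have hb f : Sh Om M k f -> bmeas (Om : set T2R) (fun x => frob (hess M f x) (hess M w x)).
  move=> hf; apply: bmeas_frob => i j.
    exact: (pw_bmeasOm (hess_pw hreg i j hf)).
  exact: (pw_bmeasOm (hess_pw hreg i j hw)).
have bb f : Sh Om M k f -> bmeas (Om : set T2R) (fun x => f x * w x).
  by move=> hf; apply: bmeasM; exact: Sh_bmeas.
have e1 : \int[mu2]_(x in Om) frob (hess M (fun p => a * u p + v p) x) (hess M w x) =
    a * \int[mu2]_(x in Om) frob (hess M u x) (hess M w x) +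
    \int[mu2]_(x in Om) frob (hess M v x) (hess M w x).
  apply: (RintOm_lin (hb u hu) (hb v hv)) => x.
  by rewrite (hess_mx_lin a x hu hv) frob_linl.
have e2 := jump_form_lin a hu hv hw.
have e3 : \int[mu2]_(x in Om) ((a * u x + v x) * w x) =
    a * \int[mu2]_(x in Om) (u x * w x) + \int[mu2]_(x in Om) (v x * w x).
  by apply: (RintOm_lin (bb u hu) (bb v hv)) => x; rewrite mulrDl mulrA.
exact: (add3_lin e1 e2 e3).
Qed.

Lemma H2_formC u v : H2_form Om Sig M u v = H2_form Om Sig M v u.
Proof.
have e1 : \int[mu2]_(x in Om) frob (hess M u x) (hess M v x) =
    \int[mu2]_(x in Om) frob (hess M v x) (hess M u x).
  by apply: Rint_eq => x _; exact: frobC.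
have e3 : \int[mu2]_(x in Om) (u x * v x) = \int[mu2]_(x in Om) (v x * u x).
  by apply: Rint_eq => x _; exact: mulrC.
exact: (congr2 +%R (congr2 +%R e1 (jump_formC u v)) e3).
Qed.

Lemma H2_form_ge u : \int[mu2]_(x in Om) (u x * u x) <= H2_form Om Sig M u u.
Proof.
rewrite /H2_form lerDr; apply: addr_ge0; last exact: jump_form_ge0.
by apply: Rintegral_ge0 => x _; exact: frob_ge0.
Qed.

Lemma L2_ge0 u : 0 <= \int[mu2]_(x in Om) (u x * u x).
Proof. by apply: Rintegral_ge0 => x _; rewrite -expr2 sqr_ge0. Qed.

Lemma H2_form_ge0 u : 0 <= H2_form Om Sig M u u.
Proof. exact: le_trans (L2_ge0 u) (H2_form_ge u). Qed.

Lemma H2_form_congr u u' v v' : (forall x, closure Om x -> u x = u' x) ->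
  (forall x, closure Om x -> v x = v' x) ->
  H2_form Om Sig M u v = H2_form Om Sig M u' v'.
Proof.
move=> uu vv.
have e1 : \int[mu2]_(x in Om) frob (hess M u x) (hess M v x) =
    \int[mu2]_(x in Om) frob (hess M u' x) (hess M v' x).
  by rewrite (hess_congr hconf uu) (hess_congr hconf vv).
have e2 : jump_form Sig M u v = jump_form Sig M u' v'.
  rewrite /jump_form; apply: eq_bigr => e _.
  by rewrite (jump_grad_congr e uu) (jump_grad_congr e vv).
have e3 : \int[mu2]_(x in Om) (u x * v x) = \int[mu2]_(x in Om) (u' x * v' x).
  apply: Rint_eq => x /(@subset_closure _ Om) hx.
  exact: (congr2 *%R (uu x hx) (vv x hx)).
exact: (congr2 +%R (congr2 +%R e1 e2) e3).
Qed.

(** A discrete function with vanishing [L^2] norm vanishes on the closed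
    domain. *)
Lemma Sh_L2_eq0 v : Sh Om M k v -> \int[mu2]_(x in Om) (v x * v x) = 0 ->
  forall x, closure Om x -> v x = 0.
Proof.
move=> hv hI.
have v0 x : Om x -> v x = 0.
  move=> Ox; have cv := Sh_cont hv Ox.
  have : v x * v x = 0.
    have bv := Sh_bmeas hv.
    have ge p : Om p -> 0 <= v p * v p by move=> _; rewrite -expr2 sqr_ge0.
    have ix : Om° x by rewrite ((interior_id Om).1 oOm).
    exact: (Rint_eq0_pt (f := fun p => v p * v p) Om_measurable Om_finite (bmeasM bv bv) ge hI ix (cvgM cv cv)).
  by move/eqP; rewrite mulf_eq0 orbb => /eqP.
have c0 : closed (v @^-1` [set 0] : set (subspace (closure Om))).
  have /continuous_closedP := hv.1; apply.
  exact: (accessible_closed_set1 (hausdorff_accessible (@norm_hausdorff _ _))).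
move: c0 => /closed_subspaceP[V cV EV] x cx.
have VO : Om `<=` V.
  move=> z Oz; have : (v @^-1` [set 0] `&` closure Om) z.
    by split; [exact: v0|exact: subset_closure].
  by rewrite -EV => -[].
have : (V `&` closure Om) x by split => //; rewrite [V](closure_id V).1//; exact: closureS VO x cx.
by rewrite EV => -[].
Qed.

End Forms.

(** * Existence and uniqueness of one step *)

Section Scheme.
Context {R : realType}.
Local Notation T2R := (measurableTypeR R * measurableTypeR R)%type.
Local Notation tfield := ('I_3 -> R * R -> R).
Variables (Om Sig : set (R * R)) (M : mesh R) (g : R * R -> 'M[R]_2) (k l : nat).
Hypotheses (oOm : open Om) (bOm : bounded_set Om).
Hypotheses (hreg : forall T : 'I_(nelem M), regular (elt T)) (hconf : conforming Om M).
Hypothesis hg : metric_field Om g.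
Variables (mu lambda gamma theta tau : R).
Hypotheses (hmu : 0 < mu) (hlambda : 0 <= lambda) (hgamma : 0 < gamma).
Hypotheses (htau : 0 < tau).

(** The combination [a u + v] of deformations. *)
Definition tlin (a : R) (u v : tfield) : tfield := fun m x => a * u m x + v m x.

Lemma congr3 (S : Type) (f : R -> R -> R -> S) r r' s s' t t' :
  r = r' -> s = s' -> t = t' -> f r s t = f r' s' t'.
Proof. by move=> -> -> ->. Qed.

Lemma Sh3_lin a u v : Sh3 Om M k u -> Sh3 Om M k v -> Sh3 Om M k (tlin a u v).
Proof. by move=> hu hv m; exact: (Sh_lin a (hu m) (hv m)). Qed.

Lemma Sh3_0 : Sh3 Om M k (fun=> fun=> 0).
Proof. by move=> m; exact: Sh0. Qed.

Lemma sum_lin (n : nat) (a : R) (F F1 F2 : 'I_n -> R) :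
  (forall m, F m = a * F1 m + F2 m) ->
  \sum_m F m = a * (\sum_m F1 m) + \sum_m F2 m.
Proof. by move=> E; rewrite (eq_bigr _ (fun m _ => E m)) big_split mulr_sumr. Qed.

Local Notation H2 := (H2_inner Om Sig M).

Lemma H2_inner_lin a u v w : Sh3 Om M k u -> Sh3 Om M k v -> Sh3 Om M k w ->
  H2 (tlin a u v) w = a * H2 u w + H2 v w.
Proof.
move=> hu hv hw; apply: sum_lin => m.
exact: (H2_form_lin Sig oOm bOm hreg hconf a (hu m) (hv m) (hw m)).
Qed.

Lemma H2_innerC u v : H2 u v = H2 v u.
Proof. by apply: eq_bigr => m _; exact: H2_formC. Qed.

Lemma H2_inner_ge0 u : 0 <= H2 u u.
Proof. by apply: sumr_ge0 => m _; exact: H2_form_ge0. Qed.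

(** Functions are defined on the whole plane, but the forms only see their
    values on the closed domain. *)
Lemma H2_inner_congr u u' v v' : (forall m x, closure Om x -> u m x = u' m x) ->
  (forall m x, closure Om x -> v m x = v' m x) -> H2 u v = H2 u' v'.
Proof.
move=> hu hv; apply: eq_bigr => m _.
exact: (H2_form_congr Sig hconf (hu m) (hv m)).
Qed.

Lemma H2_inner_eq0 u : Sh3 Om M k u -> H2 u u = 0 ->
  forall m x, closure Om x -> u m x = 0.
Proof.
move=> hu h m; apply: (Sh_L2_eq0 oOm bOm (hu m)).
apply/eqP; rewrite eq_le L2_ge0 andbT.
apply: le_trans (H2_form_ge Om Sig M (u m)) _.
rewrite -h /H2_inner (bigD1 m)//= lerDl.
by apply: sumr_ge0 => j _; exact: H2_form_ge0.
Qed.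

Local Notation HH := (Hg Sig M g l).
Local Notation aBB := (aB Om Sig M g mu lambda gamma l).

Let frobH (y v : tfield) (x : R * R) : R := \sum_m frob (HH (y m) x) (HH (v m) x).
Let trH (y v : tfield) (x : R * R) : R := \sum_m \tr (HH (y m) x) * \tr (HH (v m) x).
Let jumps (y v : tfield) : R := \sum_m jump_form Sig M (y m) (v m).

Let aBE y v : aBB y v = mu / 6 * \int[mu2]_(x in Om) frobH y v x +
  mu * lambda / (6 * (2 * mu + lambda)) * \int[mu2]_(x in Om) trH y v x +
  gamma * jumps y v.
Proof. by []. Qed.

Let frobH_bmeas y v : Sh3 Om M k y -> Sh3 Om M k v -> bmeas (Om : set T2R) (frobH y v).
Proof.
move=> hy hv; apply: bmeas_sum => m _; apply: bmeas_frob => i j.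
  exact: (Hg_bmeas Sig l oOm hreg hconf hg i j (hy m)).
exact: (Hg_bmeas Sig l oOm hreg hconf hg i j (hv m)).
Qed.

Let trH_bmeas y v : Sh3 Om M k y -> Sh3 Om M k v -> bmeas (Om : set T2R) (trH y v).
Proof.
move=> hy hv; apply: bmeas_sum => m _; apply: bmeasM; apply: bmeas_tr => i j.
  exact: (Hg_bmeas Sig l oOm hreg hconf hg i j (hy m)).
exact: (Hg_bmeas Sig l oOm hreg hconf hg i j (hv m)).
Qed.

Lemma comb3_lin (a c1 c2 c3 x1 y1 z1 x2 y2 z2 x3 y3 z3 : R) : x1 = a * y1 + z1 ->
  x2 = a * y2 + z2 -> x3 = a * y3 + z3 ->
  c1 * x1 + c2 * x2 + c3 * x3 =
  a * (c1 * y1 + c2 * y2 + c3 * y3) + (c1 * z1 + c2 * z2 + c3 * z3).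
Proof. by move=> -> -> ->; ring. Qed.

Lemma aB_lin a u v w : Sh3 Om M k u -> Sh3 Om M k v -> Sh3 Om M k w ->
  aBB (tlin a u v) w = a * aBB u w + aBB v w.
Proof.
move=> hu hv hw; rewrite !aBE; apply: comb3_lin.
- apply: (RintOm_lin oOm bOm (frobH_bmeas hu hw) (frobH_bmeas hv hw)) => x.
  apply: sum_lin => m.
  by rewrite (Hg_lin Sig g l hreg hconf a x (hu m) (hv m)) frob_linl.
- apply: (RintOm_lin oOm bOm (trH_bmeas hu hw) (trH_bmeas hv hw)) => x.
  apply: sum_lin => m.
  by rewrite (Hg_lin Sig g l hreg hconf a x (hu m) (hv m)) mxtrace_lin mulrDl mulrA.
- apply: sum_lin => m.
  exact: (jump_form_lin Sig hreg hconf a (hu m) (hv m) (hw m)).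
Qed.

Lemma aBC u v : aBB u v = aBB v u.
Proof.
rewrite !aBE.
have e1 : \int[mu2]_(x in Om) frobH u v x = \int[mu2]_(x in Om) frobH v u x.
  by apply: Rint_eq => x _; apply: eq_bigr => m _; exact: frobC.
have e2 : \int[mu2]_(x in Om) trH u v x = \int[mu2]_(x in Om) trH v u x.
  by apply: Rint_eq => x _; apply: eq_bigr => m _; exact: mulrC.
have e3 : jumps u v = jumps v u by apply: eq_bigr => m _; exact: jump_formC.
exact: (congr3 (fun r s t => mu / 6 * r + mu * lambda / (6 * (2 * mu + lambda)) * s
  + gamma * t) e1 e2 e3).
Qed.

Lemma den_gt0 : 0 < 2 * mu + lambda.
Proof. by rewrite ltr_wpDr// mulr_gt0. Qed.

Lemma aB_ge0 u : 0 <= aBB u u.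
Proof.
have d0 := den_gt0.
rewrite aBE !addr_ge0//; apply: mulr_ge0.
- by rewrite divr_ge0// ltW.
- by apply: Rintegral_ge0 => x _; apply: sumr_ge0 => m _; exact: frob_ge0.
- by rewrite divr_ge0 ?mulr_ge0// ltW.
- by apply: Rintegral_ge0 => x _; apply: sumr_ge0 => m _; rewrite -expr2 sqr_ge0.
- exact: ltW.
- by apply: sumr_ge0 => m _; exact: jump_form_ge0.
Qed.

Lemma Hg_congr u v : (forall x, closure Om x -> u x = v x) -> HH u = HH v.
Proof.
move=> uv; suff E : dhess Sig M l u = dhess Sig M l v by rewrite /Hg E.
apply/funext => x; rewrite /dhess (hess_congr hconf uv).
apply: (congr1 (fun S : 'M[R]_2 => hess M v x - S)); apply: eq_bigr => e _.
exact: (congr1 (fun f => lifting l e f x) (jump_grad_congr hconf e uv)).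
Qed.

Lemma jump_form_congr u v w : (forall x, closure Om x -> u x = v x) ->
  jump_form Sig M w u = jump_form Sig M w v.
Proof.
move=> uv; rewrite /jump_form; apply: eq_bigr => e _.
exact: (congr1 (fun f => (he e)^-1 * int_edge e (fun t => frob (jump_grad e w t) (f t)))
  (jump_grad_congr hconf e uv)).
Qed.

Lemma aB_congr w u v : (forall m x, closure Om x -> u m x = v m x) -> aBB w u = aBB w v.
Proof.
move=> uv; rewrite !aBE.
have e1 : \int[mu2]_(x in Om) frobH w u x = \int[mu2]_(x in Om) frobH w v x.
  apply: Rint_eq => x _; apply: eq_bigr => m _.
  exact: (congr1 (fun f : _ -> 'M[R]_2 => frob (HH (w m) x) (f x)) (Hg_congr (uv m))).
have e2 : \int[mu2]_(x in Om) trH w u x = \int[mu2]_(x in Om) trH w v x.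
  apply: Rint_eq => x _; apply: eq_bigr => m _.
  exact: (congr1 (fun f : _ -> 'M[R]_2 => \tr (HH (w m) x) * \tr (f x)) (Hg_congr (uv m))).
have e3 : jumps w u = jumps w v.
  by apply: eq_bigr => m _; exact: (jump_form_congr _ (uv m)).
exact: (congr3 (fun r s t => mu / 6 * r + mu * lambda / (6 * (2 * mu + lambda)) * s
  + gamma * t) e1 e2 e3).
Qed.

Local Notation aSS := (aS Om M g mu lambda).

Lemma comb2_lin (a c1 c2 x1 y1 z1 x2 y2 z2 : R) : x1 = a * y1 + z1 ->
  x2 = a * y2 + z2 -> c1 * x1 + c2 * x2 =
  a * (c1 * y1 + c2 * y2) + (c1 * z1 + c2 * z2).
Proof. by move=> -> ->; ring. Qed.

Lemma comb2B_lin (a c x1 y1 z1 x2 y2 z2 : R) : x1 = a * y1 + z1 ->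
  x2 = a * y2 + z2 -> c * x1 - x2 = a * (c * y1 - y2) + (c * z1 - z2).
Proof. by move=> -> ->; ring. Qed.

Lemma aS_lin a y u v : Sh3 Om M k y -> Sh3 Om M k u -> Sh3 Om M k v ->
  aSS y y (tlin a u v) = a * aSS y y u + aSS y y v.
Proof.
move=> hy hu hv.
have b w : Sh3 Om M k w -> bmeas (Om : set T2R)
    (fun x => frob (dstrain M g y w x) (strain M g y x)).
  move=> hw; apply: bmeas_frob => i j.
    exact: (dstrain_bmeas oOm hreg hg i j hy hw).
  exact: (strain_bmeas oOm hreg hg i j hy).
have c w : Sh3 Om M k w -> bmeas (Om : set T2R)
    (fun x => \tr (dstrain M g y w x) * \tr (strain M g y x)).
  move=> hw; apply: bmeasM; apply: bmeas_tr => i j.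
    exact: (dstrain_bmeas oOm hreg hg i j hy hw).
  exact: (strain_bmeas oOm hreg hg i j hy).
apply: comb2_lin.
- apply: (RintOm_lin oOm bOm (b u hu) (b v hv)) => x.
  by rewrite (dstrain_lin g hreg a y x hu hv) frob_linl.
- apply: (RintOm_lin oOm bOm (c u hu) (c v hv)) => x.
  by rewrite (dstrain_lin g hreg a y x hu hv) mxtrace_lin mulrDl mulrA.
Qed.

Lemma aS_congr y u v : (forall m x, closure Om x -> u m x = v m x) ->
  aSS y y u = aSS y y v.
Proof.
move=> uv; suff E : jac M u = jac M v by rewrite /aS /dstrain E.
apply/funext => x; apply/matrixP => i j.
have JE w : jac M w x i j = grad M (w i) x j ord0 := mxE _ _ _ _.
apply: (etrans (JE u)); apply: (etrans _ (esym (JE v))).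
exact: (congr1 (fun f : _ -> 'cV[R]_2 => f x j ord0) (grad_congr hconf (uv i))).
Qed.

Opaque H2_inner aB aS.

(** The bilinear form of one step, and the functional on its right-hand side. *)
Definition step_form (z v : tfield) : R := tau^-1 * H2 z v + theta ^+ 2 * aBB z v.
Definition step_rhs (y v : tfield) : R := tau^-1 * H2 y v - aSS y y v.

Lemma step_form_linl a u v w : Sh3 Om M k u -> Sh3 Om M k v -> Sh3 Om M k w ->
  step_form (tlin a u v) w = a * step_form u w + step_form v w.
Proof.
by move=> hu hv hw; apply: comb2_lin; [exact: H2_inner_lin|exact: aB_lin].
Qed.

Lemma step_formC u v : step_form u v = step_form v u.
Proof. exact: (congr2 (fun r s => tau^-1 * r + theta ^+ 2 * s) (H2_innerC u v) (aBC u v)). Qed.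

Lemma step_form_linr a u v w : Sh3 Om M k u -> Sh3 Om M k v -> Sh3 Om M k w ->
  step_form w (tlin a u v) = a * step_form w u + step_form w v.
Proof.
move=> hu hv hw.
apply: (etrans (step_formC w (tlin a u v))); apply: (etrans (step_form_linl a hu hv hw)).
exact: (congr2 (fun r s => a * r + s) (step_formC u w) (step_formC v w)).
Qed.

Lemma step_rhs_lin y a u v : Sh3 Om M k y -> Sh3 Om M k u -> Sh3 Om M k v ->
  step_rhs y (tlin a u v) = a * step_rhs y u + step_rhs y v.
Proof.
move=> hy hu hv; apply: comb2B_lin (aS_lin a hy hu hv).
apply: (etrans (H2_innerC y (tlin a u v))); apply: (etrans (H2_inner_lin a hu hv hy)).
exact: (congr2 (fun r s => a * r + s) (H2_innerC u y) (H2_innerC v y)).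
Qed.

Lemma sum_eq0_fst (a b c : R) : 0 < a -> 0 <= b -> 0 <= c -> a * b + c = 0 -> b = 0.
Proof.
move=> a0 b0 c0 /eqP; rewrite paddr_eq0//; last exact: mulr_ge0 (ltW a0) b0.
by rewrite mulf_eq0 gt_eqF//= => /andP[/eqP].
Qed.

(** The form of one step is definite on the closed domain, thanks to the [L^2]
    term of the discrete inner product. *)
Lemma step_form_eq0 u : Sh3 Om M k u -> step_form u u = 0 ->
  forall m x, closure Om x -> u m x = 0.
Proof.
move=> hu h; apply: (H2_inner_eq0 hu).
have t0 : 0 < tau^-1 by rewrite invr_gt0.
exact: (sum_eq0_fst t0 (H2_inner_ge0 u) (mulr_ge0 (sqr_ge0 theta) (aB_ge0 u)) h).
Qed.

(** A discrete deformation that vanishes on the closed domain is in the kernel of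
    the form and of the functional. *)
Lemma step_null y u : Sh3 Om M k y -> Sh3 Om M k u ->
  (forall m x, closure Om x -> u m x = 0) ->
  step_rhs y u = 0 /\ forall v, Sh3 Om M k v -> step_form v u = 0.
Proof.
move=> hy hu u0; pose z0 : tfield := fun=> fun=> 0.
have c : forall m x, closure Om x -> u m x = z0 m x := u0.
have refl v : forall m x, closure Om x -> (v : tfield) m x = v m x by [].
have zz : tlin (-1) z0 z0 = z0.
  by apply/funext => m; apply/funext => x; rewrite /tlin /z0 mulr0 addr0.
have hz : Sh3 Om M k z0 := Sh3_0.
split.
  have -> : step_rhs y u = step_rhs y z0.
    by rewrite /step_rhs (H2_inner_congr (refl y) c) (aS_congr y c).
  by have := step_rhs_lin (-1) hy hz hz; rewrite zz mulN1r addNr.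
move=> v hv; have -> : step_form v u = step_form v z0.
  by rewrite /step_form (H2_inner_congr (refl v) c) (aB_congr v c).
by have := step_form_linr (-1) hz hz hv; rewrite zz mulN1r addNr.
Qed.

Local Notation step := (flow_step Om Sig M g mu lambda gamma theta l k tau).

Lemma step_balance (a p q r s : R) : a * (p - q) + r + s = 0 <-> a * p + s = a * q - r.
Proof. by split=> E; lra. Qed.

(** One step is a linear problem for the new iterate. *)
Lemma flow_stepE y z : Sh3 Om M k y -> step y z <->
  Sh3 Om M k z /\ forall v, Sh3 Om M k v -> step_form z v = step_rhs y v.
Proof.
move=> hy.
have D (hz : Sh3 Om M k z) v : Sh3 Om M k v ->
    H2 (fun m => z m \- y m) v = H2 z v - H2 y v.
  move=> hv; have := H2_inner_lin (-1) hy hz hv.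
  rewrite (_ : tlin (-1) y z = (fun m => z m \- y m)).
    by rewrite mulN1r addrC.
  by apply/funext => m; apply/funext => x; rewrite /tlin mulN1r addrC.
split=> -[hz E]; split => // v hv; have := E v hv.
  by rewrite (D hz v hv) => /step_balance.
by move=> E'; rewrite (D hz v hv); apply/step_balance.
Qed.

Lemma flow_step_exists y : Sh3 Om M k y -> exists z, step y z.
Proof.
move=> hy.
pose I := ('I_3 * 'I_(nelem M) * ('I_k.+1 * 'I_k.+1))%type.
pose rep (c : I -> R) (v : tfield) := forall m T x, ref_elem (is_quad (elt T)) x ->
  v m (emap (elt T) x) = \sum_(a < k.+1) \sum_(b < k.+1 | is_quad (elt T) || (a + b <= k)%N)
      c (m, T, (a, b)) * x.1 ^+ a * x.2 ^+ b.
have linE a (u v : tfield) : a *: u + v = tlin a u v by [].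
have rep0 u : rep (fun=> 0) u -> forall m x, closure Om x -> u m x = 0.
  move=> hu m x; rewrite -hconf.1 => -[T _ [p rp <-]].
  by rewrite (hu m T p rp); do 2 (rewrite big1// => ? _); rewrite !mul0r.
have [|||||||||z hz Ez] := @galerkin R tfield I (Sh3 Om M k) rep step_form (step_rhs y).
- exact: Sh3_0.
- by move=> a u v hu hv; exact: (Sh3_lin a hu hv).
- move=> u hu.
  have H (q : 'I_3 * 'I_(nelem M)) : exists c : 'M[R]_k.+1, forall x,
      ref_elem (is_quad (elt q.2)) x -> u q.1 (emap (elt q.2) x) =
      \sum_(a < k.+1) \sum_(b < k.+1 | is_quad (elt q.2) || (a + b <= k)%N)
        c a b * x.1 ^+ a * x.2 ^+ b.
    have [p [c hc] hp] := (hu q.1).2 q.2; exists c => x rx.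
    by rewrite hp// hc.
  have [C hC] := choice H.
  exists (fun z : I => C z.1 z.2.1 z.2.2) => m T x rx.
  exact: (hC (m, T) x rx).
- move=> a c d u v hu hv m T x rx.
  rewrite linE /tlin (hu m T x rx) (hv m T x rx).
  rewrite mulr_sumr -big_split; apply: eq_bigr => a' _ /=.
  rewrite mulr_sumr -big_split; apply: eq_bigr => b' _ /=.
  ring.
- by move=> a u v w hu hv hw; exact: (step_form_linl a hu hv hw).
- by move=> a u v w hu hv hw; exact: (step_form_linr a hu hv hw).
- by move=> a u v hu hv; exact: (step_rhs_lin a hy hu hv).
- by move=> u hu h; exact: (step_null hy hu (step_form_eq0 hu h)).1.
- by move=> u hu /rep0 h; exact: (step_null hy hu h).
by exists z; apply/(flow_stepE z hy).
Qed.

(** Uniqueness holds on the closed domain; the values outside are not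
    constrained. *)
Lemma flow_step_unique y z z' : Sh3 Om M k y -> step y z -> step y z' ->
  forall m x, closure Om x -> z m x = z' m x.
Proof.
move=> hy /(flow_stepE z hy)[hz Ez] /(flow_stepE z' hy)[hz' Ez'] m x cx.
pose d := tlin (-1) z' z; have hd : Sh3 Om M k d := Sh3_lin (-1) hz' hz.
have dd : step_form d d = 0.
  by rewrite [LHS](step_form_linl (-1) hz' hz hd) (Ez d hd) (Ez' d hd) mulN1r addNr.
have := step_form_eq0 hd dd m cx.
by rewrite /d /tlin mulN1r addrC => /eqP; rewrite subr_eq0 => /eqP.
Qed.

Lemma energy_ge0 y : 0 <= energy Om Sig M g mu lambda gamma theta l y.
Proof.
have d0 := den_gt0.
have hS : 0 <= energyS Om M g mu lambda y.
  apply: mulr_ge0; first by rewrite invr_ge0.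
  apply: Rintegral_ge0 => x _; apply: addr_ge0.
    by apply: mulr_ge0; [rewrite mulr_ge0// ltW|exact: frob_ge0].
  by apply: mulr_ge0 => //; exact: sqr_ge0.
have hB : 0 <= energyB Om Sig M g mu lambda gamma l y.
  apply: addr_ge0; apply: mulr_ge0.
  - by rewrite invr_ge0.
  - apply: Rintegral_ge0 => x _; apply: addr_ge0; apply: mulr_ge0.
    + by rewrite mulr_ge0// ltW.
    + by apply: sumr_ge0 => m _; exact: frob_ge0.
    + by rewrite divr_ge0 ?mulr_ge0// ltW.
    + by apply: sumr_ge0 => m _; exact: sqr_ge0.
  - by rewrite divr_ge0// ltW.
  - by apply: sumr_ge0 => m _; exact: jump_form_ge0.
by rewrite addr_ge0// mulr_ge0 ?sqr_ge0.
Qed.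

End Scheme.

(** * Decay of the energy *)

Section Descent.
Context {R : realType}.

Lemma hmin_gt0 (M : mesh R) (a : R) : 0 < a -> (0 < nelem M)%N ->
  (forall T : 'I_(nelem M), a <= hT (elt T)) -> 0 < hmin M.
Proof.
move=> a0 n0 ha; apply: (lt_le_trans a0); apply: lb_le_inf.
  by exists (hT (elt (Ordinal n0))), (Ordinal n0).
by move=> _ [T _ <-].
Qed.

Lemma nelem_gt0 (Om : set (R * R)) (M : mesh R) :
  Om !=set0 -> conforming Om M -> (0 < nelem M)%N.
Proof.
move=> [x Ox] [cov _]; have := subset_closure Ox; rewrite -cov => -[T _ _].
exact: (leq_ltn_trans (leq0n T)).
Qed.

(** The admissible step size does not increase with the energy; [i] stands for
    the inverse of the smallest element diameter. *)
Lemma time_step_mono (C i tau E E' : R) : 0 < C -> 0 < i -> 0 < tau -> 0 <= E' -> E' <= E ->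
  let d e := (1 + tau ^+ 2 * e) * i * (1 + Num.sqrt e) + tau * e + Num.sqrt e in
  tau <= 1 / (C * d E) -> tau <= 1 / (C * d E').
Proof.
move=> C0 i0 tau0 E0 EE d /le_trans; apply.
have E1 : 0 <= E := le_trans E0 EE.
have s0 := sqrtr_ge0 E'; have sE : Num.sqrt E' <= Num.sqrt E by exact: ler_wsqrtr.
have t2 : 0 < tau ^+ 2 by rewrite exprn_gt0.
have f0 : 0 < (1 + tau ^+ 2 * E') * i.
  by rewrite mulr_gt0// ltr_wpDr// mulr_ge0// ltW.
have dE' : 0 < d E'.
  rewrite /d -addrA ltr_wpDr//; first by rewrite addr_ge0// mulr_ge0// ltW.
  by rewrite mulr_gt0// ltr_wpDr.
have dd : d E' <= d E.
  rewrite /d; apply: lerD => //; apply: lerD; last by rewrite ler_pM2l.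
  apply: ler_pM; [exact: ltW|by rewrite addr_ge0| |by rewrite lerD2l].
  by rewrite ler_pM2r// lerD2l ler_pM2l.
rewrite !div1r lef_pV2 ?posrE; first by rewrite ler_pM2l.
  by rewrite mulr_gt0// (lt_le_trans dE' dd).
by rewrite mulr_gt0.
Qed.

Lemma telescope_descent (a : R) (E D : nat -> R) :
  (forall n, E n.+1 + a * D n <= E n) ->
  forall N, E N.+1 + a * \sum_(0 <= n < N.+1) D n <= E 0%N.
Proof.
move=> h; elim=> [|N IH]; first by rewrite big_nat1; exact: h.
rewrite big_nat_recr//= mulrDr; apply: le_trans IH.
by have := h N.+1; lra.
Qed.

End Descent.

Theorem corollary5p3 (R : realType) (Om Sig : set (R * R))
  (g : R * R -> 'M[R]_2) (mu lambda gamma : R) (k l : nat)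
  (H : set R) (M : R -> mesh R) (C : R)
  (hOm : lipschitz_domain Om) (hSig : crease Om Sig) (hg : metric_field Om g)
  (hmu : 0 < mu) (hlambda : 0 <= lambda) (hgamma : 0 < gamma)
  (hk : (2 <= k)%N) (hM : mesh_sequence Om Sig k H M)
  (hC : 0 < C)
  (one_step : forall (h theta tau : R) (y z : 'I_3 -> R * R -> R),
    H h -> 0 < theta -> 0 < tau -> Sh3 Om (M h) k y ->
    tau <= 1 / (C * dstep Om Sig (M h) g mu lambda gamma theta l tau y) ->
    flow_step Om Sig (M h) g mu lambda gamma theta l k tau y z ->
    energy Om Sig (M h) g mu lambda gamma theta l z
      + 1 / (2 * tau) *
        H2_inner Om Sig (M h) (fun m => z m \- y m) (fun m => z m \- y m)
      <= energy Om Sig (M h) g mu lambda gamma theta l y) :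
  forall (h theta tau : R) (y0 : 'I_3 -> R * R -> R),
    H h -> 0 < theta -> 0 < tau -> Sh3 Om (M h) k y0 ->
    tau <= 1 / (C * dstep Om Sig (M h) g mu lambda gamma theta l tau y0) ->
    let step := flow_step Om Sig (M h) g mu lambda gamma theta l k tau in
    let iterates (y : nat -> 'I_3 -> R * R -> R) :=
      y 0%N = y0 /\ forall n, step (y n) (y n.+1) in
    (exists y, iterates y) /\
    (forall y, iterates y ->
       (forall n z, step (y n) z ->
          forall m x, closure Om x -> z m x = y n.+1 m x) /\
       (forall N : nat,
          energy Om Sig (M h) g mu lambda gamma theta l (y N.+1)
            + 1 / (2 * tau) * \sum_(0 <= n < N.+1)
                H2_inner Om Sig (M h) (fun m => y n.+1 m \- y n m)
                                      (fun m => y n.+1 m \- y n m)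
            <= energy Om Sig (M h) g mu lambda gamma theta l y0)).
Proof.
move=> h theta tau y0 Hh theta0 tau0 Sy0 ty0 step iterates.
have [oOm _ nOm bOm _] := hOm.
have [mesh_h [c c0 iso] _ [c' c'0 quasi]] := hM.
have [h0 _ conf _] := mesh_h h Hh.
have reg (T : 'I_(nelem (M h))) : regular (elt T) :=
  isoparametric_regular (ltnW hk) (iso h Hh T).
have hm0 : 0 < (hmin (M h))^-1.
  rewrite invr_gt0; apply: (@hmin_gt0 _ _ (c' * h)); first exact: mulr_gt0.
    exact: nelem_gt0 nOm conf.
  by move=> T; exact: quasi.
pose En := energy Om Sig (M h) g mu lambda gamma theta l.
pose H2 := H2_inner Om Sig (M h).
have En0 y : 0 <= En y by exact: (energy_ge0 _ _ _ _ _ theta hmu hlambda hgamma y).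
have stepS y z : step y z -> Sh3 Om (M h) k z by case.
split.
  have ex (y : 'I_3 -> R * R -> R) : exists z, Sh3 Om (M h) k y -> step y z.
    have [Sy|nSy] := pselect (Sh3 Om (M h) k y); last by exists y.
    have [z yz] := flow_step_exists Sig l oOm bOm reg conf hg theta hmu hlambda hgamma tau0 Sy.
    by exists z.
  have [f hf] := choice ex.
  exists (fun n => iter n f y0); split => // n.
  apply: (hf _); elim: n => [//|n IH]; exact: (stepS _ _ (hf _ IH)).
move=> y [y00 yn].
have Sy n : Sh3 Om (M h) k (y n).
  by case: n => [|n]; [rewrite y00|exact: stepS (yn n)].
split.
  move=> n z yz; exact: (flow_step_unique oOm bOm reg conf hg hmu hlambda hgamma tau0 (Sy n) yz (yn n)).
pose D n := H2 (fun m => y n.+1 m \- y n m) (fun m => y n.+1 m \- y n m).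
have drop n : tau <= 1 / (C * dstep Om Sig (M h) g mu lambda gamma theta l tau (y n)) ->
    En (y n.+1) + 1 / (2 * tau) * D n <= En (y n).
  by move=> tn; exact: (one_step h theta tau (y n) (y n.+1) Hh theta0 tau0 (Sy n) tn (yn n)).
have mono n : En (y n.+1) + 1 / (2 * tau) * D n <= En (y n) -> En (y n.+1) <= En (y n).
  apply: le_trans; rewrite lerDl; apply: mulr_ge0; last exact: (H2_inner_ge0 Om Sig (M h) _).
  by rewrite divr_ge0// mulr_ge0// ltW.
(* The admissible step size does not shrink, because the energy does not grow. *)
have adm n : tau <= 1 / (C * dstep Om Sig (M h) g mu lambda gamma theta l tau (y n)).
  elim: n => [|n IH]; first by rewrite y00.
  exact: (time_step_mono hC hm0 tau0 (En0 (y n.+1)) (mono n (drop n IH)) IH).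
move=> N; rewrite -y00.
exact: (telescope_descent (E := fun n => En (y n)) (fun n => drop n (adm n)) N).
Qed.
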